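(* Let $1<p\le2$. Then $\mathcal{Q}$ is a bounded projection on $\boldsymbol{S}_p$; that is, $\mathcal{Q}$ maps $\boldsymbol{S}_p$ into itself and is a bounded linear projection with respect to the norm of $\boldsymbol{S}_p$.
   Context: $\mathbb{R}_+=(0,\infty)$; $\boldsymbol{S}_p=\boldsymbol{S}_p(L^2(\mathbb{R}_+))$ is the Schatten--von Neumann class of operators $T$ on $L^2(\mathbb{R}_+)$ with $\|T\|_{\boldsymbol{S}_p}=\bigl(\sum_{n\ge0}s_n(T)^p\bigr)^{1/p}<\infty$, where $s_n(T)$ are the singular numbers. For a function $\varphi$ on $\mathbb{R}_+$, $Q_\varphi$ denotes the operator $(Q_\varphi f)(x)=\int_0^\infty\varphi(\max\{x,y\})f(y)\,dy$ on $L^2(\mathbb{R}_+)$. The averaging projection $\mathcal{Q}$ is defined on $\boldsymbol{S}_2$ as follows: if $T\in\boldsymbol{S}_2$ has kernel function $k\in L^2(\mathbb{R}_+\times\mathbb{R}_+)$, put $$\varphi(x)=\frac1{2x}\Bigl(\int_0^xk(x,t)\,dt+\int_0^xk(s,x)\,ds\Bigr),\quad x>0,$$ and $\mathcal{Q}T=Q_\varphi$. It is the orthogonal projection of $\boldsymbol{S}_2$ onto the set of operators in $\boldsymbol{S}_2$ of the form $Q_\psi$. For $p\le2$ one has $\boldsymbol{S}_p\subset\boldsymbol{S}_2$, so $\mathcal{Q}$ is defined on $\boldsymbol{S}_p$ by restriction. *)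

(* Defs.v *)
From HB Require Import structures.
From mathcomp Require Import all_boot all_order all_algebra.
From mathcomp Require Import generic_quotient.
From mathcomp Require Import all_classical all_reals all_analysis.
From mathcomp Require Import measurable_realfun.
From mathcomp Require Import complex.
From mathcomp Require Import ring.

Set Implicit Arguments.
Unset Strict Implicit.
Unset Printing Implicit Defensive.

Import Order.TTheory GRing.Theory Num.Theory.
Import numFieldNormedType.Exports.
Import Normc.

Local Notation Re := complex.Re.
Local Notation Im := complex.Im.

Local Open Scope classical_set_scope.
Local Open Scope ring_scope.
Local Open Scope quotient_scope.

(* Functions, kernels and operators are complex: scalars are R[i].  The library
   integrates real functions, hence the real and imaginary parts below. *)

Section ComplexValued.
Context d (T : measurableType d) (R : realType).
Variables (mu : {measure set T -> \bar R}) (D : set T).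
Implicit Types f g : T -> R[i].

Definition cmeasurable f : Prop :=
  measurable_fun D (fun x => Re (f x)) /\ measurable_fun D (fun x => Im (f x)).

Definition square_integrable f : Prop :=
  cmeasurable f /\ (\int[mu]_(x in D) (normc (f x) ^+ 2)%:E < +oo)%E.

Definition cintegral f : R[i] :=
  Complex (\int[mu]_(x in D) Re (f x)) (\int[mu]_(x in D) Im (f x)).

Lemma normc_sqrE (z : R[i]) : normc z ^+ 2 = Re z ^+ 2 + Im z ^+ 2.
Proof. by case: z => a b; rewrite /= sqr_sqrtr// addr_ge0// sqr_ge0. Qed.

Hypothesis mD : measurable D.

Lemma cmeasurable_normc_sqr f : cmeasurable f ->
  measurable_fun D (fun x => (normc (f x) ^+ 2)%:E).
Proof.
move=> [mr mi]; apply/measurable_EFinP.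
rewrite (_ : (fun _ => _) = (fun x => Re (f x) ^+ 2 + Im (f x) ^+ 2)); last first.
  by apply/funext => x; rewrite normc_sqrE.
by apply: measurable_funD; apply: measurable_funX.
Qed.

Lemma square_integrable0 : square_integrable (fun=> 0).
Proof.
split; first by split; exact: measurable_cst.
by rewrite normc0 expr0n/= integral0 ltry.
Qed.

Lemma square_integrable_linear (a : R[i]) f g :
  square_integrable f -> square_integrable g ->
  square_integrable (fun x => a * f x + g x).
Proof.
move=> [[fr fi] fi2] [[gr gi] gi2].
have mh : cmeasurable (fun x => a * f x + g x).
  split.
    rewrite (_ : (fun _ => _) =
        (fun x => (Re a * Re (f x) - Im a * Im (f x)) + Re (g x))).
      apply: measurable_funD => //.
      by apply: measurable_funB; apply: measurable_funM => //; exact: measurable_cst.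
    by apply/funext => x; case: (f x) (g x) a => ? ? [? ?] [? ?].
  rewrite (_ : (fun _ => _) =
      (fun x => (Re a * Im (f x) + Im a * Re (f x)) + Im (g x))).
    apply: measurable_funD => //.
    by apply: measurable_funD; apply: measurable_funM => //; exact: measurable_cst.
  by apply/funext => x; case: (f x) (g x) a => ? ? [? ?] [? ?].
split=> //.
pose c := 2 * normc a ^+ 2.
have c0 : 0 <= c by rewrite mulr_ge0// sqr_ge0.
apply: (@le_lt_trans _ _ (\int[mu]_(x in D)
   (c%:E * (normc (f x) ^+ 2)%:E + 2%:E * (normc (g x) ^+ 2)%:E))%E).
  apply: ge0_le_integral => //.
  - by move=> x _; rewrite lee_fin sqr_ge0.
  - exact: cmeasurable_normc_sqr.
  - by apply: emeasurable_funD; apply: measurable_funeM;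
      apply: cmeasurable_normc_sqr.
  - move=> x _; rewrite -!EFinM -EFinD lee_fin /c -mulrA -exprMn -normcM.
    move: (a * f x) (g x) => u v.
    rewrite !normc_sqrE; case: u v => [u1 u2] [v1 v2] /=.
    rewrite -subr_ge0.
    rewrite (_ : _ - _ = (u1 - v1) ^+ 2 + (u2 - v2) ^+ 2).
      by rewrite addr_ge0// sqr_ge0.
    by rewrite !sqrrD !sqrrN !mulr2n !mulrN; ring.
have sq0 (h : T -> R[i]) x : (0 <= (normc (h x) ^+ 2)%:E)%E.
  by rewrite lee_fin sqr_ge0.
rewrite ge0_integralD//; last first.
- by apply: measurable_funeM; exact: cmeasurable_normc_sqr.
- by move=> x _; rewrite mule_ge0.
- by apply: measurable_funeM; exact: cmeasurable_normc_sqr.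
- by move=> x _; rewrite mule_ge0.
rewrite !ge0_integralZl//; [|exact: cmeasurable_normc_sqr..].
by rewrite lte_add_pinfty// lte_mul_pinfty// ge0_fin_numE// integral_ge0.
Qed.

End ComplexValued.

Section L2.
Variable R : realType.

Definition Rpos : set (measurableTypeR R) := [set x | 0 < x].

Lemma measurable_Rpos : measurable Rpos.
Proof.
rewrite (_ : Rpos = `]0, +oo[%classic); first exact: measurable_itv.
by apply/seteqP; split => x /=; rewrite in_itv/= andbT.
Qed.

Definition L2fun_pred : pred (R -> R[i]) :=
  fun f => `[< square_integrable (@lebesgue_measure R) Rpos f >].

Definition L2fun := {f : R -> R[i] | L2fun_pred f}.
HB.instance Definition _ := Choice.on L2fun.
HB.instance Definition _ := SubType.on L2fun.

Definition L2_ae_eq (f g : L2fun) : bool :=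
  `[< {ae @lebesgue_measure R, forall x, Rpos x -> val f x = val g x} >].

Lemma L2_ae_eq_refl : reflexive L2_ae_eq.
Proof. by move=> f; apply/asboolP; apply: nearW. Qed.

Lemma L2_ae_eq_sym : symmetric L2_ae_eq.
Proof.
by move=> f g; apply/idP/idP => /asboolP h; apply/asboolP;
  apply: filterS h => x h /h.
Qed.

Lemma L2_ae_eq_trans : transitive L2_ae_eq.
Proof.
move=> g f h /asboolP fg /asboolP gh; apply/asboolP.
by apply: filterS2 fg gh => x fg gh Dx; rewrite fg// gh.
Qed.

Canonical L2_ae_eq_equiv :=
  EquivRel L2_ae_eq L2_ae_eq_refl L2_ae_eq_sym L2_ae_eq_trans.

(* The complex Hilbert space L^2(R_+). *)
Definition L2 : Type := {eq_quot L2_ae_eq}.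
HB.instance Definition _ := Choice.on L2.
HB.instance Definition _ := EqQuotient.on L2.

Lemma L2fun0_subproof : L2fun_pred (fun=> 0).
Proof. apply/asboolP; exact: square_integrable0. Qed.

Definition L2fun0 : L2fun := exist L2fun_pred (fun=> 0) L2fun0_subproof.

Definition L2repr (u : L2) : R -> R[i] := val (repr u).

(* The class of f in L^2(R_+); by convention 0 if f is not in L^2(R_+). *)
Definition L2class (f : R -> R[i]) : L2 := \pi_L2 (insubd L2fun0 f).

Lemma L2reprP (u : L2) :
  square_integrable (@lebesgue_measure R) Rpos (L2repr u).
Proof. exact/asboolP/(valP (repr u)). Qed.

Lemma L2reprK (u : L2) : L2class (L2repr u) = u.
Proof. by rewrite /L2class /L2repr valKd reprK. Qed.

Lemma L2classK (f : R -> R[i]) :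
  square_integrable (@lebesgue_measure R) Rpos f ->
  {ae @lebesgue_measure R, forall x, Rpos x -> L2repr (L2class f) x = f x}.
Proof.
move=> f2; rewrite /L2repr /L2class.
case: piP => g /eqmodP /asboolP; apply: filterS => x /[apply] <-.
by rewrite val_insubd ifT//; apply/asboolP.
Qed.

Lemma eq_L2class (f g : R -> R[i]) :
  square_integrable (@lebesgue_measure R) Rpos f ->
  square_integrable (@lebesgue_measure R) Rpos g ->
  {ae @lebesgue_measure R, forall x, Rpos x -> f x = g x} ->
  L2class f = L2class g.
Proof.
move=> f2 g2 fg; apply/eqmodP/asboolP; apply: filterS fg => x /[apply].
by rewrite !val_insubd !ifT//; apply/asboolP.
Qed.

Definition L2zero : L2 := L2class (fun=> 0).
Definition L2add (u v : L2) : L2 := L2class (fun x => L2repr u x + L2repr v x).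
Definition L2opp (u : L2) : L2 := L2class (fun x => - L2repr u x).
Definition L2scale (a : R[i]) (u : L2) : L2 := L2class (fun x => a * L2repr u x).

Local Notation sqint := (square_integrable (@lebesgue_measure R) Rpos).

Lemma sqint0 : sqint (fun=> 0). Proof. exact: square_integrable0. Qed.

Lemma sqintD f g : sqint f -> sqint g -> sqint (fun x => f x + g x).
Proof.
move=> f2 g2; have := square_integrable_linear measurable_Rpos 1 f2 g2.
by under [X in square_integrable _ _ X -> _]eq_fun do rewrite mul1r.
Qed.

Lemma sqintZ a f : sqint f -> sqint (fun x => a * f x).
Proof.
move=> f2; have := square_integrable_linear measurable_Rpos a f2 sqint0.
by under [X in square_integrable _ _ X -> _]eq_fun do rewrite addr0.
Qed.

Lemma sqintN f : sqint f -> sqint (fun x => - f x).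
Proof.
move=> /(sqintZ (-1)).
by under [X in square_integrable _ _ X -> _]eq_fun do rewrite mulN1r.
Qed.

Hint Resolve sqint0 L2reprP sqintD sqintZ sqintN : core.

Lemma L2addC : commutative L2add.
Proof.
move=> u v; apply: eq_L2class; [by auto..|].
by apply: nearW => x _; rewrite addrC.
Qed.

Lemma L2addA : associative L2add.
Proof.
move=> u v w; apply: eq_L2class; [by auto..|].
have h1 := L2classK (sqintD (L2reprP v) (L2reprP w)).
have h2 := L2classK (sqintD (L2reprP u) (L2reprP v)).
by apply: filterS2 h1 h2 => x h1 h2 Dx; rewrite h1// h2// addrA.
Qed.

Lemma L2add0 : left_id L2zero L2add.
Proof.
move=> u; rewrite -[RHS]L2reprK; apply: eq_L2class; [by auto..|].
by apply: filterS (L2classK sqint0) => x h Dx; rewrite h// add0r.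
Qed.

Lemma L2addN : left_inverse L2zero L2opp L2add.
Proof.
move=> u; apply: eq_L2class; [by auto..|].
by apply: filterS (L2classK (sqintN (L2reprP u))) => x h Dx; rewrite h// addNr.
Qed.

HB.instance Definition _ :=
  GRing.isZmodule.Build L2 L2addA L2addC L2add0 L2addN.

Lemma L2scaleA a b u : L2scale a (L2scale b u) = L2scale (a * b) u.
Proof.
apply: eq_L2class; [by auto..|].
by apply: filterS (L2classK (sqintZ b (L2reprP u))) => x h Dx; rewrite h// mulrA.
Qed.

Lemma L2scale1 : left_id 1 L2scale.
Proof.
move=> u; rewrite -[RHS]L2reprK; apply: eq_L2class; [by auto..|].
by apply: nearW => x _; rewrite mul1r.
Qed.

Lemma L2scaleDr : right_distributive L2scale +%R.
Proof.
move=> a u v; apply: eq_L2class; [by auto..|].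
have h1 := L2classK (sqintD (L2reprP u) (L2reprP v)).
have h2 := L2classK (sqintZ a (L2reprP u)).
have h3 := L2classK (sqintZ a (L2reprP v)).
apply: filterS3 h1 h2 h3 => x h1 h2 h3 Dx.
by rewrite h1// h2// h3// mulrDr.
Qed.

Lemma L2scaleDl u : {morph L2scale^~ u : a b / a + b}.
Proof.
move=> a b; apply: eq_L2class; [by auto..|].
have h2 := L2classK (sqintZ a (L2reprP u)).
have h3 := L2classK (sqintZ b (L2reprP u)).
by apply: filterS2 h2 h3 => x h2 h3 Dx; rewrite h2// h3// mulrDl.
Qed.

HB.instance Definition _ := GRing.Zmodule_isLmodule.Build R[i] L2
  L2scaleA L2scale1 L2scaleDr L2scaleDl.

Definition L2norm (u : L2) : R :=
  Num.sqrt (fine (\int[@lebesgue_measure R]_(x in Rpos)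
    (normc (L2repr u x) ^+ 2)%:E)).

End L2.

Section Schatten.
Variable R : realType.
Local Open Scope ereal_scope.
Implicit Types T K : L2 R -> L2 R.

Definition opnorm T : \bar R :=
  ereal_sup [set (L2norm (T u))%:E | u in [set u | (L2norm u <= 1)%R]].

Definition bounded_operator T : Prop := linear T /\ opnorm T < +oo.

Definition rank_le n T : Prop :=
  exists e : 'I_n -> L2 R, forall u, exists c : 'I_n -> R[i],
    T u = (\sum_(i < n) c i *: e i)%R.

(* s_n(T), as the distance from T to the operators of rank at most n; in
   particular s_0(T) is the operator norm. *)
Definition singular_number T (n : nat) : \bar R :=
  ereal_inf [set opnorm (T \- K)%R |
    K in [set K | bounded_operator K /\ rank_le n K]].

Definition schatten_norm (p : R) T : \bar R :=
  (\sum_(0 <= n <oo) singular_number T n `^ p) `^ (p^-1)%R.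

Definition schatten (p : R) : set (L2 R -> L2 R) :=
  [set T | bounded_operator T /\ schatten_norm p T < +oo].

End Schatten.

Section AveragingProjection.
Variable R : realType.
Local Notation mu := (@lebesgue_measure R).
Local Notation RxR := (measurableTypeR R * measurableTypeR R)%type.
Implicit Types (k : RxR -> R[i]) (phi : R -> R[i]).

(* L2class makes this 0 at the u whose image is not in L^2(R_+); there is no
   such u when k is in L^2(R_+ x R_+). *)
Definition integral_operator k : L2 R -> L2 R := fun u =>
  L2class (fun x => cintegral mu (@Rpos R) (fun y => k (x, y) * L2repr u y)).

Definition max_kernel phi : RxR -> R[i] := fun z => phi (Num.max z.1 z.2).

Definition Qop phi : L2 R -> L2 R := integral_operator (max_kernel phi).

Definition L2_kernels : set (RxR -> R[i]) :=
  [set k | square_integrable (mu \x mu)%E (@Rpos R `*` @Rpos R) k].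

(* Every T in S_2 is the integral operator of some k in L^2(R_+ x R_+), unique
   up to a null set; xget picks one such k.  The value 0 is only used for T
   outside S_2. *)
Definition kernel_of (T : L2 R -> L2 R) : RxR -> R[i] :=
  xget (fun=> 0) [set k | L2_kernels k /\ T = integral_operator k].

Definition averaged_symbol k : R -> R[i] := fun x =>
  (2 * real_complex R x)^-1 *
    (cintegral mu `]0, x[ (fun t => k (x, t)) +
     cintegral mu `]0, x[ (fun s => k (s, x))).

Definition averaging_projection (T : L2 R -> L2 R) : L2 R -> L2 R :=
  Qop (averaged_symbol (kernel_of T)).

End AveragingProjection.

(* Main.v *)
From HB Require Import structures.
From mathcomp Require Import all_boot all_order all_algebra.
From mathcomp Require Import spectral.
From mathcomp Require Import all_classical all_reals all_analysis.
From mathcomp Require Import measurable_realfun.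
From mathcomp Require Import complex.
From mathcomp Require Import ring lra zify.
Require Import Defs.

Set Implicit Arguments.
Unset Strict Implicit.
Unset Printing Implicit Defensive.

Import Order.TTheory GRing.Theory Num.Theory.
Import numFieldNormedType.Exports.
Import Normc.

Local Open Scope classical_set_scope.
Local Open Scope ring_scope.

Local Notation Re := complex.Re.
Local Notation Im := complex.Im.

(** Let [phi] be the averaged symbol of an operator [T] of class [p], and cut the
    half-line into the dyadic blocks from [a j] to [a j.+1 = 2 * a j].  The weight
    [w j] of a block is [a j] times the integral of [|phi|^2] over it.  The sum of
    the [w j `^ (p / 2)] is bounded by that of the powers [p] of the singular
    numbers of [T], and it bounds that of the singular numbers of [Qop phi].

    Weights of [T] ([weights_averaged]).  An operator of class [p <= 2] is
    Hilbert--Schmidt, so [T] has a kernel [k] ([hilbert_schmidt_kernel]), and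
    [phi] is half the sum of the averages from 0 to [x] of [k (x, .)] and [k (., x)].
    On a block the first one is controlled by the images under [T] of the
    normalized indicator of everything to the left of the block and of the cells
    of a fine grid in the block ([ae_lower_le]).  The indicators of different
    blocks are not orthogonal, but their inner products decay geometrically, so
    a multiple of the whole system is Bessel ([bessel_system]).  Mixing each block
    unitarily makes its images orthogonal, after which the local
    Hilbert--Schmidt norms become diagonal entries of [T] with respect to two
    Bessel systems ([block_hilbert_schmidt]).  The powers [p] of such entries sum
    to at most that of the singular numbers, because the squared moduli of the
    expansion coefficients have row and column sums at most 1 and [1 < p]
    ([diagonal_bound]).  The second average is the first one for the transposed
    kernel.

    Singular numbers of [Qop phi] ([Qop_singular]).  Fix a level [t].  After
    truncation, each block with [w j > t ^+ 2] is cut into about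
    [Num.sqrt (w j) / t] intervals for which length times the integral of
    [|phi|^2] is at most [t ^+ 2] ([energy_cut]).  Since [max_kernel phi] depends
    on the larger variable only, [Qop phi] is the sum of orthogonal corners over
    the squares of the intervals, of norm at most a multiple of [t], and of two
    rank one operators per interval ([max_kernel_piece]).  Dropping the rank one operators
    of the cut blocks costs a rank comparable with the number of intervals; those
    of the other blocks sum to an operator of norm at most a multiple of [t],
    again by the almost orthogonality of the dyadic indicators.  This
    estimates the number of singular numbers above a multiple of [t] by a sum of
    [Num.sqrt (w j) / t] over the blocks above level [t], and summation over
    dyadic [t] gives the bound for [1 < p] ([layer_cake_level]).

    Linearity and idempotence are properties of symbols: an operator determines
    the averages of its kernel almost everywhere ([lower_eq0]), and averaging the
    kernel of [Qop phi] returns [phi] ([averaged_symbol_max_kernel]). *)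

(** * Inner products, Bessel systems and unitary mixing *)

Section SquaredModulus.
Context {R : realType}.
Implicit Types z w : R[i].

Definition sqmod z : R := normc z ^+ 2.

Lemma sqmodE z : sqmod z = Re z ^+ 2 + Im z ^+ 2.
Proof. exact: normc_sqrE. Qed.

Lemma sqmod_ge0 z : 0 <= sqmod z.
Proof. exact: sqr_ge0. Qed.

Lemma sqmodM z w : sqmod (z * w) = sqmod z * sqmod w.
Proof. by rewrite /sqmod normcM exprMn. Qed.

Lemma mulCconj z : z * z^*%C = (sqmod z)%:C%C.
Proof.
rewrite sqmodE; case: z => a b; apply/eqP; rewrite eq_complex /=.
by apply/andP; split; apply/eqP; ring.
Qed.

Lemma sqmodJ z : sqmod z^*%C = sqmod z.
Proof. by rewrite !sqmodE; case: z => a b /=; rewrite sqrrN. Qed.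

Lemma sqmod_real (r : R) : sqmod r%:C%C = r ^+ 2.
Proof. by rewrite sqmodE /= expr0n addr0. Qed.

Lemma normc_real (r : R) : normc r%:C%C = `|r|.
Proof. by rewrite /= expr0n /= addr0 sqrtr_sqr. Qed.

Lemma sqmod0 : sqmod 0 = 0.
Proof. by rewrite (sqmod_real 0) expr0n. Qed.

Lemma sqmod1 : sqmod 1 = 1.
Proof. by rewrite (sqmod_real 1) expr1n. Qed.

Lemma sqmod_eq0 z : sqmod z = 0 -> z = 0.
Proof. by move=> /eqP; rewrite sqrf_eq0 => /eqP /eq0_normc. Qed.

Lemma normc_ge0 z : 0 <= normc z.
Proof. by case: z => a b; rewrite /= sqrtr_ge0. Qed.

Lemma sqmodD_le z w : sqmod (z + w) <= 2 * (sqmod z + sqmod w).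
Proof.
rewrite !sqmodE; case: z w => [a b] [c d] /=.
by have := sqr_ge0 (a - c); have := sqr_ge0 (b - d); nra.
Qed.

Lemma Re_sum (I : Type) (r : seq I) (P : pred I) (F : I -> R[i]) :
  Re (\sum_(i <- r | P i) F i) = \sum_(i <- r | P i) Re (F i).
Proof.
elim/big_rec2: _ => //= i a b _ <-.
by case: (F i) b => ? ? [].
Qed.

Lemma normc_sum_le (I : Type) (r : seq I) (P : pred I) (F : I -> R[i]) :
  normc (\sum_(i <- r | P i) F i) <= \sum_(i <- r | P i) normc (F i).
Proof.
elim/big_rec2: _ => [|i a b _ h]; first by rewrite normc0.
by rewrite (le_trans (le_normcD _ _))// lerD2l.
Qed.

Lemma normcJ z : normc z^*%C = normc z.
Proof. by case: z => a b /=; rewrite sqrrN. Qed.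

End SquaredModulus.

Section InnerProduct.
Context {R : realType}.
Local Notation C := R[i].

Record inner_product (V : lmodType C) := InnerProduct {
  dot :> V -> V -> C;
  dotDl : forall u v w, dot (u + v) w = dot u w + dot v w;
  dotZl : forall a u v, dot (a *: u) v = a * dot u v;
  dotC : forall u v, dot u v = (dot v u)^*%C;
  dot_ge0 : forall u, 0 <= Re (dot u u) }.

Context {V : lmodType C} (ip : inner_product V).
Local Notation "<| u , v |>" := (dot ip u v) (at level 0).

Definition nsq u : R := Re <| u, u |>.

Lemma nsqE u : nsq u = Re <| u, u |>. Proof. by []. Qed.

Lemma nsq_ge0 u : 0 <= nsq u. Proof. exact: dot_ge0. Qed.

Lemma dotDr u v w : <| u, v + w |> = <| u, v |> + <| u, w |>.
Proof. by rewrite dotC dotDl rmorphD/= -!dotC. Qed.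

Lemma dotZr a u v : <| u, a *: v |> = a^*%C * <| u, v |>.
Proof. by rewrite dotC dotZl rmorphM/= -dotC. Qed.

Lemma dot0l v : <| 0, v |> = 0.
Proof. by rewrite -(scale0r (0 : V)) dotZl mul0r. Qed.

Lemma dot0r v : <| v, 0 |> = 0.
Proof. by rewrite dotC dot0l conjc0. Qed.

Lemma dotNl u v : <| - u, v |> = - <| u, v |>.
Proof. by rewrite -scaleN1r dotZl mulN1r. Qed.

Lemma dotNr u v : <| u, - v |> = - <| u, v |>.
Proof. by rewrite dotC dotNl rmorphN/= -dotC. Qed.

Lemma dot_suml (I : Type) (r : seq I) (P : pred I) (F : I -> V) v :
  <| \sum_(i <- r | P i) F i, v |> = \sum_(i <- r | P i) <| F i, v |>.
Proof.
elim/big_rec2: _ => [|i a b _ <-]; first exact: dot0l.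
by rewrite dotDl.
Qed.

Lemma dot_sumr (I : Type) (r : seq I) (P : pred I) (F : I -> V) v :
  <| v, \sum_(i <- r | P i) F i |> = \sum_(i <- r | P i) <| v, F i |>.
Proof.
elim/big_rec2: _ => [|i a b _ <-]; first exact: dot0r.
by rewrite dotDr.
Qed.

Lemma dot_nsq u : <| u, u |> = (nsq u)%:C%C.
Proof.
have := dotC ip u u; rewrite /nsq; case: <| u, u |> => a b /= [h].
by apply/eqP; rewrite eq_complex /= eqxx/=; apply/eqP; lra.
Qed.

Lemma nsq0 : nsq 0 = 0. Proof. by rewrite /nsq dot0l. Qed.

Lemma nsqZ a u : nsq (a *: u) = sqmod a * nsq u.
Proof.
rewrite /nsq dotZl dotZr dot_nsq mulrA mulCconj -rmorphM/=.
by rewrite /nsq.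
Qed.

Lemma nsqN u : nsq (- u) = nsq u.
Proof. by rewrite /nsq dotNl dotNr opprK. Qed.

Lemma nsqD_le u v : nsq (u + v) <= 2 * (nsq u + nsq v).
Proof.
have := nsq_ge0 (u - v); rewrite /nsq !(dotDl, dotDr, dotNl, dotNr).
move: <| u, u |> <| u, v |> <| v, u |> <| v, v |> => [a1 a2] [b1 b2] [c1 c2] [d1 d2] /=.
lra.
Qed.

Lemma cauchy_schwarz u v : sqmod <| u, v |> <= nsq u * nsq v.
Proof.
set s := sqmod _; have s0 : 0 <= s by exact: sqmod_ge0.
have key (t : R) : 0 <= nsq u - 2 * t * s + t ^+ 2 * s * nsq v.
  have := nsq_ge0 (u - (t%:C%C * <| u, v |>) *: v).
  rewrite /nsq !(dotDl, dotDr, dotNl, dotNr, dotZl, dotZr) (dotC ip v u) dot_nsq.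
  rewrite (dot_nsq v) /s sqmodE.
  case: <| u, v |> => a b /=; rewrite !(mul0r, subr0, addr0, mulr0, oppr0, add0r) => h.
  by rewrite (le_trans h)// le_eqVlt; apply/orP; left; apply/eqP; ring.
have u0 := nsq_ge0 u; have := nsq_ge0 v; rewrite le_eqVlt => /orP[/eqP v0|v0].
  rewrite -v0 mulr0; case: (ltrP 0 s) => // sp.
  have := key ((nsq u + 1) / (2 * s)); rewrite -v0 mulr0 addr0.
  rewrite (_ : 2 * _ * s = nsq u + 1); last by field; rewrite gt_eqF.
  lra.
have := key (nsq v)^-1; rewrite (_ : _ + _ = nsq u - s / nsq v); last first.
  by field; rewrite gt_eqF.
by rewrite subr_ge0 ler_pdivrMr.
Qed.

Lemma dot_nsq0 u v : nsq u = 0 -> <| u, v |> = 0.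
Proof.
move=> u0; apply: sqmod_eq0; apply/le_anti; rewrite sqmod_ge0 andbT.
by rewrite (le_trans (cauchy_schwarz u v))// u0 mul0r.
Qed.

Lemma nsq_sum_orth (I : finType) (f : I -> V) (c : I -> C) :
  (forall i j, i != j -> <| f i, f j |> = 0) ->
  nsq (\sum_i c i *: f i) = \sum_i sqmod (c i) * nsq (f i).
Proof.
move=> fo; rewrite {1}/nsq dot_suml Re_sum; apply: eq_bigr => i _.
rewrite dot_sumr (bigD1 i)//= big1 ?addr0; last first.
  by move=> j ji; rewrite dotZl dotZr fo ?mulr0// eq_sym.
by rewrite -nsqZ.
Qed.

(** Bessel systems with bound 1: the synthesis map of [f] is a contraction of
    the Euclidean space.  Normalized indicators of nested intervals satisfy
    this up to a constant although they are not orthogonal, and the property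
    survives unitary mixing. *)
Definition bessel (I : finType) (f : I -> V) :=
  forall c : I -> C, nsq (\sum_i c i *: f i) <= \sum_i sqmod (c i).

Lemma bessel_orth (I : finType) (f : I -> V) :
  (forall i j, i != j -> <| f i, f j |> = 0) -> (forall i, nsq (f i) <= 1) ->
  bessel f.
Proof.
move=> fo f1 c; rewrite nsq_sum_orth//; apply: ler_sum => i _.
by rewrite ler_piMr// sqmod_ge0.
Qed.

Lemma bessel_le1 (I : finType) (f : I -> V) i : bessel f -> nsq (f i) <= 1.
Proof.
move=> /(_ (fun j => (j == i)%:R)).
rewrite (bigD1 i)//= eqxx scale1r big1 ?addr0; last first.
  by move=> j /negbTE ->; rewrite scale0r.
move=> /le_trans; apply.
rewrite (bigD1 i)//= eqxx sqmod1 big1 ?addr0// => j /negbTE ->.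
by rewrite sqmod0.
Qed.

(** The analysis map of a Bessel system is the adjoint of its synthesis map,
    hence a contraction as well. *)
Lemma bessel_dual (I : finType) (f : I -> V) u : bessel f ->
  \sum_i sqmod <| u, f i |> <= nsq u.
Proof.
move=> fb; pose c i := <| u, f i |>; set S := \sum_i _.
have S0 : 0 <= S by apply: sumr_ge0 => i _; exact: sqmod_ge0.
have E : <| u, \sum_i c i *: f i |> = S%:C%C.
  rewrite dot_sumr /S rmorph_sum/=; apply: eq_bigr => i _.
  by rewrite dotZr mulrC mulCconj.
have := cauchy_schwarz u (\sum_i c i *: f i); rewrite E sqmod_real => h.
have {}h : S ^+ 2 <= nsq u * S.
  by rewrite (le_trans h)// ler_wpM2l ?nsq_ge0//; exact: fb.
move: S0; rewrite le_eqVlt => /orP[/eqP <-|S0]; first exact: nsq_ge0.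
by move: h; rewrite expr2 ler_pM2r.
Qed.

Definition unitary (I : finType) (U : I -> I -> C) :=
  (forall i j, \sum_k (U k i)^*%C * U k j = (i == j)%:R) /\
  (forall k l, \sum_i U k i * (U l i)^*%C = (k == l)%:R).

Definition mix (I : finType) (U : I -> I -> C) (f : I -> V) k : V :=
  \sum_i U k i *: f i.

Section Unitary.
Context (I : finType) (U : I -> I -> C) (hU : unitary U).

Lemma unitary_col i : \sum_k sqmod (U k i) = 1.
Proof.
have := hU.1 i i; rewrite eqxx => /(congr1 (@complex.Re R)); rewrite Re_sum /= => <-.
by apply: eq_bigr => k _; rewrite mulrC mulCconj.
Qed.

Lemma unitary_row k : \sum_i sqmod (U k i) = 1.
Proof.
have := hU.2 k k; rewrite eqxx => /(congr1 (@complex.Re R)); rewrite Re_sum /= => <-.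
by apply: eq_bigr => i _; rewrite mulCconj.
Qed.

Lemma mixK (f : I -> V) i : f i = \sum_k (U k i)^*%C *: mix U f k.
Proof.
under eq_bigr do rewrite /mix scaler_sumr.
rewrite exchange_big /=.
under eq_bigr => j _ do under eq_bigr do rewrite scalerA.
under eq_bigr do rewrite -scaler_suml hU.1.
rewrite (bigD1 i)//= eqxx scale1r big1 ?addr0// => j ji.
by rewrite eq_sym (negbTE ji) scale0r.
Qed.

Lemma unitary_isometry (c : I -> C) : \sum_i sqmod (\sum_k c k * U k i) = \sum_k sqmod (c k).
Proof.
apply: (@complexI R); rewrite !rmorph_sum/=.
under eq_bigr do rewrite -mulCconj rmorph_sum/= mulr_suml.
rewrite exchange_big /=; apply: eq_bigr => k _; rewrite -mulCconj.
transitivity (\sum_l c k * (c l)^*%C * \sum_i U k i * (U l i)^*%C).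
  under eq_bigr do rewrite mulr_sumr.
  rewrite exchange_big /=; apply: eq_bigr => l _; rewrite mulr_sumr.
  by apply: eq_bigr => i _; rewrite rmorphM/= mulrACA.
rewrite (bigD1 k)//= hU.2 eqxx mulr1 big1 ?addr0// => l lk.
by rewrite hU.2 eq_sym (negbTE lk) mulr0.
Qed.

Lemma bessel_mix (f : I -> V) : bessel f -> bessel (mix U f).
Proof.
move=> fb c.
have -> : \sum_k c k *: mix U f k = \sum_i (\sum_k c k * U k i) *: f i.
  under eq_bigr do rewrite /mix scaler_sumr.
  rewrite exchange_big /=; apply: eq_bigr => i _; rewrite scaler_suml.
  by apply: eq_bigr => k _; rewrite scalerA.
by apply: (le_trans (fb _)); rewrite unitary_isometry.
Qed.

Lemma nsq_mix (f : I -> V) : \sum_k nsq (mix U f k) = \sum_i nsq (f i).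
Proof.
apply: (@complexI R); rewrite !rmorph_sum/=.
under eq_bigr do rewrite -dot_nsq {1}/mix dot_suml.
rewrite exchange_big /=; apply: eq_bigr => i _; rewrite -dot_nsq.
rewrite {3}(mixK f i) dot_sumr; apply: eq_bigr => k _.
by rewrite dotZl dotZr conjcK.
Qed.

End Unitary.

(** Singular vectors of a finite system: the Gram matrix is Hermitian, so a
    unitary change of basis makes any finite family orthogonal. *)
Lemma gram_diagonalization (I : finType) (y : I -> V) :
  exists U, unitary U /\
    forall k l, k != l -> <| mix U y k, mix U y l |> = 0.
Proof.
pose n := #|I|; pose G : 'M[C]_n := \matrix_(i, j) <| y (enum_val i), y (enum_val j) |>.
have conjE (z : C) : Num.conj z = z^*%C by [].
have GH : map_mx Num.conj (G^T) = G.
  by apply/matrixP => i j; rewrite !mxE conjE -dotC.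
have Gn : G \is normalmx by apply/normalmxP; rewrite GH.
pose P := spectralmx G; have Pu : P \is unitarymx := spectral_unitarymx G.
have PP : P *m map_mx Num.conj (P^T) = 1%:M by apply/unitarymxP.
have PP' : map_mx Num.conj (P^T) *m P = 1%:M.
  by rewrite -(invmx_unitary Pu) mulVmx// unitarymx_unit.
exists (fun k i => P (enum_rank k) (enum_rank i)); split; first split.
- move=> i j; move/matrixP: PP' => /(_ (enum_rank i) (enum_rank j)).
  rewrite !mxE (inj_eq enum_rank_inj) => <-.
  rewrite (reindex (@enum_rank I)) /=; last by apply: onW_bij; exact: enum_rank_bij.
  by apply: eq_bigr => k _; rewrite !mxE conjE.
- move=> i j; move/matrixP: PP => /(_ (enum_rank i) (enum_rank j)).
  rewrite !mxE (inj_eq enum_rank_inj) => <-.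
  rewrite (reindex (@enum_rank I)) /=; last by apply: onW_bij; exact: enum_rank_bij.
  by apply: eq_bigr => k _; rewrite !mxE conjE.
move=> k l kl; rewrite /mix.
have D : P *m G *m map_mx Num.conj (P^T) = diag_mx (spectral_diag G).
  rewrite {1}(orthomx_spectralP Gn) -/P.
  rewrite !mulmxA mulmxV ?unitarymx_unit// mul1mx -mulmxA PP mulmx1.
  by [].
move/matrixP: D => /(_ (enum_rank k) (enum_rank l)).
rewrite !mxE (inj_eq enum_rank_inj) (negbTE kl) mulr0n => <-.
rewrite dot_sumr (reindex (@enum_rank I)) /=; last by apply: onW_bij; exact: enum_rank_bij.
apply: eq_bigr => j _; rewrite !mxE dotZr conjE mulrC; congr (_ * _).
rewrite dot_suml (reindex (@enum_rank I)) /=; last by apply: onW_bij; exact: enum_rank_bij.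
by apply: eq_bigr => i _; rewrite !mxE dotZl !enum_rankK.
Qed.

End InnerProduct.

(** * Lower bounds for singular numbers *)

Section ApproximationNumbers.
Context {R : realType}.
Local Notation C := R[i].
Context {V : lmodType C} (ip : inner_product V).
Local Notation "<| u , v |>" := (dot ip u v) (at level 0).
Local Notation nsq := (nsq ip).
Local Notation bessel := (bessel ip).
Local Notation mix := (@mix _ V _).

Lemma bessel_comp_inj (I J : finType) (h : J -> I) (f : I -> V) :
  injective h -> bessel f -> bessel (f \o h).
Proof.
move=> hi fb c; pose c' i := \sum_(j | h j == i) c j.
have -> : \sum_j c j *: (f \o h) j = \sum_i c' i *: f i.
  rewrite (partition_big h predT)//=; apply: eq_bigr => i _.
  rewrite scaler_suml; apply: eq_bigr => j /eqP <- //.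
apply: (le_trans (fb _)); rewrite [leRHS](partition_big h predT)//=.
apply: ler_sum => i _; rewrite /c'.
have [/existsP[j0 /eqP <-]|ne] := boolP [exists j, h j == i].
  rewrite (big_pred1 j0); last by move=> j; rewrite /= (inj_eq hi).
  by rewrite (big_pred1 j0)// => j; rewrite /= (inj_eq hi).
rewrite !big_pred0 ?sqmod0// => j; apply/negbTE; move: ne; rewrite negb_exists => /forallP/(_ j)//.
Qed.

Definition finrank n (K : V -> V) : Prop :=
  exists e : 'I_n -> V, forall u, exists c : 'I_n -> C,
    K u = \sum_(i < n) c i *: e i.

(** The inequality [s_n(T) <= a] for the approximation numbers, free of norms
    and infima. *)
Definition approximable (T : V -> V) n (a : R) : Prop :=
  exists K, [/\ linear K, finrank n K &
    forall u, nsq (T u - K u) <= a ^+ 2 * nsq u].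

Lemma linear_sumZ (T : V -> V) : linear T -> forall (I : finType) (c : I -> C) f,
  T (\sum_i c i *: f i) = \sum_i c i *: T (f i).
Proof.
move=> lT I c f.
have T0 : T 0 = 0.
  have := lT 1 0 0; rewrite !scale1r addr0 => /eqP.
  by rewrite -subr_eq0 opprD addrA subrr sub0r oppr_eq0 => /eqP.
elim/big_rec2: _ => // i a b _ <-; exact: lT.
Qed.

(** The rank of [K] is smaller than the number of the [F j], so some nonzero
    combination of them is killed by [K]; on it [T] and [T - K] agree, while
    [T] expands it at least by the factor [Num.sqrt l]. *)
Lemma approximable_lower_bound (T : V -> V) n (F : 'I_n.+1 -> V) (l a : R) :
  linear T -> bessel F ->
  (forall i j, i != j -> <| T (F i), T (F j) |> = 0) ->
  (forall j, l <= nsq (T (F j))) -> approximable T n a -> l <= a ^+ 2.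
Proof.
move=> lT bF oF lF [K [lK [e Ke] Ka]].
have [c cE] : exists c : 'I_n.+1 -> 'I_n -> C,
    forall j, K (F j) = \sum_(i < n) c j i *: e i.
  exists (fun j => sval (cid (Ke (F j)))) => j; exact: (svalP (cid (Ke (F j)))).
pose A : 'M[C]_(n.+1, n) := \matrix_(j, i) c j i.
have : kermx A != 0.
  rewrite -mxrank_eq0 mxrank_ker -lt0n subn_gt0.
  by rewrite (leq_ltn_trans (rank_leq_col A)).
move=> /rowV0Pn[v /sub_kermxP vA v0].
pose w := \sum_j v 0 j *: F j.
have Kw : K w = 0.
  rewrite linear_sumZ//; under eq_bigr do rewrite cE scaler_sumr.
  rewrite exchange_big /= big1// => i _; under eq_bigr do rewrite scalerA.
  rewrite -scaler_suml; move/rowP: vA => /(_ i); rewrite !mxE => vA.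
  rewrite (_ : \sum_j _ = 0) ?scale0r// -[RHS]vA.
  by apply: eq_bigr => j _; rewrite mxE.
have vpos : 0 < \sum_j sqmod (v 0 j).
  move/rV0Pn: v0 => [j vj]; rewrite (bigD1 j)//= ltr_wpDr//.
    by apply: sumr_ge0 => *; exact: sqmod_ge0.
  by rewrite lt_neqAle sqmod_ge0 andbT; apply: contra_neq vj => /esym/sqmod_eq0.
rewrite -(ler_pM2r vpos).
apply: (@le_trans _ _ (nsq (T w))).
  rewrite linear_sumZ// nsq_sum_orth// mulr_sumr; apply: ler_sum => j _.
  by rewrite mulrC ler_wpM2l// sqmod_ge0.
have := Ka w; rewrite Kw subr0 => /le_trans; apply.
by rewrite ler_wpM2l ?sqr_ge0//; exact: bF.
Qed.

Section Bounds.
Context (T : V -> V) (lT : linear T) (s : nat -> R).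
(* [s] is only known through the approximations it provides, as an infimum. *)
Hypothesis s_ge0 : forall n, 0 <= s n.
Hypothesis sP : forall n a, s n < a -> approximable T n a.

(** Sort the [F i] by decreasing [nsq (T (F i))] and apply the lower bound to
    the first [k + 1] of them. *)
Lemma sorted_singular_values (I : finType) (F : I -> V) :
  bessel F -> (forall i j, i != j -> <| T (F i), T (F j) |> = 0) ->
  exists2 e : 'I_#|I| -> I, bijective e &
    forall k, Num.sqrt (nsq (T (F (e k)))) <= s k.
Proof.
move=> bF oF; pose l i := nsq (T (F i)).
pose leT := [rel i j : I | l j <= l i].
have totT : total leT by move=> i j; exact: le_total.
have trT : transitive leT by move=> i j k /= h1 h2; exact: le_trans h2 h1.
have reT : reflexive leT by move=> i /=.
pose t := sort leT (enum I).
have st : size t = #|I| by rewrite size_sort cardE.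
have ut : uniq t by rewrite sort_uniq enum_uniq.
pose e (k : 'I_#|I|) := nth (enum_val k) t k.
have einj : injective e.
  move=> k k'; rewrite /e (set_nth_default (enum_val k)) ?st// => /eqP.
  by rewrite nth_uniq ?st// => /eqP kk; exact: val_inj.
exists e.
  by apply: inj_card_bij => //; rewrite card_ord.
move=> k; apply/ler_addgt0Pr => eps eps0.
pose F' (j : 'I_k.+1) := F (nth (enum_val k) t j).
have jk (j : 'I_k.+1) : (j < size t)%N by rewrite st; apply: leq_ltn_trans (ltn_ord k); rewrite -ltnS.
have hinj : injective (fun j : 'I_k.+1 => nth (enum_val k) t j).
  by move=> i j /eqP; rewrite nth_uniq// => /eqP ij; exact: val_inj.
have ap : approximable T k (s k + eps) by apply: sP; rewrite ltrDl.
have e0 : 0 <= s k + eps by rewrite addr_ge0// ltW.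
rewrite -(ger0_norm e0) -sqrtr_sqr ler_wsqrtr//.
apply: (@approximable_lower_bound T k F') => //.
- exact: (bessel_comp_inj hinj).
- by move=> i j ij; rewrite oF// (inj_eq hinj).
- move=> j; rewrite /e.
  apply: (sorted_leq_nth trT reT (enum_val k) (sort_sorted totT _)).
  + by rewrite inE; exact: jk.
  + by rewrite inE st.
  + by rewrite -ltnS.
Qed.

Lemma sum_singular_values (I : finType) (F : I -> V) p : 0 <= p ->
  bessel F -> (forall i j, i != j -> <| T (F i), T (F j) |> = 0) ->
  \sum_i Num.sqrt (nsq (T (F i))) `^ p <= \sum_(k < #|I|) s k `^ p.
Proof.
move=> p0 bF oF; have [e be es] := sorted_singular_values bF oF.
rewrite (reindex e); last exact: onW_bij.
by apply: ler_sum => k _; apply: ge0_ler_powR; rewrite ?nnegrE ?sqrtr_ge0.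
Qed.

(** Hilbert--Schmidt sums do not see the unitary mixing that diagonalizes the
    Gram matrix. *)
Lemma hilbert_schmidt_bound (I : finType) (f : I -> V) : bessel f ->
  \sum_i nsq (T (f i)) <= \sum_(k < #|I|) s k ^+ 2.
Proof.
move=> bf; have [U [uU oU]] := gram_diagonalization ip (T \o f).
have TU k : T (mix U f k) = mix U (T \o f) k by rewrite /mix linear_sumZ.
rewrite -(nsq_mix ip uU (T \o f)).
have := @sum_singular_values I (mix U f) 2 (ler0n _ 2) (bessel_mix uU bf).
rewrite (_ : \sum_(k < _) s k `^ 2 = \sum_(k < #|I|) s k ^+ 2); last first.
  by apply: eq_bigr => k _; rewrite powR_mulrn.
move=> h; apply: (le_trans _ (h _)); last first.
  by move=> i j ij; rewrite !TU oU.
apply: ler_sum => k _; rewrite powR_mulrn ?sqrtr_ge0// sqr_sqrtr ?nsq_ge0//.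
by rewrite TU.
Qed.

(** Expanding [T (f i)] in singular vectors gives the coefficients
    [<| T (f i), g i |>] as means of the singular values against a matrix whose
    rows and columns have sum at most 1.  Young's inequality then plays the
    role of Jensen's. *)
Lemma diagonal_bound (I : finType) (f g : I -> V) p : 1 < p ->
  bessel f -> bessel g ->
  \sum_i normc <| T (f i), g i |> `^ p <= \sum_(k < #|I|) s k `^ p.
Proof.
move=> p1 bf bg; have p0 : 0 < p by exact: lt_trans p1.
have [U [uU oU]] := gram_diagonalization ip (T \o f).
pose F := mix U f.
have TU k : T (F k) = mix U (T \o f) k by rewrite /F /mix linear_sumZ.
have oF i j : i != j -> <| T (F i), T (F j) |> = 0 by move=> ij; rewrite !TU oU.
have := @sum_singular_values I F p (ltW p0) (bessel_mix uU bf) oF.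
apply: le_trans; pose m k : R := Num.sqrt (nsq (T (F k))).
have m0 k : 0 <= m k by exact: sqrtr_ge0.
have mE k : m k ^+ 2 = nsq (T (F k)) by rewrite sqr_sqrtr// nsq_ge0.
pose u k : V := (m k)^-1%:C%C *: T (F k).
have bu : bessel u.
  apply: bessel_orth => [i j ij|i]; first by rewrite dotZl dotZr oF// !mulr0.
  rewrite nsqZ sqmod_real -mE exprVn; have [->|mi] := eqVneq (m i) 0.
    by rewrite expr0n mulr0.
  by rewrite mulVf ?expf_neq0.
pose a k i : R := normc (U k i); pose b k i : R := normc <| u k, g i |>.
pose y i : R := normc <| T (f i), g i |>.
have y0 i : 0 <= y i by exact: normc_ge0.
have yle i : y i <= \sum_k m k * (a k i * b k i).
  have -> : y i = normc (\sum_k (U k i)^*%C * <| T (F k), g i |>).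
    rewrite /y (_ : T (f i) = (T \o f) i)// {1}(mixK uU (T \o f) i) dot_suml.
    by congr normc; apply: eq_bigr => k _; rewrite dotZl TU.
  apply: (le_trans (normc_sum_le _ _ _)); apply: ler_sum => k _.
  rewrite normcM normcJ -/(a k i) mulrCA ler_wpM2l ?normc_ge0//.
  rewrite /b /u dotZl normcM; have [mk|mk] := eqVneq (m k) 0.
    by rewrite dot_nsq0 ?normc0 ?mulr0// -mE mk expr0n.
  rewrite mulrA (_ : normc ((m k)^-1)%:C%C = (m k)^-1); last first.
    by rewrite normc_real ger0_norm// invr_ge0.
  by rewrite mulfV// mul1r.
pose w k i : R := a k i * b k i.
have w0 k i : 0 <= w k i by rewrite mulr_ge0 ?normc_ge0.
have wle k i : w k i <= (sqmod (U k i) + sqmod <| u k, g i |>) / 2.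
  rewrite /w /sqmod -/(a k i) -/(b k i).
  by have := sqr_ge0 (a k i - b k i); nra.
have half (x z : R) : x <= 1 -> z <= 1 -> (x + z) / 2 <= 1 by lra.
have wrow k : \sum_i w k i <= 1.
  apply: (le_trans (ler_sum _ (fun i _ => wle k i))).
  rewrite -mulr_suml big_split /=; apply: half; first by rewrite unitary_row.
  by rewrite (le_trans (bessel_dual _ bg))// bessel_le1.
have wcol i : \sum_k w k i <= 1.
  apply: (le_trans (ler_sum _ (fun k _ => wle k i))).
  rewrite -mulr_suml big_split /=; apply: half; first by rewrite unitary_col.
  under eq_bigr do rewrite dotC sqmodJ.
  by rewrite (le_trans (bessel_dual _ bu))// bessel_le1.
pose q : R := p / (p - 1).
have q0 : 0 < q by rewrite divr_gt0// subr_gt0.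
have pq : p^-1 + q^-1 = 1.
  by rewrite /q invf_div -[X in X + _]mul1r -mulrDl addrC subrK divff// gt_eqF.
have yp i : y i `^ p <= \sum_k w k i * (m k `^ p / p + y i `^ p / q).
  rewrite -{1}(mulr_powRB1 (y0 i) p0).
  apply: (le_trans (ler_wpM2r (powR_ge0 _ _) (yle i))).
  rewrite mulr_suml; apply: ler_sum => k _; rewrite -/(w k i).
  rewrite [m k * _]mulrC -mulrA; apply: ler_wpM2l => //.
  have := conjugate_powR (m0 k) (powR_ge0 (y i) (p - 1)) p0 q0 pq.
  rewrite -powRrM.
  rewrite (_ : (p - 1) * q = p)//; last by rewrite /q mulrCA divff ?mulr1// gt_eqF// subr_gt0.
have h : \sum_i y i `^ p <= (\sum_k m k `^ p) / p + (\sum_i y i `^ p) / q.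
  apply: (le_trans (ler_sum _ (fun i _ => yp i))).
  under eq_bigr do under eq_bigr do rewrite mulrDr.
  under eq_bigr do rewrite big_split /=.
  rewrite big_split /= lerD//.
    rewrite exchange_big /= mulr_suml; apply: ler_sum => k _.
    by rewrite -mulr_suml ler_piMl// divr_ge0 ?powR_ge0// ltW.
  rewrite mulr_suml; apply: ler_sum => i _.
  by rewrite -mulr_suml ler_piMl// divr_ge0 ?powR_ge0// ltW.
rewrite -(ler_pM2r (_ : 0 < p^-1)) ?invr_gt0//.
have : (\sum_i y i `^ p) * (p^-1 + q^-1) <= (\sum_k m k `^ p) / p + (\sum_i y i `^ p) / q.
  by rewrite pq mulr1.
by rewrite mulrDr lerD2r.
Qed.

End Bounds.

End ApproximationNumbers.

(** * Integrals of complex functions *)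

(** The increments are dominated by a geometric series of ratio the square
    root of one half. *)
Lemma cvg_geometric_increments (R : realType) (a : nat -> R) (C : R) :
  (forall j, (a j.+1 - a j) ^+ 2 <= C * 2^-1 ^+ j) -> cvgn a.
Proof.
move=> h; have C0 : 0 <= C by have := h 0%N; rewrite expr0 mulr1; apply: le_trans; exact: sqr_ge0.
pose z : R := Num.sqrt 2^-1.
have z0 : 0 <= z by exact: sqrtr_ge0.
have z2 : z ^+ 2 = 2^-1 by rewrite sqr_sqrtr// invr_ge0.
have z1 : z < 1.
  rewrite -(@ltr_pXn2r _ 2)// ?nnegrE// z2 expr1n invf_lt1//.
  by rewrite (@ltr_nat R 1 2).
have cs : cvgn (series (telescope a)).
  apply: normed_cvg; apply: (@series_le_cvg _ _ (geometric (Num.sqrt C) z)).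
  - by move=> n /=; exact: normr_ge0.
  - by move=> n; rewrite /= mulr_ge0 ?sqrtr_ge0 ?exprn_ge0.
  - move=> n; rewrite /telescope /= -(ler_pXn2r (_ : 0 < 2)%N) ?nnegrE//; last first.
      by rewrite mulr_ge0 ?sqrtr_ge0 ?exprn_ge0.
    by rewrite real_normK ?num_real// exprMn sqr_sqrtr// -exprM mulnC exprM z2 h.
  - apply: is_cvg_geometric_series; by rewrite ger0_norm.
rewrite (_ : a = (fun n => a 0%N + series (telescope a) n)); last first.
  by apply/funext => n; exact: eq_sum_telescope.
exact: is_cvgD (is_cvg_cst _) cs.
Qed.

Section ComplexIntegral.
Context d (T : measurableType d) (R : realType).
Variables (mu : {measure set T -> \bar R}) (D : set T).
Hypothesis mD : measurable D.
Implicit Types (f g : T -> R[i]) (a : R[i]).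

Lemma ReM (z w : R[i]) : Re (z * w) = Re z * Re w - Im z * Im w.
Proof. by case: z w => [? ?] []. Qed.
Lemma ImM (z w : R[i]) : Im (z * w) = Re z * Im w + Im z * Re w.
Proof. by case: z w => [? ?] []. Qed.
Lemma ReD (z w : R[i]) : Re (z + w) = Re z + Re w.
Proof. by case: z w => [? ?] []. Qed.
Lemma ImD (z w : R[i]) : Im (z + w) = Im z + Im w.
Proof. by case: z w => [? ?] []. Qed.
Lemma ReB (z w : R[i]) : Re (z - w) = Re z - Re w.
Proof. by case: z w => [? ?] []. Qed.
Lemma ImB (z w : R[i]) : Im (z - w) = Im z - Im w.
Proof. by case: z w => [? ?] []. Qed.
Lemma sqmodB (z w : R[i]) : sqmod (z - w) = sqmod (w - z).
Proof. by rewrite !sqmodE !ReB !ImB; ring. Qed.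
Lemma ReJ (z : R[i]) : Re z^*%C = Re z.
Proof. by case: z. Qed.
Lemma ImJ (z : R[i]) : Im z^*%C = - Im z.
Proof. by case: z. Qed.

Lemma cmeasurable_cst a : cmeasurable D (fun=> a).
Proof. by split; exact: measurable_cst. Qed.

Lemma cmeasurable_real (r : T -> R) : measurable_fun D r ->
  cmeasurable D (fun x => (r x)%:C%C).
Proof. by move=> mr; split => //=; exact: measurable_cst. Qed.

Lemma cmeasurableD f g : cmeasurable D f -> cmeasurable D g ->
  cmeasurable D (fun x => f x + g x).
Proof.
move=> [fr fi] [gr gi]; split.
  by under eq_fun do rewrite ReD; exact: measurable_funD.
by under eq_fun do rewrite ImD; exact: measurable_funD.
Qed.

Lemma cmeasurableB f g : cmeasurable D f -> cmeasurable D g ->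
  cmeasurable D (fun x => f x - g x).
Proof.
move=> [fr fi] [gr gi]; split.
  by under eq_fun do rewrite ReB; exact: measurable_funB.
by under eq_fun do rewrite ImB; exact: measurable_funB.
Qed.

Lemma cmeasurableM f g : cmeasurable D f -> cmeasurable D g ->
  cmeasurable D (fun x => f x * g x).
Proof.
move=> [fr fi] [gr gi]; split.
  under eq_fun do rewrite ReM.
  by apply: measurable_funB; exact: measurable_funM.
under eq_fun do rewrite ImM.
by apply: measurable_funD; exact: measurable_funM.
Qed.

Lemma cmeasurableJ f : cmeasurable D f -> cmeasurable D (fun x => (f x)^*%C).
Proof.
move=> [fr fi]; split; first by under eq_fun do rewrite ReJ.
by under eq_fun do rewrite ImJ; exact: measurableT_comp.
Qed.

Lemma cmeasurable_sum (I : Type) (s : seq I) (P : pred I) (h : I -> T -> R[i]) :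
  (forall i, P i -> cmeasurable D (h i)) ->
  cmeasurable D (fun x => \sum_(i <- s | P i) h i x).
Proof.
move=> mh; elim: s => [|i s ih].
  by under eq_fun do rewrite big_nil; exact: cmeasurable_cst.
have [Pi|nPi] := boolP (P i); last by under eq_fun do rewrite big_cons (negbTE nPi).
under eq_fun do rewrite big_cons Pi.
by apply: cmeasurableD => //; exact: mh.
Qed.

Lemma measurable_sqmod f : cmeasurable D f ->
  measurable_fun D (fun x => (sqmod (f x))%:E).
Proof. exact: cmeasurable_normc_sqr. Qed.

Lemma measurable_normc f : cmeasurable D f ->
  measurable_fun D (fun x => (normc (f x))%:E).
Proof.
move=> /cmeasurable_normc_sqr /measurable_EFinP mf; apply/measurable_EFinP.
rewrite (_ : (fun _ => _) = (fun x => Num.sqrt (normc (f x) ^+ 2))); last first.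
  by apply/funext => x; rewrite sqrtr_sqr ger0_norm// normc_ge0.
exact: (measurableT_comp (continuous_measurable_fun (@sqrt_continuous R)) mf).
Qed.

Definition cintegrable f := mu.-integrable D (EFin \o (fun x => Re (f x))) /\
  mu.-integrable D (EFin \o (fun x => Im (f x))).

Lemma normRe_le (z : R[i]) : `|Re z| <= normc z.
Proof.
case: z => a b /=; rewrite -sqrtr_sqr ler_wsqrtr// lerDl; exact: sqr_ge0.
Qed.

Lemma normIm_le (z : R[i]) : `|Im z| <= normc z.
Proof.
case: z => a b /=; rewrite -sqrtr_sqr ler_wsqrtr// lerDr; exact: sqr_ge0.
Qed.

Lemma cintegrableP f : cmeasurable D f ->
  (\int[mu]_(x in D) (normc (f x))%:E < +oo)%E -> cintegrable f.
Proof.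
move=> mf fi.
have ni : mu.-integrable D (fun x => (normc (f x))%:E).
  apply/integrableP; split; first exact: measurable_normc.
  apply: le_lt_trans fi; apply: ge0_le_integral => //.
  - by apply: measurableT_comp => //; exact: measurable_normc.
  - exact: measurable_normc.
  - by move=> x _; rewrite /= ger0_norm// normc_ge0.
case: mf => mr mi; split; apply: le_integrable ni => //.
- exact/measurable_EFinP.
- by move=> x _ /=; rewrite lee_fin [leRHS]ger0_norm ?normc_ge0 ?normRe_le.
- exact/measurable_EFinP.
- by move=> x _ /=; rewrite lee_fin [leRHS]ger0_norm ?normc_ge0 ?normIm_le.
Qed.

Lemma cintegrable_meas f : cintegrable f -> cmeasurable D f.
Proof.
by move=> [/measurable_int/measurable_EFinP ? /measurable_int/measurable_EFinP].
Qed.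

Lemma cintegrableZ a f : cintegrable f -> cintegrable (fun x => a * f x).
Proof.
move=> [fr fi]; split.
  apply: eq_integrable (integrableB mD (integrableZl mD (Re a) fr)
    (integrableZl mD (Im a) fi)) => // x _ /=.
  by rewrite ReM -!EFinM -EFinB.
apply: eq_integrable (integrableD mD (integrableZl mD (Re a) fi)
  (integrableZl mD (Im a) fr)) => // x _ /=.
by rewrite ImM -!EFinM -EFinD.
Qed.

Lemma cintegralD f g : cintegrable f -> cintegrable g ->
  cintegral mu D (fun x => f x + g x) = cintegral mu D f + cintegral mu D g.
Proof.
move=> [fr fi] [gr gi]; apply/eqP; rewrite eq_complex /=.
by rewrite -!RintegralD//; apply/andP; split; apply/eqP; apply: eq_Rintegral => x _;
  rewrite ?ReD ?ImD.
Qed.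

Lemma cintegralZ a f : cintegrable f ->
  cintegral mu D (fun x => a * f x) = a * cintegral mu D f.
Proof.
move=> [fr fi]; apply/eqP; rewrite eq_complex ReM ImM /=.
have zl (r : R) h : mu.-integrable D (EFin \o h) ->
    mu.-integrable D (EFin \o (fun x => r * h x)).
  by move=> ih; apply: eq_integrable (integrableZl mD r ih).
rewrite -!RintegralZl// -RintegralB// -?RintegralD//; try exact: zl.
by apply/andP; split; apply/eqP; apply: eq_Rintegral => x _; rewrite ?ReM ?ImM.
Qed.

Lemma cintegralJ f : cintegrable f ->
  cintegral mu D (fun x => (f x)^*%C) = (cintegral mu D f)^*%C.
Proof.
move=> [fr fi]; apply/eqP; rewrite eq_complex /=; apply/andP; split; apply/eqP.
  by apply: eq_Rintegral => x _; rewrite ReJ.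
rewrite -mulN1r -RintegralZl//; apply: eq_Rintegral => x _.
by rewrite ImJ mulN1r.
Qed.

Lemma cintegral0 : cintegral mu D (fun=> 0) = 0.
Proof.
by apply/eqP; rewrite eq_complex /= !Rintegral_cst// !mul0r eqxx.
Qed.

Lemma eq_cintegral f g : (forall x, D x -> f x = g x) ->
  cintegral mu D f = cintegral mu D g.
Proof.
move=> fg; rewrite /cintegral; congr Complex; apply: eq_Rintegral => x.
  by rewrite inE => /fg ->.
by rewrite inE => /fg ->.
Qed.

Lemma ae_eq_cintegral f g : cmeasurable D f -> cmeasurable D g ->
  {ae mu, forall x, D x -> f x = g x} -> cintegral mu D f = cintegral mu D g.
Proof.
move=> [fr fi] [gr gi] fg; rewrite /cintegral; congr Complex; congr fine.
  apply: ae_eq_integral => //; try exact/measurable_EFinP.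
  by apply: filterS fg => x /[apply] ->.
apply: ae_eq_integral => //; try exact/measurable_EFinP.
by apply: filterS fg => x /[apply] ->.
Qed.

Lemma sqintM f g : square_integrable mu D f -> square_integrable mu D g ->
  cintegrable (fun x => f x * g x).
Proof.
move=> [mf f2] [mg g2]; apply: cintegrableP; first exact: cmeasurableM.
apply: (@le_lt_trans _ _ (\int[mu]_(x in D)
    ((normc (f x) ^+ 2)%:E + (normc (g x) ^+ 2)%:E))%E).
  apply: ge0_le_integral => //.
  - by move=> x _; rewrite lee_fin normc_ge0.
  - by apply: measurable_normc; exact: cmeasurableM.
  - by apply: emeasurable_funD; exact: cmeasurable_normc_sqr.
  - move=> x _; rewrite -EFinD lee_fin normcM.
    by have := sqr_ge0 (normc (f x) - normc (g x)); have := normc_ge0 (f x);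
       have := normc_ge0 (g x); nra.
rewrite ge0_integralD//; [by rewrite lte_add_pinfty|..];
  try exact: cmeasurable_normc_sqr; by move=> x _; rewrite lee_fin sqr_ge0.
Qed.

Lemma sqintJ f : square_integrable mu D f -> square_integrable mu D (fun x => (f x)^*%C).
Proof.
move=> [mf f2]; split; first exact: cmeasurableJ.
by under eq_integral do rewrite normcJ.
Qed.

Lemma sqint_le f g : cmeasurable D f -> square_integrable mu D g ->
  (forall x, D x -> normc (f x) <= normc (g x)) -> square_integrable mu D f.
Proof.
move=> mf [mg g2] fg; split => //; apply: le_lt_trans g2.
apply: ge0_le_integral => //; try exact: cmeasurable_normc_sqr.
  by move=> x _; rewrite lee_fin sqr_ge0.
by move=> x Dx; rewrite lee_fin lerXn2r ?nnegrE ?normc_ge0 ?fg.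
Qed.

Definition sqnorm f : \bar R := (\int[mu]_(x in D) (sqmod (f x))%:E)%E.

Lemma sqnorm_ge0 f : (0 <= sqnorm f)%E.
Proof. by apply: integral_ge0 => x _; rewrite lee_fin sqmod_ge0. Qed.

Lemma sqnorm_fin f : square_integrable mu D f -> sqnorm f \is a fin_num.
Proof. by move=> [mf f2]; rewrite ge0_fin_numE// sqnorm_ge0. Qed.

Lemma sqnorm_le f g : cmeasurable D f -> cmeasurable D g ->
  {ae mu, forall x, D x -> sqmod (f x) <= sqmod (g x)} -> (sqnorm f <= sqnorm g)%E.
Proof.
move=> mf mg fg; apply: ae_ge0_le_integral => //.
- by move=> x _; rewrite lee_fin sqmod_ge0.
- exact: measurable_sqmod.
- by move=> x _; rewrite lee_fin sqmod_ge0.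
- exact: measurable_sqmod.
Qed.

Lemma ae_eq_sqnorm f g : cmeasurable D f -> cmeasurable D g ->
  {ae mu, forall x, D x -> f x = g x} -> sqnorm f = sqnorm g.
Proof.
move=> mf mg fg; apply/eqP; rewrite eq_le; apply/andP; split; apply: sqnorm_le => //;
  by apply: filterS fg => x /[apply] ->.
Qed.

Lemma eq_sqnorm f g : (forall x, D x -> f x = g x) -> sqnorm f = sqnorm g.
Proof. by move=> fg; apply: eq_integral => x; rewrite inE => /fg ->. Qed.

Lemma sqnormD_le f g : cmeasurable D f -> cmeasurable D g ->
  (sqnorm (fun x => f x + g x)%R <= 2%:E * (sqnorm f + sqnorm g))%E.
Proof.
move=> mf mg; rewrite /sqnorm -ge0_integralD//; last 4 first.
- by move=> x _; rewrite lee_fin sqmod_ge0.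
- exact: measurable_sqmod.
- by move=> x _; rewrite lee_fin sqmod_ge0.
- exact: measurable_sqmod.
rewrite -ge0_integralZl//; last 2 first.
- by apply: emeasurable_funD; exact: measurable_sqmod.
- by move=> x _; rewrite -EFinD lee_fin addr_ge0// sqmod_ge0.
apply: ge0_le_integral => //.
- by move=> x _; rewrite lee_fin sqmod_ge0.
- by apply: measurable_sqmod; exact: cmeasurableD.
- by apply: measurable_funeM; apply: emeasurable_funD; exact: measurable_sqmod.
- by move=> x _; rewrite -EFinD -EFinM lee_fin sqmodD_le.
Qed.

(** Along a subsequence with [sqnorm (g_(j+1) - g_j) <= 4^-j] the weighted sum
    of [2^j |g_(j+1) - g_j|^2] is integrable, so almost everywhere the
    increments are summable and [g_j x] converges; Fatou's lemma turns this
    pointwise limit into a limit in the mean. *)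
Lemma sqint_complete (f : nat -> T -> R[i]) :
  (forall n, square_integrable mu D (f n)) ->
  (forall e : R, 0 < e -> exists N, forall m n, (N <= m)%N -> (N <= n)%N ->
    (sqnorm (fun x => f m x - f n x)%R <= e%:E)%E) ->
  exists2 g, square_integrable mu D g &
    forall e : R, 0 < e -> exists N, forall n, (N <= n)%N ->
      (sqnorm (fun x => f n x - g x)%R <= e%:E)%E.
Proof.
move=> fi fC.
have q0 j : 0 < (4^-1 : R) ^+ j by rewrite exprn_gt0// invr_gt0.
have /choice[N0 N0P] : forall j, exists N, forall m n, (N <= m)%N -> (N <= n)%N ->
    (sqnorm (fun x => f m x - f n x)%R <= ((4^-1) ^+ j)%:E)%E.
  by move=> j; exact: fC.
pose N j := (\sum_(i < j.+1) (N0 i).+1)%N.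
have N0N j : (N0 j <= N j)%N by rewrite /N big_ord_recr /= (leq_trans (leqnSn _))// leq_addl.
have Nmono j : (N j <= N j.+1)%N by rewrite /N [leqRHS]big_ord_recr /= leq_addr.
pose g j := f (N j).
have gi j : square_integrable mu D (g j) by exact: fi.
have mB (u v : T -> R[i]) : square_integrable mu D u -> square_integrable mu D v ->
    cmeasurable D (fun x => u x - v x).
  by move=> [mu' _] [mv _]; exact: cmeasurableB.
have gd j : (sqnorm (fun x => g j.+1 x - g j x)%R <= ((4^-1) ^+ j)%:E)%E.
  by apply: N0P => //; exact: leq_trans (Nmono _).
pose h x : \bar R := (\sum_(j <oo) (2 ^+ j * sqmod (g j.+1 x - g j x))%:E)%E.
have t0 j x : (0 <= (2 ^+ j * sqmod (g j.+1 x - g j x))%:E)%E.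
  by rewrite lee_fin mulr_ge0// ?sqmod_ge0// exprn_ge0.
have mt j : measurable_fun D (fun x => (2 ^+ j * sqmod (g j.+1 x - g j x))%:E).
  under eq_fun do rewrite EFinM.
  by apply: measurable_funeM; apply: measurable_sqmod; exact: mB.
have mh : measurable_fun D h.
  by apply: ge0_emeasurable_sum => // j x _ _.
have h0 x : (0 <= h x)%E by apply: nneseries_ge0 => j _ _.
have hoo : (\int[mu]_(x in D) h x < +oo)%E.
  rewrite integral_nneseries//.
  apply: (@le_lt_trans _ _ 2%:E); last exact: ltry.
  apply: lime_le; first by apply: is_cvg_nneseries => j _ _; exact: integral_ge0.
  apply: nearW => n /=.
  apply: (@le_trans _ _ (\sum_(0 <= j < n) ((2^-1) ^+ j)%:E)%E).
    apply: lee_sum => j _; under eq_integral do rewrite EFinM.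
    rewrite ge0_integralZl//.
    - apply: (@le_trans _ _ ((2 ^+ j)%:E * ((4^-1) ^+ j)%:E)%E).
        by rewrite lee_wpmul2l ?lee_fin ?exprn_ge0//; exact: gd.
      rewrite -EFinM lee_fin -exprMn (_ : 2 * 4^-1 = 2^-1 :> R)//.
      by field.
    - by apply: measurable_sqmod; exact: mB.
    - by move=> x _; rewrite lee_fin sqmod_ge0.
  rewrite sumEFin lee_fin.
  suff -> : \sum_(0 <= j < n) (2^-1 : R) ^+ j = 2 - 2 * 2^-1 ^+ n.
    by rewrite lerBlDr lerDl mulr_ge0// exprn_ge0// invr_ge0.
  elim: n => [|n IH]; first by rewrite big_nil expr0; lra.
  by rewrite big_nat_recr//= IH exprS; field.
have hi : mu.-integrable D h.
  apply/integrableP; split => //.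
  by under eq_integral do rewrite gee0_abs//.
have hfin := integrable_ae mD hi.
pose G x : R[i] := Complex (fine (limn_esup (fun j => (Re (g j x))%:E)))
                           (fine (limn_esup (fun j => (Im (g j x))%:E))).
have mG : cmeasurable D G.
  split.
    apply: (measurableT_comp (fine_measurable measurableT)).
    by apply: measurable_fun_limn_esup => j; apply/measurable_EFinP; case: (gi j) => [[]].
  apply: (measurableT_comp (fine_measurable measurableT)).
  by apply: measurable_fun_limn_esup => j; apply/measurable_EFinP; case: (gi j) => [[]].
have Glim : {ae mu, forall x, D x -> (Re (g j x) @[j --> \oo] --> Re (G x)) /\
                                     (Im (g j x) @[j --> \oo] --> Im (G x))}.
  apply: filterS hfin => x /[apply] hx.
  have C j : sqmod (g j.+1 x - g j x) <= fine (h x) * 2^-1 ^+ j.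
    rewrite -ler_pdivrMr ?exprn_gt0// ?invr_gt0// exprVn invrK mulrC -lee_fin fineK//.
    rewrite /h (@nneseriesD1 _ _ j)//; first by rewrite leeDl// nneseries_ge0.
  have key (a : nat -> R) : (forall j, (a j.+1 - a j) ^+ 2 <= sqmod (g j.+1 x - g j x)) ->
      a @ \oo --> fine (limn_esup (fun j => (a j)%:E)).
    move=> ah; have ca : cvgn a.
      by apply: (@cvg_geometric_increments _ _ (fine (h x))) => j; exact: le_trans (C j).
    rewrite (_ : limn_esup _ = (limn a)%:E)//.
    by apply: (cvg_limn_einf_sup _).2; apply: cvg_EFin => //; apply: nearW.
  split; apply: key => j; rewrite sqmodE.
    by rewrite -ReB lerDl sqr_ge0.
  by rewrite -ImB lerDr sqr_ge0.
have Gle n j (e : R) : (forall i, (j <= i)%N -> (sqnorm (fun x => f n x - g i x)%R <= e%:E)%E) ->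
    (sqnorm (fun x => f n x - G x)%R <= e%:E)%E.
  move=> ge; pose F i x := (sqmod (f n x - g (i + j)%N x))%:E.
  have mF i : measurable_fun D (F i) by apply: measurable_sqmod; exact: mB.
  have F0 i x : (0 <= F i x)%E by rewrite lee_fin sqmod_ge0.
  apply: (@le_trans _ _ (\int[mu]_(x in D) limn_einf (F ^~ x))%E).
    apply: ae_ge0_le_integral => //.
    - by move=> x _; rewrite lee_fin sqmod_ge0.
    - by apply: measurable_sqmod; apply: cmeasurableB => //; case: (fi n).
    - by move=> x _; rewrite limn_einf_lim; apply: lime_ge;
        [exact: is_cvg_einfs | apply: nearW => k; apply: le_ereal_inf_tmp => _ [m _ <-]].
    - rewrite (_ : (fun _ => _) = (fun x => - limn_esup (fun i => - F i x))%E)//.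
      apply: measurableT_comp => //; apply: measurable_fun_limn_esup => i.
      exact: measurableT_comp.
    apply: filterS Glim => x /[apply] -[Lr Li].
    suff : F ^~ x @ \oo --> (sqmod (f n x - G x))%:E.
      by move=> /cvg_limn_einf_sup[-> _].
    apply: cvg_EFin; first exact: nearW.
    rewrite (_ : fine \o _ = (fun i => (Re (f n x) - Re (g (i + j)%N x)) ^+ 2 +
        (Im (f n x) - Im (g (i + j)%N x)) ^+ 2)); last first.
      by apply/funext => i /=; rewrite sqmodE ReB ImB.
    have -> : sqmod (f n x - G x) = (Re (f n x) - Re (G x)) ^+ 2 +
        (Im (f n x) - Im (G x)) ^+ 2.
      by rewrite sqmodE ReB ImB.
    have sh (a : nat -> R) (b l : R) : a @ \oo --> l ->
        (b - a (i + j)%N) ^+ 2 @[i --> \oo] --> (b - l) ^+ 2.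
      move=> al; have al' : a (i + j)%N @[i --> \oo] --> l by rewrite cvg_shiftn.
      by under eq_fun do rewrite expr2; rewrite expr2; apply: cvgM; apply: cvgB => //; exact: cvg_cst.
    apply: cvgD; first exact: (sh (fun i => Re (g i x)) (Re (f n x)) _ Lr).
    exact: (sh (fun i => Im (g i x)) (Im (f n x)) _ Li).
  apply: (le_trans (@fatou _ _ _ mu D mD F mF _)) => //.
  rewrite limn_einf_lim; apply: lime_le; first exact: is_cvg_einfs.
  apply: nearW => i; apply: (@le_trans _ _ (\int[mu]_(x in D) F i x)%E).
    by apply: ereal_inf_lbound; exists i => /=.
  by apply: ge; exact: leq_addl.
have Gf : forall e : R, 0 < e -> exists N, forall n, (N <= n)%N ->
    (sqnorm (fun x => f n x - G x)%R <= e%:E)%E.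
  move=> e e0; have [K KP] := fC e e0; exists K => n Kn.
  apply: (Gle n K) => i Ki; apply: KP => //.
  apply: (leq_trans Ki); apply: (@leq_trans (\sum_(k < i.+1) 1)%N).
    by rewrite sum1_card card_ord.
  by apply: leq_sum.
exists G => //.
have [N1 /(_ N1 (leqnn _)) Nle] := Gf 1 ltr01.
split => //; rewrite -/(sqnorm G).
apply: (@le_lt_trans _ _ (2%:E * (sqnorm (fun x => f N1 x - G x)%R + sqnorm (f N1)))%E).
  rewrite (@eq_sqnorm G (fun x => (G x - f N1 x) + f N1 x)); last first.
    by move=> x _; rewrite subrK.
  have mf1 : cmeasurable D (f N1) by case: (fi N1).
  apply: (le_trans (sqnormD_le _ _)) => //; first exact: cmeasurableB.
  rewrite (_ : sqnorm (fun x => G x - f N1 x)%R = sqnorm (fun x => f N1 x - G x)%R)//.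
  by apply: eq_integral => x _; rewrite sqmodB.
rewrite lte_mul_pinfty ?lee_fin// lte_add_pinfty//.
  by rewrite (le_lt_trans Nle)// ltry.
by rewrite -ge0_fin_numE ?sqnorm_ge0// sqnorm_fin.
Qed.

End ComplexIntegral.

(** * The Hilbert space L2 and the singular numbers of its operators *)

Section L2Space.
Variable R : realType.
Local Notation mu := (@lebesgue_measure R).
Local Notation D := (@Rpos R).
Local Notation sqint := (square_integrable mu D).
Local Notation mD := (@measurable_Rpos R).
Implicit Types (u v w : L2 R) (f g : R -> R[i]).

Definition L2dot u v : R[i] :=
  cintegral mu D (fun x => L2repr u x * (L2repr v x)^*%C).

Lemma L2repr_class f : sqint f ->
  {ae mu, forall x, D x -> L2repr (L2class f) x = f x}.
Proof. exact: L2classK. Qed.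

Lemma sqint_meas f : sqint f -> cmeasurable D f. Proof. by case. Qed.

Lemma sqintMJ f g : sqint f -> sqint g -> cintegrable mu D (fun x => f x * (g x)^*%C).
Proof. by move=> f2 g2; apply: sqintM => //; [exact: mD|exact/sqintJ]. Qed.

Fact L2dot_class_subproof f g : sqint f -> sqint g ->
  L2dot (L2class f) (L2class g) = cintegral mu D (fun x => f x * (g x)^*%C).
Proof.
move=> f2 g2; apply: ae_eq_cintegral.
- exact: mD.
- exact: cintegrable_meas (sqintMJ (L2reprP _) (L2reprP _)).
- exact: cintegrable_meas (sqintMJ f2 g2).
- by apply: filterS2 (L2repr_class f2) (L2repr_class g2) => x h1 h2 Dx; rewrite h1// h2.
Qed.

Lemma L2reprD u v :
  {ae mu, forall x, D x -> L2repr (u + v) x = L2repr u x + L2repr v x}.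
Proof. by apply: L2repr_class; apply: sqintD; exact: L2reprP. Qed.

Lemma L2reprZ a u : {ae mu, forall x, D x -> L2repr (a *: u) x = a * L2repr u x}.
Proof. by apply: L2repr_class; apply: sqintZ; exact: L2reprP. Qed.

Lemma L2repr0 : {ae mu, forall x, D x -> L2repr (0 : L2 R) x = 0}.
Proof. by apply: L2repr_class; exact: sqint0. Qed.

Lemma L2reprB u v :
  {ae mu, forall x, D x -> L2repr (u - v) x = L2repr u x - L2repr v x}.
Proof.
apply: filterS2 (L2reprD u (- v)) (L2repr_class (sqintN (L2reprP v))) => x h1 h2 Dx.
by rewrite h1// h2.
Qed.

Lemma L2repr_sumZ (I : Type) (s : seq I) (P : pred I) (c : I -> R[i]) (h : I -> L2 R) :
  {ae mu, forall x, D x -> L2repr (\sum_(i <- s | P i) c i *: h i) x =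
    \sum_(i <- s | P i) c i * L2repr (h i) x}.
Proof.
elim: s => [|i s IH].
  by rewrite big_nil; apply: filterS L2repr0 => x h0 Dx; rewrite big_nil h0.
rewrite big_cons; have [Pi|nPi] := boolP (P i); last first.
  by apply: filterS IH => x h0 Dx; rewrite big_cons (negbTE nPi) h0.
apply: filterS3 IH (L2reprZ (c i) (h i))
  (L2reprD (c i *: h i) (\sum_(j <- s | P j) c j *: h j)) => x h1 h2 h3 Dx.
rewrite big_cons Pi.
exact: etrans (h3 Dx) (congr2 +%R (h2 Dx) (h1 Dx)).
Qed.

Lemma L2_eqP u v : {ae mu, forall x, D x -> L2repr u x = L2repr v x} -> u = v.
Proof.
move=> uv; rewrite -[u]L2reprK -[v]L2reprK; apply: eq_L2class => //; exact: L2reprP.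
Qed.

Lemma L2classD f g : sqint f -> sqint g ->
  L2class f + L2class g = L2class (fun x => f x + g x).
Proof.
move=> f2 g2; apply: eq_L2class.
- by apply: sqintD; exact: L2reprP.
- exact: sqintD.
- by apply: filterS2 (L2repr_class f2) (L2repr_class g2) => x h1 h2 Dx; rewrite h1// h2.
Qed.

Lemma L2classZ a f : sqint f -> a *: L2class f = L2class (fun x => a * f x).
Proof.
move=> f2; apply: eq_L2class.
- by apply: sqintZ; exact: L2reprP.
- exact: sqintZ.
- by apply: filterS (L2repr_class f2) => x h Dx; rewrite h.
Qed.

Fact L2dotDl u v w : L2dot (u + v) w = L2dot u w + L2dot v w.
Proof.
rewrite /L2dot -cintegralD//; try exact: mD; try by apply: sqintMJ; exact: L2reprP.
apply: ae_eq_cintegral; first exact: mD.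
- by apply: cintegrable_meas; apply: sqintMJ; exact: L2reprP.
- by apply: cmeasurableD; apply: cintegrable_meas; apply: sqintMJ; exact: L2reprP.
- by apply: filterS (L2reprD u v) => x h Dx; rewrite h// mulrDl.
Qed.

Fact L2dotZl a u v : L2dot (a *: u) v = a * L2dot u v.
Proof.
rewrite /L2dot -cintegralZ//; try exact: mD; try by apply: sqintMJ; exact: L2reprP.
apply: ae_eq_cintegral; first exact: mD.
- by apply: cintegrable_meas; apply: sqintMJ; exact: L2reprP.
- by apply: cmeasurableM; [exact: cmeasurable_cst|];
    apply: cintegrable_meas; apply: sqintMJ; exact: L2reprP.
- by apply: filterS (L2reprZ a u) => x h Dx; rewrite h// mulrA.
Qed.

Fact L2dotC u v : L2dot u v = (L2dot v u)^*%C.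
Proof.
rewrite /L2dot -cintegralJ//; try exact: mD; try by apply: sqintMJ; exact: L2reprP.
by apply: eq_cintegral => x _; rewrite rmorphM/= conjcK mulrC.
Qed.

Lemma L2dot_self u : L2dot u u = (fine (sqnorm mu D (L2repr u)))%:C%C.
Proof.
rewrite /L2dot /cintegral; apply/eqP; rewrite eq_complex /=; apply/andP; split; apply/eqP.
  by congr fine; apply: eq_integral => x _; rewrite mulCconj.
rewrite /Rintegral (_ : (fun _ => _) = cst 0%E) ?integral0//.
by apply/funext => x; rewrite mulCconj.
Qed.

Fact L2dot_ge0 u : 0 <= Re (L2dot u u).
Proof. by rewrite L2dot_self /= fine_ge0// sqnorm_ge0. Qed.

Fact L2ip_subproof : {ip : inner_product (L2 R) | forall u v, dot ip u v = L2dot u v}.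
Proof. by exists (InnerProduct L2dotDl L2dotZl L2dotC L2dot_ge0). Qed.

(* Sealed, so that simplification does not unfold the integrals. *)
Definition L2ip : inner_product (L2 R) := sval L2ip_subproof.

Lemma L2ipE u v : dot L2ip u v = L2dot u v.
Proof. exact: (svalP L2ip_subproof). Qed.

Lemma L2dot_class f g : sqint f -> sqint g ->
  dot L2ip (L2class f) (L2class g) = cintegral mu D (fun x => f x * (g x)^*%C).
Proof. by move=> f2 g2; rewrite L2ipE L2dot_class_subproof. Qed.

Local Notation nsq := (nsq L2ip).

Lemma nsq_repr u : (nsq u)%:E = sqnorm mu D (L2repr u).
Proof.
rewrite /nsq L2ipE L2dot_self /= fineK// sqnorm_fin//.
exact: L2reprP.
Qed.

Lemma nsq_class f : sqint f -> (nsq (L2class f))%:E = sqnorm mu D f.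
Proof.
move=> f2; rewrite nsq_repr; apply: ae_eq_sqnorm; first exact: mD.
- by case: (L2reprP (L2class f)).
- by case: f2.
- exact: L2repr_class.
Qed.

Lemma L2norm_nsq u : L2norm u = Num.sqrt (nsq u).
Proof. by rewrite /L2norm -[nsq u]/(fine (nsq u)%:E) nsq_repr. Qed.

Lemma L2norm_le (a : R) u : 0 <= a -> (L2norm u <= a) = (nsq u <= a ^+ 2).
Proof.
move=> a0; rewrite L2norm_nsq -{1}(ger0_norm a0) -sqrtr_sqr.
by rewrite ler_sqrt// sqr_ge0.
Qed.

(** Classes are equal as soon as their representatives agree almost everywhere,
    and a nonnegative function with null integral vanishes almost everywhere. *)
Lemma nsq_eq0 u : nsq u = 0 -> u = 0.
Proof.
move=> u0; apply: L2_eqP.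
have : (\int[mu]_(x in D) `|(sqmod (L2repr u x))%:E| = 0)%E.
  transitivity (sqnorm mu D (L2repr u)); last by rewrite -nsq_repr u0.
  by apply: eq_integral => x _; rewrite gee0_abs// lee_fin sqmod_ge0.
have mu2 : measurable_fun D (fun x => (sqmod (L2repr u x))%:E).
  by apply: measurable_sqmod => //; case: (L2reprP u).
move=> /(ae_eq_integral_abs _ mD mu2) h.
apply: filterS2 h L2repr0 => x h1 h2 Dx.
by rewrite h2//; apply: sqmod_eq0; have := h1 Dx => -[].
Qed.

End L2Space.

Section Operators.
Variable R : realType.
Local Notation nsq := (nsq (@L2ip R)).
Implicit Types T K : L2 R -> L2 R.

Lemma linearB_fun T K : linear T -> linear K -> linear (T \- K)%R.
Proof.
move=> lT lK a u v; rewrite /= lT lK scalerBr opprD addrACA //.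
Qed.

Lemma opnorm_ge0 T : (0 <= opnorm T)%E.
Proof.
apply: (@le_trans _ _ (L2norm (T 0))%:E).
  by rewrite lee_fin L2norm_nsq sqrtr_ge0.
apply: ereal_sup_ubound; exists 0 => //=.
by rewrite L2norm_nsq nsq0 sqrtr0.
Qed.

Lemma opnorm_le T (a : R) : 0 <= a -> (forall u, nsq (T u) <= a ^+ 2 * nsq u) ->
  (opnorm T <= a%:E)%E.
Proof.
move=> a0 Ta; apply: ge_ereal_sup => _ [u /= u1 <-]; rewrite lee_fin L2norm_le//.
rewrite (le_trans (Ta u))// ler_piMr ?sqr_ge0//.
by move: u1; rewrite L2norm_le// expr1n.
Qed.

Lemma opnormP T (a : R) : linear T -> (opnorm T <= a%:E)%E ->
  forall u, nsq (T u) <= a ^+ 2 * nsq u.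
Proof.
move=> lT Ta u.
have a0 : 0 <= a by rewrite -lee_fin (le_trans _ Ta)// opnorm_ge0.
apply/ler_addgt0Pr => e e0.
pose d := e / (a ^+ 2 + 1); have a1 : 0 < a ^+ 2 + 1 by rewrite ltr_wpDl// sqr_ge0.
have d0 : 0 < d by rewrite divr_gt0.
have u0 : 0 <= nsq u by exact: nsq_ge0.
pose t := Num.sqrt (nsq u + d).
have t0 : 0 < t by rewrite sqrtr_gt0 ltr_wpDl.
have t2 : t ^+ 2 = nsq u + d by rewrite sqr_sqrtr// addr_ge0// ltW.
have h : nsq (T (t^-1%:C%C *: u)) <= a ^+ 2.
  rewrite -L2norm_le// -lee_fin (le_trans _ Ta)//.
  apply: ereal_sup_ubound; exists (t^-1%:C%C *: u) => //=.
  rewrite L2norm_le// expr1n nsqZ sqmod_real exprVn t2.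
  by rewrite mulrC ler_pdivrMr ?mul1r ?lerDl 1?ltW// ltr_wpDl.
have Tz : T (t^-1%:C%C *: u) = t^-1%:C%C *: T u.
  have := lT (t^-1%:C%C) u 0; rewrite addr0 => ->.
  suff -> : T 0 = 0 by rewrite addr0.
  have := lT 1 0 0; rewrite !scale1r addr0 => /eqP.
  by rewrite -subr_eq0 opprD addrA subrr sub0r oppr_eq0 => /eqP.
move: h; rewrite Tz nsqZ sqmod_real exprVn t2 mulrC ler_pdivrMr ?ltr_wpDl// => /le_trans; apply.
rewrite mulrDr lerD2l /d mulrCA ler_piMr ?(ltW e0)// ler_pdivrMr// mul1r lerDl//.
Qed.

Lemma singular_number_ge0 T n : (0 <= singular_number T n)%E.
Proof. by apply: le_ereal_inf_tmp => _ [K _ <-]; exact: opnorm_ge0. Qed.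

Lemma rank_le_const0 n : rank_le n (fun=> 0 : L2 R).
Proof.
exists (fun=> 0) => u; exists (fun=> 0); rewrite big1// => i _; exact: scaler0.
Qed.

Lemma bounded_const0 : bounded_operator (fun=> 0 : L2 R).
Proof.
split; first by move=> a u v; rewrite scaler0 addr0.
apply: (@le_lt_trans _ _ 0%:E); last exact: ltry.
by apply: opnorm_le => // u; rewrite nsq0 expr0n mul0r.
Qed.

Lemma singular_number_le T K n (a : R) : 0 <= a -> bounded_operator K -> rank_le n K ->
  (forall u, nsq (T u - K u) <= a ^+ 2 * nsq u) -> (singular_number T n <= a%:E)%E.
Proof.
move=> a0 bK rK TK; apply: (le_trans (ereal_inf_lbound _)).
  by exists K; [split|reflexivity].
exact: opnorm_le.
Qed.

Lemma singular_number_opnorm T n : (singular_number T n <= opnorm T)%E.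
Proof.
apply: ereal_inf_lbound; exists (fun=> 0); first by split; [exact: bounded_const0|exact: rank_le_const0].
by congr opnorm; apply/funext => u /=; rewrite subr0.
Qed.

(** Singular numbers of bounded operators are finite, so real arithmetic
    applies to them. *)
Definition snum T n : R := fine (singular_number T n).

Lemma snumE T n : bounded_operator T -> (snum T n)%:E = singular_number T n.
Proof.
move=> [_ oT]; rewrite /snum fineK// ge0_fin_numE ?singular_number_ge0//.
exact: le_lt_trans (singular_number_opnorm T n) oT.
Qed.

Lemma snum_ge0 T n : 0 <= snum T n.
Proof. by rewrite fine_ge0// singular_number_ge0. Qed.

Lemma snum_approximable T : bounded_operator T -> forall n a, snum T n < a ->
  approximable (@L2ip R) T n a.
Proof.
move=> bT n a; rewrite -lte_fin snumE// => /ereal_inf_lt[_ [K [bK rK] <-] Ka].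
exists K; split => //; first by case: bK.
by apply: (@opnormP (T \- K)%R); [apply: linearB_fun; [case: bT|case: bK]|exact: ltW].
Qed.

Lemma singular_number_nonincreasing T m n : (m <= n)%N ->
  (singular_number T n <= singular_number T m)%E.
Proof.
move=> mn; apply: ereal_inf_le_tmp => _ [K [bK [e Ke]] <-]; exists K => //; split => //.
pose F A (f : 'I_m -> A) (x0 : A) (i : nat) := if insub i is Some j then f j else x0.
exists (fun i : 'I_n => F _ e 0 i) => u; have [c ->] := Ke u.
exists (fun i : 'I_n => F _ c 0 i).
transitivity (\sum_(i < m) F _ c 0 i *: F _ e 0 i).
  by apply: eq_bigr => i _; rewrite /F valK.
rewrite (big_ord_widen n (fun i => F _ c 0 i *: F _ e 0 i))// big_mkcond.
apply: eq_bigr => i _; case: ifP => // im.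
by rewrite /F insubF// scale0r.
Qed.

End Operators.

(** * Tonelli and Fubini on the quarter plane *)

Section QuarterPlane.
Variable R : realType.
Local Notation mu := (@lebesgue_measure R).
Local Notation D := (@Rpos R).
Local Notation mD := (@measurable_Rpos R).
Local Notation DD := (D `*` D).
Local Notation mu2 := (mu \x mu)%E.
Local Notation RR := (measurableTypeR R * measurableTypeR R)%type.

Lemma measurable_RposX : measurable (DD : set RR).
Proof. by apply: measurableX; exact: mD. Qed.
Local Notation mDD := measurable_RposX.

Lemma patch_quarter (F : RR -> \bar R) x y :
  (F \_ DD) (x, y) = ((fun x => ((fun y => F (x, y)) \_ D) y) \_ D) x.
Proof.
rewrite /patch; have [xD|xD] := boolP (x \in D); last first.
  rewrite ifF//; apply/negbTE; apply: contra xD; rewrite !inE => -[]//.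
have [yD|yD] := boolP (y \in D).
  by rewrite ifT// inE; split; rewrite -in_setE.
by rewrite ifF//; apply/negbTE; apply: contra yD; rewrite !inE => -[].
Qed.

Lemma measurable_section d' (U : measurableType d') (F : RR -> U) x :
  measurable_fun DD F -> D x -> measurable_fun D (fun y => F (x, y)).
Proof.
move=> mF Dx _ Y mY.
have -> : D `&` (fun y => F (x, y)) @^-1` Y = pair x @^-1` (DD `&` F @^-1` Y).
  by apply/seteqP; split=> y /= => [[Dy Fy]|[[_ Dy] Fy]]; repeat split.
have := @pair1_measurable _ _ (measurableTypeR R) (measurableTypeR R) x measurableT
  _ (mF mDD _ mY).
by rewrite setTI.
Qed.

Lemma measurable_integral_section (F : RR -> \bar R) :
  measurable_fun DD F -> measurable_fun D (fun x => \int[mu]_(y in D) F (x, y))%E.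
Proof.
have pos (G : RR -> \bar R) : measurable_fun DD G -> (forall z, DD z -> 0 <= G z)%E ->
    measurable_fun D (fun x => \int[mu]_(y in D) G (x, y))%E.
  move=> mG G0; pose G' := G \_ DD.
  have mG' : measurable_fun setT G' by apply/(measurable_restrictT _ mDD).
  have G'0 z : (0 <= G' z)%E by exact: erestrict_ge0.
  have h := measurable_fun_fubini_tonelli_F (m2 := mu) G' mG' G'0.
  apply: eq_measurable_fun (measurable_funS measurableT (@subsetT _ D) h) => x xD.
  rewrite /fubini_F [RHS]integral_mkcond; apply: eq_integral => y _.
  by rewrite /G' patch_quarter /patch xD.
move=> mF; under eq_fun do rewrite integralE.
apply: emeasurable_funB.
  have hp := pos (F ^\+)%E (measurable_funepos mF) (fun z _ => funepos_ge0 F z).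
  by apply: eq_measurable_fun hp => x _; apply: eq_integral => y _; rewrite !funeposE.
have hn := pos (F ^\-)%E (measurable_funeneg mF) (fun z _ => funeneg_ge0 F z).
by apply: eq_measurable_fun hn => x _; apply: eq_integral => y _; rewrite !funenegE.
Qed.

Lemma quarter_tonelli1 (F : RR -> \bar R) : measurable_fun DD F ->
  (forall z, DD z -> 0 <= F z)%E ->
  (\int[mu2]_(z in DD) F z = \int[mu]_(x in D) \int[mu]_(y in D) F (x, y))%E.
Proof.
move=> mF F0; rewrite integral_mkcond fubini_tonelli1.
- rewrite [RHS]integral_mkcond; apply: eq_integral => x _; rewrite /fubini_F /=.
  under eq_integral do rewrite patch_quarter.
  rewrite [RHS]/patch; case: ifPn => xD; last first.
    by rewrite -[RHS](integral0 mu setT); apply: eq_integral => y _; rewrite /patch (negbTE xD).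
  by rewrite [RHS]integral_mkcond; apply: eq_integral => y _; rewrite {1}/patch xD.
- by apply/(measurable_restrictT _ mDD).
- by move=> z; exact: erestrict_ge0.
Qed.

Lemma quarter_tonelli2 (F : RR -> \bar R) : measurable_fun DD F ->
  (forall z, DD z -> 0 <= F z)%E ->
  (\int[mu2]_(z in DD) F z = \int[mu]_(y in D) \int[mu]_(x in D) F (x, y))%E.
Proof.
move=> mF F0; rewrite integral_mkcond fubini_tonelli2.
- rewrite [RHS]integral_mkcond; apply: eq_integral => y _; rewrite /fubini_G /=.
  under eq_integral do rewrite patch_quarter.
  rewrite [RHS]/patch; case: ifPn => yD; last first.
    rewrite -[RHS](integral0 mu setT); apply: eq_integral => x _.
    by rewrite /patch (negbTE yD) if_same.
  rewrite [RHS]integral_mkcond; apply: eq_integral => x _.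
  by rewrite /patch yD.
- by apply/(measurable_restrictT _ mDD).
- by move=> z; exact: erestrict_ge0.
Qed.

Lemma quarter_swap (F : RR -> \bar R) : measurable_fun DD F ->
  measurable_fun DD (fun z => F (z.2, z.1)).
Proof.
move=> mF _ Y mY.
have -> : DD `&` (fun z => F (z.2, z.1)) @^-1` Y = (fun z : RR => (z.2, z.1)) @^-1` (DD `&` F @^-1` Y).
  by apply/seteqP; split=> -[x y] /= => [[[Dx Dy] Fy]|[[Dy Dx] Fy]]; repeat split.
have := @measurable_swap _ _ (measurableTypeR R) (measurableTypeR R) measurableT
  _ (mF mDD _ mY).
by rewrite setTI.
Qed.

Section Complex.
Implicit Types k h : RR -> R[i].

Lemma cmeasurable_section k x : cmeasurable DD k -> D x ->
  cmeasurable D (fun y => k (x, y)).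
Proof.
by move=> [mr mi] Dx; split;
  [exact: (measurable_section (F := fun z => Re (k z)))|
   exact: (measurable_section (F := fun z => Im (k z)))].
Qed.

Lemma cmeasurable_swap k : cmeasurable DD k -> cmeasurable DD (fun z => k (z.2, z.1)).
Proof.
move=> [mr mi]; split; apply/measurable_EFinP.
  by apply: (quarter_swap (F := fun z => (Re (k z))%:E)); exact/measurable_EFinP.
by apply: (quarter_swap (F := fun z => (Im (k z))%:E)); exact/measurable_EFinP.
Qed.

Lemma cmeasurable_integral_section h : cmeasurable DD h ->
  cmeasurable D (fun x => cintegral mu D (fun y => h (x, y))).
Proof.
move=> [mr mi]; split.
  apply: (measurableT_comp (fine_measurable measurableT)).
  by apply: (measurable_integral_section (F := fun z => (Re (h z))%:E)); exact/measurable_EFinP.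
apply: (measurableT_comp (fine_measurable measurableT)).
by apply: (measurable_integral_section (F := fun z => (Im (h z))%:E)); exact/measurable_EFinP.
Qed.

Lemma sqnorm_sections k : cmeasurable DD k ->
  sqnorm mu2 DD k = (\int[mu]_(x in D) sqnorm mu D (fun y => k (x, y)))%E.
Proof.
move=> mk; rewrite /sqnorm quarter_tonelli1//; first exact: measurable_sqmod.
by move=> z _; rewrite lee_fin sqmod_ge0.
Qed.

Lemma measurable_sqnorm_section k : cmeasurable DD k ->
  measurable_fun D (fun x => sqnorm mu D (fun y => k (x, y))).
Proof.
move=> mk; apply: (measurable_integral_section (F := fun z => (sqmod (k z))%:E)).
exact: measurable_sqmod.
Qed.

Lemma sqint_section k : square_integrable mu2 DD k ->
  {ae mu, forall x, D x -> square_integrable mu D (fun y => k (x, y))}.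
Proof.
move=> [mk k2].
have ki : mu.-integrable D (fun x => sqnorm mu D (fun y => k (x, y))).
  apply/integrableP; split; first exact: measurable_sqnorm_section.
  under eq_integral do rewrite gee0_abs ?sqnorm_ge0//.
  by rewrite -sqnorm_sections.
apply: filterS (integrable_ae mD ki) => x /[swap] Dx /(_ Dx) kx.
split; first exact: cmeasurable_section.
by rewrite -ge0_fin_numE ?sqnorm_ge0//.
Qed.

Lemma sqint_swap k : square_integrable mu2 DD k ->
  square_integrable mu2 DD (fun z => k (z.2, z.1)).
Proof.
move=> [mk k2]; split; first exact: cmeasurable_swap.
rewrite quarter_tonelli1//; last 2 first.
- by apply: measurable_sqmod; exact: cmeasurable_swap.
- by move=> z _; rewrite lee_fin sqmod_ge0.
rewrite -(quarter_tonelli2 (F := fun z => (normc (k z) ^+ 2)%:E))//.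
- exact: measurable_sqmod.
- by move=> z _; rewrite lee_fin sqmod_ge0.
Qed.

Lemma cfubini h : cintegrable mu2 DD h ->
  cintegral mu D (fun x => cintegral mu D (fun y => h (x, y))) =
  cintegral mu D (fun y => cintegral mu D (fun x => h (x, y))).
Proof.
have real (f : RR -> R) : mu2.-integrable DD (EFin \o f) ->
    \int[mu]_(x in D) \int[mu]_(y in D) f (x, y) =
    \int[mu]_(y in D) \int[mu]_(x in D) f (x, y).
  move=> fi; pose F := (EFin \o f) \_ DD.
  have Fi : mu2.-integrable setT F by apply/(integrable_mkcond _ mDD).
  have H := Fubini Fi.
  rewrite /Rintegral; congr fine.
  transitivity (\int[mu]_x \int[mu]_y F (x, y))%E.
    rewrite integral_mkcond; apply: ae_eq_integral; first exact: measurableT.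
    - apply/(measurable_restrictT _ mD).
      apply/measurable_EFinP/(measurableT_comp (fine_measurable measurableT)).
      apply: (measurable_integral_section (F := EFin \o f)).
      exact: measurable_int fi.
    - exact: (measurable_fubini_F Fi).
    - apply: filterS (ae_integrable1 Fi) => x Fx _.
      rewrite /patch; case: ifPn => xD; last first.
        rewrite -[LHS](integral0 mu setT); apply: eq_integral => y _.
        by rewrite /F patch_quarter /patch (negbTE xD).
      have E : (\int[mu]_(y in D) (f (x, y))%:E)%E = (\int[mu]_y F (x, y))%E.
        rewrite integral_mkcond; apply: eq_integral => y _.
        by rewrite /F patch_quarter /patch xD.
      by rewrite E fineK// integrable_fin_num.
  rewrite H; apply/esym.
  rewrite integral_mkcond; apply: ae_eq_integral; first exact: measurableT.
  - apply/(measurable_restrictT _ mD).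
    apply/measurable_EFinP/(measurableT_comp (fine_measurable measurableT)).
    apply: (measurable_integral_section (F := fun z => (f (z.2, z.1))%:E)).
    apply: (quarter_swap (F := EFin \o f)).
    exact: measurable_int fi.
  - exact: (measurable_fubini_G Fi).
  - apply: filterS (ae_integrable2 Fi) => y Fy _.
    rewrite /patch; case: ifPn => yD; last first.
      rewrite -[LHS](integral0 mu setT); apply: eq_integral => x _.
      by rewrite /F patch_quarter /patch (negbTE yD) if_same.
    have E : (\int[mu]_(x in D) (f (x, y))%:E)%E = (\int[mu]_x F (x, y))%E.
      rewrite integral_mkcond; apply: eq_integral => x _.
      by rewrite /F patch_quarter /patch yD.
    by rewrite E fineK// integrable_fin_num.
move=> [hr hi]; rewrite /cintegral /=; congr Complex.
  exact: (real (fun z => Re (h z)) hr).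
exact: (real (fun z => Im (h z)) hi).
Qed.

End Complex.
End QuarterPlane.

(** * Integral operators with square integrable kernels *)

Section IntegralOperators.
Variable R : realType.
Local Notation mu := (@lebesgue_measure R).
Local Notation D := (@Rpos R).
Local Notation mD := (@measurable_Rpos R).
Local Notation DD := (D `*` D).
Local Notation mDD := (@measurable_RposX R).
Local Notation mu2 := (mu \x mu)%E.
Local Notation RR := (measurableTypeR R * measurableTypeR R)%type.
Local Notation sqint := (square_integrable mu D).
Local Notation nsq := (nsq (@L2ip R)).
Local Notation op := (@integral_operator R).
Implicit Types (k h : RR -> R[i]) (f g : R -> R[i]) (u v : L2 R).

Lemma cmeasurable_snd f : cmeasurable D f -> cmeasurable DD (fun z : RR => f z.2).
Proof.
have real (r : R -> R) : measurable_fun D r -> measurable_fun DD (fun z : RR => r z.2).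
  move=> mr _ Y mY.
  have -> : DD `&` (fun z : RR => r z.2) @^-1` Y = D `*` (D `&` r @^-1` Y).
    by apply/seteqP; split=> -[x y] /= => [[[Dx Dy] Fy]|[Dx [Dy Fy]]]; repeat split.
  by apply: measurableX; [exact: mD|exact: mr mD _ mY].
move=> [mr mi]; split; first exact: (real (fun x => Re (f x))).
exact: (real (fun x => Im (f x))).
Qed.

Lemma cmeasurable_fst f : cmeasurable D f -> cmeasurable DD (fun z : RR => f z.1).
Proof. by move=> /cmeasurable_snd/cmeasurable_swap. Qed.

Lemma cauchy_schwarz_fun f g : sqint f -> sqint g ->
  ((sqmod (cintegral mu D (fun x => f x * g x)))%:E <= sqnorm mu D f * sqnorm mu D g)%E.
Proof.
move=> f2 g2; have gJ : sqint (fun x => (g x)^*%C) by exact: sqintJ.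
have := cauchy_schwarz (@L2ip R) (L2class f) (L2class (fun x => (g x)^*%C)).
rewrite [dot _ _ _](L2dot_class f2 gJ).
under [X in cintegral _ _ X]eq_fun do rewrite conjcK.
have -> : sqnorm mu D g = sqnorm mu D (fun x => (g x)^*%C).
  by apply: eq_integral => x _; rewrite sqmodJ.
by rewrite -!nsq_class// -[X in (_ <= X)%E]EFinM lee_fin.
Qed.

Definition op_fun k f : R -> R[i] := fun x => cintegral mu D (fun y => k (x, y) * f y).

Lemma cmeasurable_op_fun k f : cmeasurable DD k -> cmeasurable D f ->
  cmeasurable D (op_fun k f).
Proof.
move=> mk mf; apply: (cmeasurable_integral_section (h := fun z => k z * f z.2)).
by apply: cmeasurableM => //; exact: cmeasurable_snd.
Qed.

Lemma sqnorm_op_fun k f : square_integrable mu2 DD k -> sqint f ->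
  (sqnorm mu D (op_fun k f) <= sqnorm mu2 DD k * sqnorm mu D f)%E.
Proof.
move=> k2 f2; have [mk _] := k2; have [mf _] := f2.
rewrite sqnorm_sections// -ge0_integralZr//; last 4 first.
- exact: mD.
- exact: measurable_sqnorm_section.
- by move=> x _; exact: sqnorm_ge0.
- exact: sqnorm_ge0.
apply: ae_ge0_le_integral.
- exact: mD.
- by move=> x _; rewrite lee_fin sqmod_ge0.
- by apply: measurable_sqmod; exact: cmeasurable_op_fun.
- by move=> x _; rewrite mule_ge0 ?sqnorm_ge0.
- by apply: emeasurable_funM => //; exact: measurable_sqnorm_section.
- apply: filterS (sqint_section k2) => x kx Dx.
  exact: cauchy_schwarz_fun (kx Dx) f2.
Qed.

Lemma sqint_op_fun k f : square_integrable mu2 DD k -> sqint f -> sqint (op_fun k f).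
Proof.
move=> k2 f2; split; first by apply: cmeasurable_op_fun; [case: k2|case: f2].
apply: (le_lt_trans (sqnorm_op_fun k2 f2)).
rewrite lte_mul_pinfty ?sqnorm_ge0//; first exact: sqnorm_fin.
by case: f2.
Qed.

Lemma sqint_meas2 k : square_integrable mu2 DD k -> cmeasurable DD k.
Proof. by case. Qed.

Lemma op_class k f : square_integrable mu2 DD k -> sqint f ->
  op k (L2class f) = L2class (op_fun k f).
Proof.
move=> k2 f2; have fr := L2reprP (L2class f); apply: eq_L2class.
- exact: (sqint_op_fun k2 fr).
- exact: sqint_op_fun.
apply: nearW => x Dx; have kx := cmeasurable_section (sqint_meas2 k2) Dx.
apply: ae_eq_cintegral; first exact: mD.
- by apply: cmeasurableM => //; case: fr.
- by apply: cmeasurableM => //; case: f2.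
- by apply: filterS (L2repr_class f2) => y h Dy; rewrite h.
Qed.

Lemma op_repr k u : square_integrable mu2 DD k ->
  {ae mu, forall x, D x -> L2repr (op k u) x = op_fun k (L2repr u) x}.
Proof. by move=> k2; apply: L2repr_class; apply: sqint_op_fun => //; exact: L2reprP. Qed.

Lemma nsq_op_le k u : square_integrable mu2 DD k ->
  ((nsq (op k u))%:E <= sqnorm mu2 DD k * (nsq u)%:E)%E.
Proof.
move=> k2; rewrite nsq_class; last by apply: sqint_op_fun => //; exact: L2reprP.
by rewrite nsq_repr sqnorm_op_fun//; exact: L2reprP.
Qed.

Lemma ae_cintegrable_section k f : square_integrable mu2 DD k -> sqint f ->
  {ae mu, forall x, D x -> cintegrable mu D (fun y => k (x, y) * f y)}.
Proof.
move=> k2 f2; apply: filterS (sqint_section k2) => x kx Dx.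
by apply: sqintM => //; [exact: mD|exact: kx].
Qed.

Lemma op_linear k : square_integrable mu2 DD k -> linear (op k).
Proof.
move=> k2 a u v; apply: L2_eqP.
have i1 := ae_cintegrable_section k2 (L2reprP u).
have i2 := ae_cintegrable_section k2 (L2reprP v).
have e1 := op_repr (a *: u + v) k2.
have e2 := L2reprD (a *: op k u) (op k v).
have e3 := L2reprZ a (op k u).
have e4 := L2reprZ a u; have e5 := L2reprD (a *: u) v.
have e6 := op_repr u k2; have e7 := op_repr v k2.
apply: filterS (filterI (filterI i1 i2) (filterI e1 (filterI e2 (filterI e3
  (filterI e6 e7))))) => x [[i1x i2x] [e1x [e2x [e3x [e6x e7x]]]]] Dx.
have E2 := etrans (e2x Dx) (congr2 +%R (etrans (e3x Dx) (congr1 ( *%R a) (e6x Dx))) (e7x Dx)).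
apply: (etrans (e1x Dx)); apply: (etrans _ (esym E2)).
rewrite /op_fun -(cintegralZ mD a (i1x Dx)).
rewrite -(cintegralD mD (cintegrableZ mD a (i1x Dx)) (i2x Dx)).
have kx := cmeasurable_section (sqint_meas2 k2) Dx.
apply: ae_eq_cintegral; first exact: mD.
- by apply: cmeasurableM => //; case: (L2reprP (a *: u + v)).
- apply: cmeasurableD; last by apply: cintegrable_meas; exact: i2x.
  by apply: cmeasurableM; [exact: cmeasurable_cst|apply: cintegrable_meas; exact: i1x].
- apply: filterS2 e4 e5 => y h4 h5 Dy.
  by rewrite h5// h4// mulrDr mulrCA.
Qed.

Lemma op_bounded k : square_integrable mu2 DD k -> bounded_operator (op k).
Proof.
move=> k2; split; first exact: op_linear.
have kf : sqnorm mu2 DD k \is a fin_num by exact: sqnorm_fin.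
have K0 : 0 <= fine (sqnorm mu2 DD k) by rewrite fine_ge0// sqnorm_ge0.
apply: (@le_lt_trans _ _ (Num.sqrt (fine (sqnorm mu2 DD k)))%:E); last exact: ltry.
apply: opnorm_le; first exact: sqrtr_ge0.
move=> u; rewrite sqr_sqrtr// -lee_fin; apply: (le_trans (nsq_op_le u k2)).
by rewrite -[X in (X * _ <= _)%E](fineK kf) -EFinM.
Qed.

Lemma eq_op k h : square_integrable mu2 DD k -> square_integrable mu2 DD h ->
  {ae mu, forall x, D x -> {ae mu, forall y, D y -> k (x, y) = h (x, y)}} -> op k = op h.
Proof.
move=> k2 h2 kh; apply/funext => u; have u2 := L2reprP u; apply: eq_L2class.
- exact: (sqint_op_fun k2 u2).
- exact: (sqint_op_fun h2 u2).
apply: filterS kh => x khx Dx; apply: ae_eq_cintegral; first exact: mD.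
- by apply: cmeasurableM; [exact: cmeasurable_section (sqint_meas2 k2) Dx|case: u2].
- by apply: cmeasurableM; [exact: cmeasurable_section (sqint_meas2 h2) Dx|case: u2].
- by apply: filterS (khx Dx) => y h' Dy; rewrite h'.
Qed.

Lemma sqint2D k h : square_integrable mu2 DD k -> square_integrable mu2 DD h ->
  square_integrable mu2 DD (fun z => k z + h z).
Proof.
move=> k2 h2; have := square_integrable_linear mDD 1 k2 h2.
by under [X in square_integrable _ _ X -> _]eq_fun do rewrite mul1r.
Qed.

Lemma sqint2Z a k : square_integrable mu2 DD k ->
  square_integrable mu2 DD (fun z => a * k z).
Proof.
move=> k2; have := square_integrable_linear mDD a k2 (square_integrable0 mu2 DD).
by under [X in square_integrable _ _ X -> _]eq_fun do rewrite addr0.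
Qed.

Lemma sqint2_sum (I : Type) (s : seq I) (P : pred I) (F : I -> RR -> R[i]) :
  (forall i, P i -> square_integrable mu2 DD (F i)) ->
  square_integrable mu2 DD (fun z => \sum_(i <- s | P i) F i z).
Proof.
move=> F2; elim: s => [|i s IH].
  by under eq_fun do rewrite big_nil; exact: square_integrable0.
have [Pi|nPi] := boolP (P i); last by under eq_fun do rewrite big_cons (negbTE nPi).
by under eq_fun do rewrite big_cons Pi; apply: sqint2D => //; exact: F2.
Qed.

Lemma opD k h u : square_integrable mu2 DD k -> square_integrable mu2 DD h ->
  op (fun z => k z + h z) u = op k u + op h u.
Proof.
move=> k2 h2; have u2 := L2reprP u.
rewrite [RHS](L2classD (sqint_op_fun k2 u2) (sqint_op_fun h2 u2)).
apply: eq_L2class.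
- exact: (sqint_op_fun (sqint2D k2 h2) u2).
- by apply: sqintD; exact: sqint_op_fun.
apply: filterS2 (ae_cintegrable_section k2 u2) (ae_cintegrable_section h2 u2) => x ix jx Dx.
rewrite /op_fun -(cintegralD mD (ix Dx) (jx Dx)).
by apply: eq_cintegral => y _; rewrite mulrDl.
Qed.

Lemma opZ a k u : square_integrable mu2 DD k -> op (fun z => a * k z) u = a *: op k u.
Proof.
move=> k2; have u2 := L2reprP u.
rewrite [RHS](L2classZ a (sqint_op_fun k2 u2)).
apply: eq_L2class.
- exact: (sqint_op_fun (sqint2Z a k2) u2).
- by apply: sqintZ; exact: sqint_op_fun.
apply: filterS (ae_cintegrable_section k2 u2) => x ix Dx.
rewrite /op_fun -(cintegralZ mD a (ix Dx)).
by apply: eq_cintegral => y _; rewrite mulrA.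
Qed.

Lemma op_sum (I : Type) (s : seq I) (P : pred I) (F : I -> RR -> R[i]) u :
  (forall i, P i -> square_integrable mu2 DD (F i)) ->
  op (fun z => \sum_(i <- s | P i) F i z) u = \sum_(i <- s | P i) op (F i) u.
Proof.
move=> F2; elim: s => [|i s IH].
  rewrite big_nil; under [X in integral_operator X]eq_fun do rewrite big_nil.
  have := opZ 0 u (square_integrable0 mu2 DD); rewrite scale0r => <-.
  by congr (op _ u); apply/funext => z; rewrite mul0r.
rewrite big_cons; have [Pi|nPi] := boolP (P i); last first.
  by under [X in integral_operator X]eq_fun do rewrite big_cons (negbTE nPi).
under [X in integral_operator X]eq_fun do rewrite big_cons Pi.
by rewrite opD ?IH//; [exact: F2|exact: sqint2_sum].
Qed.

(** The conjugation makes the operator of [tensor f g] the rank one operator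
    with range spanned by [f] and coefficient the inner product with [g]. *)
Definition tensor f g : RR -> R[i] := fun z => f z.1 * (g z.2)^*%C.

Lemma sqnorm_tensor f g : sqint f -> sqint g ->
  sqnorm mu2 DD (tensor f g) = (sqnorm mu D f * sqnorm mu D g)%E.
Proof.
move=> f2 g2; have [mf _] := f2; have [mg _] := g2.
rewrite sqnorm_sections; last first.
  apply: cmeasurableM; first exact: cmeasurable_fst.
  by apply: (cmeasurable_snd (f := fun x => (g x)^*%C)); exact: cmeasurableJ.
transitivity (\int[mu]_(x in D) ((sqmod (f x))%:E * sqnorm mu D g))%E.
  apply: eq_integral => x _; rewrite /sqnorm -ge0_integralZl//.
  - by apply: eq_integral => y _; rewrite /tensor sqmodM sqmodJ EFinM.
  - exact: mD.
  - exact: measurable_sqmod.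
  - by move=> y _; rewrite lee_fin sqmod_ge0.
  - by rewrite lee_fin sqmod_ge0.
rewrite ge0_integralZr//.
- exact: mD.
- exact: measurable_sqmod.
- by move=> y _; rewrite lee_fin sqmod_ge0.
- exact: sqnorm_ge0.
Qed.

Lemma sqint_tensor f g : sqint f -> sqint g -> square_integrable mu2 DD (tensor f g).
Proof.
move=> f2 g2; split.
  apply: cmeasurableM; first by apply: cmeasurable_fst; case: f2.
  by apply: (cmeasurable_snd (f := fun x => (g x)^*%C)); apply: cmeasurableJ; case: g2.
rewrite -/(sqnorm mu2 DD (tensor f g)) sqnorm_tensor//.
rewrite lte_mul_pinfty ?sqnorm_ge0//; first exact: sqnorm_fin.
by case: g2.
Qed.

Lemma op_tensor f g u : sqint f -> sqint g ->
  op (tensor f g) u = dot (@L2ip R) u (L2class g) *: L2class f.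
Proof.
move=> f2 g2; have u2 := L2reprP u.
have -> : dot (@L2ip R) u (L2class g) = cintegral mu D (fun y => L2repr u y * (g y)^*%C).
  by rewrite -{1}[u]L2reprK; exact: L2dot_class.
rewrite L2classZ//; apply: eq_L2class.
- exact: (sqint_op_fun (sqint_tensor f2 g2) u2).
- exact: sqintZ.
- apply: nearW => x Dx.
  rewrite mulrC -(cintegralZ mD (f x) (sqintMJ u2 g2)).
  by apply: eq_cintegral => y _; rewrite /tensor /= mulrCA mulrA mulrC mulrA mulrC.
Qed.

Definition transpose k : RR -> R[i] := fun z => k (z.2, z.1).

Definition L2conj u : L2 R := L2class (fun x => (L2repr u x)^*%C).

Lemma L2conj_class f : sqint f -> L2conj (L2class f) = L2class (fun x => (f x)^*%C).
Proof.
move=> f2; apply: eq_L2class.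
- by apply: sqintJ; exact: L2reprP.
- exact: sqintJ.
- by apply: filterS (L2repr_class f2) => x h Dx; rewrite h.
Qed.

Lemma L2conjK u : L2conj (L2conj u) = u.
Proof.
rewrite {2}/L2conj L2conj_class; last by apply: sqintJ; exact: L2reprP.
by under [X in L2class X]eq_fun do rewrite conjcK; exact: L2reprK.
Qed.

Lemma nsq_conj u : nsq (L2conj u) = nsq u.
Proof.
have u2 := L2reprP u; have := nsq_class (sqintJ u2).
rewrite (_ : sqnorm _ _ _ = sqnorm mu D (L2repr u)); last first.
  by apply: eq_integral => x _; rewrite sqmodJ.
by rewrite -nsq_repr => -[].
Qed.

(** The transposed kernel gives the adjoint conjugated by complex
    conjugation. *)
Lemma dot_op_transpose k u v : square_integrable mu2 DD k ->
  dot (@L2ip R) (op (transpose k) u) v = dot (@L2ip R) (op k (L2conj v)) (L2conj u).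
Proof.
move=> k2; have k2' := sqint_swap k2.
have u2 := L2reprP u; have v2 := L2reprP v.
have uJ := sqintJ u2; have vJ := sqintJ v2.
rewrite /L2conj (op_class k2 vJ).
rewrite [RHS](L2dot_class (sqint_op_fun k2 vJ) uJ).
rewrite -{1}[v]L2reprK [LHS](L2dot_class (sqint_op_fun k2' u2) v2).
pose h (z : RR) := k z * tensor (fun x => (L2repr v x)^*%C) (fun y => (L2repr u y)^*%C) (z.2, z.1).
have hi : cintegrable mu2 DD h.
  apply: sqintM => //; first exact: mDD.
  exact: (sqint_swap (sqint_tensor vJ uJ)).
transitivity (cintegral mu D (fun x => cintegral mu D (fun y => h (y, x)))).
  apply: ae_eq_cintegral; first exact: mD.
  - apply: cmeasurableM; first exact: sqint_meas (sqint_op_fun k2' u2).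
    exact: sqint_meas vJ.
  - apply: (cmeasurable_integral_section (h := fun z => h (z.2, z.1))).
    by apply: cmeasurable_swap; exact: cintegrable_meas hi.
  apply: filterS (ae_cintegrable_section k2' u2) => x ix Dx.
  rewrite mulrC -(cintegralZ mD _ (ix Dx)); apply: eq_cintegral => y _.
  by rewrite /h /tensor /transpose /= conjcK mulrCA.
rewrite -(cfubini hi).
apply: ae_eq_cintegral; first exact: mD.
- apply: (cmeasurable_integral_section (h := h)); exact: cintegrable_meas hi.
- apply: cmeasurableM; first exact: sqint_meas (sqint_op_fun k2 vJ).
  by apply: cmeasurableJ; exact: sqint_meas uJ.
apply: filterS (ae_cintegrable_section k2 vJ) => x ix Dx.
rewrite mulrC -(cintegralZ mD _ (ix Dx)); apply: eq_cintegral => y _.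
by rewrite /h /tensor /= mulrA mulrC.
Qed.

End IntegralOperators.

(** * Indicators of intervals *)

Section Indicators.
Variable R : realType.
Local Notation mu := (@lebesgue_measure R).
Local Notation D := (@Rpos R).
Local Notation mD := (@measurable_Rpos R).
Local Notation sqint := (square_integrable mu D).
Local Notation nsq := (nsq (@L2ip R)).
Implicit Types (f g h : R -> R[i]) (u v : L2 R) (E : set R).

Definition ind E : R -> R[i] := fun x => (\1_E x)%:C%C.

Lemma sqmod_ind E x : sqmod (ind E x) = \1_E x.
Proof. by rewrite sqmod_real indicE; case: (_ \in _); rewrite ?expr1n ?expr0n. Qed.

Lemma cmeasurable_ind E (A : set R) : measurable E -> cmeasurable (A : set (measurableTypeR R)) (ind E).
Proof. by move=> mE; apply: cmeasurable_real; exact: measurable_indic. Qed.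

Lemma sqnorm_ind E : measurable E -> sqnorm mu D (ind E) = mu (E `&` D).
Proof.
move=> mE; rewrite /sqnorm; under eq_integral do rewrite sqmod_ind.
by rewrite integral_indic//; exact: mD.
Qed.

Lemma sqint_ind E : measurable E -> (mu E < +oo)%E -> sqint (ind E).
Proof.
move=> mE Eoo; split; first exact: cmeasurable_ind.
rewrite -/(sqnorm mu D (ind E)) sqnorm_ind//; apply: le_lt_trans Eoo.
by apply: le_measure => //; rewrite inE//; apply: measurableI => //; exact: mD.
Qed.

Lemma cintegral_ind f E (A : set R) : cintegral mu A (fun x => f x * ind E x) =
  cintegral mu (A `&` E) f.
Proof.
rewrite /cintegral !Rintegral_mkcondr; congr Complex; apply: eq_Rintegral => x _;
  rewrite ?ReM ?ImM /= /patch indicE; case: (x \in E); rewrite ?mulr0 ?subr0 ?mulr1 ?add0r//.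
Qed.

Lemma cmeasurable_mulind f E : cmeasurable D f -> measurable E ->
  cmeasurable D (fun x => f x * ind E x).
Proof. by move=> mf mE; apply: cmeasurableM => //; exact: cmeasurable_ind. Qed.

Lemma sqint_mulind f E : sqint f -> measurable E -> sqint (fun x => f x * ind E x).
Proof.
move=> f2 mE; apply: (@sqint_le _ _ _ mu D mD _ f) => //.
  by apply: cmeasurable_mulind => //; exact: sqint_meas f2.
move=> x _; rewrite normcM normc_real indicE.
by case: (x \in E); rewrite ?normr1 ?mulr1// normr0 mulr0 normc_ge0.
Qed.

Lemma indJ E x : (ind E x)^*%C = ind E x.
Proof. by rewrite /ind /= oppr0. Qed.

Definition L2ind (a b : R) : L2 R := L2class (ind `]a, b]%classic).

Lemma lebesgue_itvoc (a b : R) : a <= b -> mu `]a, b]%classic = (b - a)%:E.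
Proof.
move=> ab; rewrite lebesgue_measure_itv /= lte_fin; case: ltP => // ba.
by rewrite (_ : b - a = 0)//; apply/eqP; rewrite subr_eq0 eq_le ab ba.
Qed.

Lemma sqint_itv (a b : R) : sqint (ind `]a, b]%classic).
Proof.
apply: sqint_ind => //; rewrite lebesgue_measure_itv /=.
by case: ifP => _; rewrite ltry.
Qed.

Lemma nsq_ind (a b : R) : 0 <= a -> a <= b -> nsq (L2ind a b) = b - a.
Proof.
move=> a0 ab; suff : (nsq (L2ind a b))%:E = (b - a)%:E by case.
rewrite nsq_class ?sqnorm_ind ?setIidl ?lebesgue_itvoc//; last exact: sqint_itv.
by move=> x /=; rewrite in_itv /= => /andP[ax _]; exact: le_lt_trans ax.
Qed.

Lemma dot_ind u (a b : R) : 0 <= a ->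
  dot (@L2ip R) u (L2ind a b) = cintegral mu `]a, b]%classic (L2repr u).
Proof.
move=> a0; rewrite -{1}[u]L2reprK [LHS]L2dot_class; [|exact: L2reprP|exact: sqint_itv].
under [X in cintegral _ _ X]eq_fun do rewrite indJ.
rewrite cintegral_ind setIidr//.
by move=> x /=; rewrite in_itv /= => /andP[ax _]; exact: le_lt_trans ax.
Qed.

(** By Lebesgue's differentiation theorem a function is determined by its
    integrals over the intervals starting at 0. *)
Lemma ae0_of_integrals (f : R -> R) :
  (forall b : R, 0 < b -> mu.-integrable `]0, b]%classic (EFin \o f)) ->
  (forall b : R, 0 < b -> \int[mu]_(x in `]0, b]%classic) f x = 0) ->
  {ae mu, forall x, D x -> f x = 0}.
Proof.
move=> fi f0.
have H (n : nat) : {ae mu, forall x, D x -> x <= n%:R -> f x = 0}.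
  pose J := `]0, n%:R : R]%classic; pose fn := f \_ J.
  have fJ : mu.-integrable J (EFin \o f).
    case: n @J @fn => [|n] /=; last exact: fi.
    by rewrite set_itvoc0 ?ltxx//; exact: integrable_set0.
  have int0 y : \int[mu]_(t in `]0, y]%classic) fn t = 0.
    rewrite /fn -Rintegral_mkcondr /J.
    have [y0|y0] := ltP 0 (Num.min y n%:R).
      rewrite (_ : _ `&` _ = `]0, Num.min y n%:R]%classic) ?f0//.
      apply/seteqP; split => t /=; rewrite !in_itv /=.
        by move=> [/andP[t0 ty] /andP[_ tn]]; rewrite t0 le_min ty tn.
      by move=> /andP[t0]; rewrite le_min => /andP[ty tn]; rewrite t0 ty tn.
    rewrite (_ : _ `&` _ = set0) ?Rintegral_set0//.
    apply/seteqP; split => t //=; rewrite !in_itv /= => -[/andP[t0 ty] /andP[_ tn]].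
    by move: y0; rewrite leNgt lt_min (lt_le_trans t0 ty) (lt_le_trans t0 tn).
  have fni : mu.-integrable setT (EFin \o fn).
    rewrite /fn -restrict_EFin.
    exact: ((@integrable_mkcond _ _ R mu J (EFin \o f) (measurable_itv _)).1 fJ).
  have fny y : mu.-integrable [set` Interval (BRight 0) (BRight y)] (EFin \o fn).
    by apply: integrableS fni => //; exact: measurable_itv.
  have := FTC1 fny (integrable_locally (measurable_itv _) fJ).
  apply: filterS; first exact: (ae_filter_ringOfSetsType mu).
  move=> x xF Dx xn; have [_] := xF Dx.
  rewrite [X in derive1 X](_ : _ = cst 0); last by apply/funext => y; exact: int0.
  by rewrite derive1_cst /fn /patch ifT// inE /J /= in_itv /= Dx.
have : {ae mu, forall x (n : nat), D x -> x <= n%:R -> f x = 0} by apply: ae_foralln.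
apply: filterS => x /(_ (Num.truncn x).+1) h Dx; apply: h => //.
exact/ltW/truncnS_gt.
Qed.

End Indicators.

(** * Hilbert--Schmidt operators have kernels *)

Section GramSchmidt.
Context {R : realType} {V : lmodType R[i]} (ip : inner_product V).
Local Notation "<| u , v |>" := (dot ip u v) (at level 0).
Local Notation nsq := (nsq ip).

(** The inverse of 0 is 0, so null vectors are sent to 0. *)
Definition normalize (w : V) : V := (Num.sqrt (nsq w))^-1%:C%C *: w.

Lemma nsq_normalize w : nsq (normalize w) = (nsq w != 0)%:R.
Proof.
rewrite nsqZ sqmod_real exprVn sqr_sqrtr ?nsq_ge0//.
by have [->|w0] := eqVneq (nsq w) 0; rewrite ?mulr0// mulVf.
Qed.

Lemma dot_normalize0 w u : <| u, normalize w |> = 0 -> <| u, w |> = 0.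
Proof.
have [w0 _|w0] := eqVneq (nsq w) 0; first by rewrite dotC dot_nsq0// conjc0.
rewrite /normalize dotZr => /eqP; rewrite mulf_eq0 conjc_eq0 => /orP[|/eqP//].
rewrite (_ : 0 = 0%:C%C)// => /eqP/complexI/eqP; rewrite invr_eq0 sqrtr_eq0.
by rewrite leNgt lt_neqAle nsq_ge0 andbT eq_sym w0.
Qed.

Fixpoint gram_schmidt_seq (v : nat -> V) n : seq V :=
  if n is m.+1 then
    rcons (gram_schmidt_seq v m)
      (normalize (v m - \sum_(h <- gram_schmidt_seq v m) <| v m, h |> *: h))
  else [::].

Definition gram_schmidt v n : V := nth 0 (gram_schmidt_seq v n.+1) n.

Lemma size_gram_schmidt_seq v n : size (gram_schmidt_seq v n) = n.
Proof. by elim: n => //= n IH; rewrite size_rcons IH. Qed.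

Lemma gram_schmidt_seqE v n : gram_schmidt_seq v n = mkseq (gram_schmidt v) n.
Proof.
elim: n => // n IH; rewrite mkseqS -IH /=; congr rcons.
by rewrite /gram_schmidt /= nth_rcons size_gram_schmidt_seq ltnn eqxx.
Qed.

Lemma gram_schmidtE v n : gram_schmidt v n =
  normalize (v n - \sum_(i < n) <| v n, gram_schmidt v i |> *: gram_schmidt v i).
Proof.
rewrite {1}/gram_schmidt /= nth_rcons size_gram_schmidt_seq ltnn eqxx.
rewrite gram_schmidt_seqE big_map.
rewrite -(big_mkord xpredT (fun i => <| v n, gram_schmidt v i |> *: gram_schmidt v i)).
by rewrite /index_iota subn0.
Qed.

Lemma nsq_gram_schmidt v n :
  nsq (gram_schmidt v n) = 1 \/ gram_schmidt v n = 0.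
Proof.
rewrite gram_schmidtE; set w := _ - _.
have [w0|w0] := eqVneq (nsq w) 0; last by left; rewrite nsq_normalize w0.
by right; rewrite /normalize w0 sqrtr0 invr0 scale0r.
Qed.

Lemma gram_schmidt_orth v i j : i != j ->
  <| gram_schmidt v i, gram_schmidt v j |> = 0.
Proof.
have key n : forall k, (k < n)%N -> <| gram_schmidt v n, gram_schmidt v k |> = 0.
  elim/ltn_ind: n => n IH k kn; rewrite gram_schmidtE /normalize.
  set c := (Num.sqrt _)^-1; rewrite dotZl dotDl dotNl dot_suml.
  rewrite (bigD1 (Ordinal kn))//= big1 ?addr0; last first.
    move=> l lk; rewrite dotZl.
    have lkn : (l : nat) != k by apply: contra lk => /eqP lk; apply/eqP/val_inj.
    have [h|h] := ltnP k l; first by rewrite IH ?mulr0.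
    by rewrite (dotC ip (gram_schmidt v l)) (IH k kn l) ?conjc0 ?mulr0// ltn_neqAle lkn.
  rewrite dotZl dot_nsq; have [->|->] := nsq_gram_schmidt v k.
    by rewrite mulr1 subrr mulr0.
  by rewrite dot0r mul0r subr0 mulr0.
move=> ij; have [h|h] := ltnP j i; first exact: key.
by rewrite dotC key ?conjc0// ltn_neqAle ij.
Qed.

Lemma nsq_gram_schmidt_le1 v n : nsq (gram_schmidt v n) <= 1.
Proof. by have [->//|->] := nsq_gram_schmidt v n; rewrite nsq0. Qed.

Lemma gram_schmidt_total v u : (forall n, <| u, gram_schmidt v n |> = 0) ->
  forall n, <| u, v n |> = 0.
Proof.
move=> uh n; have := uh n; rewrite gram_schmidtE => /dot_normalize0.
rewrite dotDr dotNr dot_sumr big1 ?subr0// => i _.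
by rewrite dotZr uh mulr0.
Qed.

Lemma bessel_gram_schmidt v (I : finType) (e : I -> nat) : injective e ->
  bessel ip (fun i => gram_schmidt v (e i)).
Proof.
move=> ei; apply: bessel_orth => [i j ij|i]; last exact: nsq_gram_schmidt_le1.
by apply: gram_schmidt_orth; rewrite (inj_eq ei).
Qed.

End GramSchmidt.

Section HilbertSchmidtKernel.
Variable R : realType.
Local Notation mu := (@lebesgue_measure R).
Local Notation D := (@Rpos R).
Local Notation mD := (@measurable_Rpos R).
Local Notation DD := (D `*` D).
Local Notation mDD := (@measurable_RposX R).
Local Notation mu2 := (mu \x mu)%E.
Local Notation RR := (measurableTypeR R * measurableTypeR R)%type.
Local Notation ip := (@L2ip R).
Local Notation nsq := (nsq ip).
Local Notation "<| u , v |>" := (dot ip u v) (at level 0).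
Local Notation op := (@integral_operator R).
Implicit Types (u v : L2 R).

Lemma bounded_sums_cauchy (a : nat -> R) (H : R) : (forall n, 0 <= a n) ->
  (forall n, \sum_(i < n) a i <= H) -> forall e, 0 < e ->
  exists N, forall m n, (N <= m)%N -> \sum_(i < n) a (m + i)%N <= e.
Proof.
move=> a0 aH e e0; pose S n := \sum_(i < n) a i.
have SD m n : S (m + n)%N = S m + \sum_(i < n) a (m + i)%N.
  by rewrite /S big_split_ord.
have has : has_sup (range S).
  by split; [exists (S 0%N); exists 0%N|exists H => _ [n _ <-]; exact: aH].
have [_ [N _ <-] SN] := sup_adherent e0 has.
exists N => m n Nm.
have Sm : S N <= S m by rewrite -(subnKC Nm) SD lerDl sumr_ge0.
have : S (m + n)%N <= sup (range S).
  by apply: ub_le_sup; [exact: has.2|exists (m + n)%N].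
by rewrite SD; move: SN Sm; lra.
Qed.

Lemma L2_complete (u : nat -> L2 R) :
  (forall e : R, 0 < e -> exists N, forall m n, (N <= m)%N -> (N <= n)%N ->
    nsq (u m - u n) <= e) ->
  exists w, forall e : R, 0 < e -> exists N, forall n, (N <= n)%N -> nsq (u n - w) <= e.
Proof.
have nB v w : (nsq (v - w))%:E = sqnorm mu D (fun x => L2repr v x - L2repr w x)%R.
  rewrite nsq_repr; apply: ae_eq_sqnorm; first exact: mD.
  - exact: sqint_meas (L2reprP _).
  - by apply: cmeasurableB; exact: sqint_meas (L2reprP _).
  - exact: L2reprB.
move=> uC; have [||g g2 gP] := @sqint_complete _ _ R mu D mD (fun n => L2repr (u n)).
- by move=> n; exact: L2reprP.
- move=> e e0; have [N NP] := uC e e0; exists N => m n Nm Nn.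
  by rewrite -nB lee_fin NP.
exists (L2class g) => e e0; have [N NP] := gP e e0; exists N => n Nn.
rewrite -lee_fin nB; apply: le_trans (NP n Nn).
rewrite le_eqVlt; apply/orP; left; apply/eqP/ae_eq_sqnorm; first exact: mD.
- by apply: cmeasurableB; exact: sqint_meas (L2reprP _).
- by apply: cmeasurableB; [exact: sqint_meas (L2reprP _)|case: g2].
- by apply: filterS (L2repr_class g2) => x h Dx; rewrite h.
Qed.

(** Orthogonality to the indicators kills the integrals of the real and
    imaginary parts over all intervals starting at 0. *)
Lemma L2_orth_ind u : (forall b : R, 0 < b -> <| u, L2ind 0 b |> = 0) -> u = 0.
Proof.
move=> u0; have u2 := L2reprP u.
have ci (b : R) : cintegrable mu `]0, b]%classic (L2repr u).
  have h : cintegrable mu D (fun x => L2repr u x * ind `]0, b]%classic x).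
    by apply: sqintM => //; [exact: mD|exact: sqint_itv].
  have sub : `]0, b]%classic `<=` D by move=> x /=; rewrite in_itv /= => /andP[].
  have [hr hi] := h; split.
    apply: eq_integrable (integrableS mD (measurable_itv _) sub hr) => //.
    by move=> x xb; rewrite /= /ind indicE xb (_ : 1%:C%C = 1)// mulr1.
  apply: eq_integrable (integrableS mD (measurable_itv _) sub hi) => //.
  by move=> x xb; rewrite /= /ind indicE xb (_ : 1%:C%C = 1)// mulr1.
have cz (b : R) : 0 < b -> cintegral mu `]0, b]%classic (L2repr u) = 0.
  by move=> b0; rewrite -dot_ind// u0.
have zr : {ae mu, forall x, D x -> Re (L2repr u x) = 0}.
  apply: ae0_of_integrals => b b0; first by case: (ci b).
  by have := cz b b0 => -[].
have zi : {ae mu, forall x, D x -> Im (L2repr u x) = 0}.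
  apply: ae0_of_integrals => b b0; first by case: (ci b).
  by have := cz b b0 => -[].
apply: L2_eqP; apply: filterS (filterI zr (filterI zi (@L2repr0 R))) => x [h1 [h2 h3]] Dx.
rewrite (h3 Dx); apply/eqP; rewrite eq_complex (h1 Dx) (h2 Dx) /= !eqxx.
by [].
Qed.

Lemma L2ind_split (a b c : R) : a <= b -> b <= c -> L2ind a c = L2ind a b + L2ind b c.
Proof.
move=> ab bc; rewrite [RHS]L2classD; try exact: sqint_itv.
congr L2class; apply/funext => x.
suff E : (x \in `]a, c]%classic) = (x \in `]a, b]%classic) (+) (x \in `]b, c]%classic) /\
    ~~ ((x \in `]a, b]%classic) && (x \in `]b, c]%classic)).
  rewrite /ind !indicE E.1; move: E.2; rewrite -rmorphD/= -natrD.
  by case: (x \in `]a, b]%classic); case: (x \in `]b, c]%classic).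
rewrite !mem_setE !in_itv /=.
have [ax|xa] := ltP a x; have [bx|xb] := ltP b x; rewrite /= ?(le_trans xb bc)//.
by have := lt_le_trans bx xa; rewrite ltNge ab.
Qed.

(** A countable total family.  Indices that encode no rational number give the
    empty interval, hence the zero vector. *)
Definition rational_indicators j : L2 R :=
  L2ind 0 (if unpickle j is Some q then `|ratr (q : rat)| else 0).

Definition basis := gram_schmidt ip rational_indicators.

Lemma basis_total u : (forall n, <| u, basis n |> = 0) -> u = 0.
Proof.
move=> /gram_schmidt_total uq; apply: L2_orth_ind => b b0.
apply: sqmod_eq0; apply/le_anti; rewrite sqmod_ge0 andbT.
apply/ler_addgt0Pr => e e0; rewrite add0r.
pose d := e / (nsq u + 1).
have u1 : 0 < nsq u + 1 by rewrite ltr_wpDl ?nsq_ge0.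
have d0 : 0 < d by rewrite divr_gt0.
have mb : Num.max 0 (b - d) < b by rewrite gt_max b0 ltrBlDr ltrDl.
have [q] := rat_in_itvoo mb.
rewrite in_itv /= gt_max => /andP[/andP[q0 dq] qb].
have := uq (pickle q); rewrite /rational_indicators pickleK ger0_norm ?(ltW q0)// => uq0.
rewrite (@L2ind_split 0 (ratr q) b (ltW q0) (ltW qb)) dotDr uq0 add0r.
apply: (le_trans (cauchy_schwarz _ _ _)).
rewrite nsq_ind ?(ltW q0) ?(ltW qb)//.
apply: (@le_trans _ _ (nsq u * d)).
  by rewrite ler_wpM2l ?nsq_ge0// lerBlDl -lerBlDr ltW.
by rewrite /d mulrA ler_pdivrMr// mulrC ler_pM2l// lerDl.
Qed.

Definition expansion u n := \sum_(i < n) <| u, basis i |> *: basis i.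

Lemma bessel_basis m n : bessel ip (fun i : 'I_n => basis (m + i)).
Proof. by apply: bessel_gram_schmidt => i j /addnI ij; exact: val_inj. Qed.

(** The expansion is Cauchy by the Bessel inequality; its limit differs from [u]
    by a vector orthogonal to a total family. *)
Lemma expansion_cvg u : forall e, 0 < e -> exists N, forall n, (N <= n)%N ->
  nsq (u - expansion u n) <= e.
Proof.
pose a i := sqmod <| u, basis i |>.
have a0 i : 0 <= a i by exact: sqmod_ge0.
have aH n : \sum_(i < n) a i <= nsq u.
  by have := bessel_dual u (@bessel_basis 0 n).
have [w wP] : exists w, forall e : R, 0 < e -> exists N, forall n, (N <= n)%N ->
    nsq (expansion u n - w) <= e.
  apply: L2_complete => e e0; have [N NP] := bounded_sums_cauchy a0 aH e0.
  exists N; have key m n : (N <= m)%N -> nsq (expansion u (m + n) - expansion u m) <= e.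
    move=> Nm; rewrite /expansion big_split_ord /= addrAC subrr add0r.
    by apply: le_trans (NP m n Nm); exact: (@bessel_basis m n).
  move=> m n Nm Nn; have [mn|/ltnW nm] := leqP m n.
    by rewrite -nsqN opprB -(subnKC mn) key.
  by rewrite -(subnKC nm) key.
suff uw : u = w.
  move=> e e0; have [N NP] := wP e e0; exists N => n Nn.
  have -> : u - expansion u n = - (expansion u n - w).
    by rewrite opprB; apply: (congr1 (fun z => z - _) uw).
  rewrite nsqN; exact: NP.
apply/eqP; rewrite -subr_eq0; apply/eqP; apply: basis_total => k.
apply: sqmod_eq0; apply/le_anti; rewrite sqmod_ge0 andbT.
apply/ler_addgt0Pr => e e0; rewrite add0r.
have [N NP] := wP e e0.
have {NP} := NP (maxn N k.+1) (leq_maxl _ _).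
set n := maxn N k.+1; have kn : (k < n)%N by exact: leq_maxr.
move=> nw.
have -> : <| u - w, basis k |> = <| expansion u n - w, basis k |>.
  rewrite !dotDl; congr (_ + _); rewrite /expansion dot_suml (bigD1 (Ordinal kn))//=.
  rewrite big1 ?addr0; last first.
    by move=> i ik; rewrite dotZl gram_schmidt_orth ?mulr0//; apply: contra ik => /eqP ik; apply/eqP/val_inj.
  have hk : nsq (basis k) = 1 \/ basis k = 0 by exact: nsq_gram_schmidt.
  rewrite dotZl dot_nsq; case: hk => ->; first by rewrite mulr1.
  by rewrite dot0r mul0r.
apply: (le_trans (cauchy_schwarz _ _ _)); rewrite -[leRHS]mulr1.
by apply: ler_pM => //; rewrite ?nsq_ge0// nsq_gram_schmidt_le1.
Qed.

Lemma linearB_arg (T : L2 R -> L2 R) : linear T -> forall u v, T (u - v) = T u - T v.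
Proof.
by move=> lT u v; rewrite addrC -scaleN1r lT scaleN1r addrC.
Qed.

(** For fixed [x] the slice in [y] is a combination of the [h i], whose norm
    the Bessel property controls by the coefficients [L2repr (f i) x]. *)
Lemma sqnorm_sum_tensor (I : finType) (f h : I -> L2 R) : bessel ip h ->
  (sqnorm mu2 DD (fun z => \sum_i tensor (L2repr (f i)) (L2repr (h i)) z)%R <=
   (\sum_i nsq (f i))%R%:E)%E.
Proof.
move=> bh; have t2 i : square_integrable mu2 DD (tensor (L2repr (f i)) (L2repr (h i))).
  by apply: sqint_tensor; exact: L2reprP.
pose F (z : RR) : R[i] := \sum_i tensor (L2repr (f i)) (L2repr (h i)) z.
have F2 : square_integrable mu2 DD F by exact: sqint2_sum.
rewrite (sqnorm_sections (sqint_meas2 F2)).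
apply: (@le_trans _ _ (\int[mu]_(x in D) \sum_i (sqmod (L2repr (f i) x))%:E)%E); last first.
  rewrite ge0_integral_sum//; last 3 first.
  - exact: mD.
  - by move=> i; apply: measurable_sqmod; exact: sqint_meas (L2reprP _).
  - by move=> i x _; rewrite lee_fin sqmod_ge0.
  rewrite -sumEFin; apply: lee_sum => i _.
  by rewrite nsq_repr.
apply: ge0_le_integral.
- exact: mD.
- by move=> x _; exact: sqnorm_ge0.
- exact: (measurable_sqnorm_section (sqint_meas2 F2)).
- by apply: emeasurable_sum => i; apply: measurable_sqmod; exact: sqint_meas (L2reprP _).
move=> x Dx; rewrite sumEFin.
pose c i := (L2repr (f i) x)^*%C.
have := bh c; rewrite -lee_fin nsq_repr.
under [X in (_ <= X%:E)%E -> _]eq_bigr do rewrite sqmodJ.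
apply: le_trans; rewrite le_eqVlt; apply/orP; left; apply/eqP.
rewrite (_ : sqnorm mu D (fun y => F (x, y)) =
   sqnorm mu D (fun y => \sum_i c i * L2repr (h i) y)); last first.
  apply: eq_integral => y _; rewrite -sqmodJ rmorph_sum/=; congr (sqmod _)%:E.
  by apply: eq_bigr => i _; rewrite /tensor /= rmorphM/= conjcK.
apply: ae_eq_sqnorm; first exact: mD.
- by apply: cmeasurable_sum => i _; apply: cmeasurableM; [exact: cmeasurable_cst|exact: sqint_meas (L2reprP _)].
- exact: sqint_meas (L2reprP _).
apply: filterS (L2repr_sumZ (index_enum I) xpredT c h) => y hy Dy; exact: esym (hy Dy).
Qed.

Lemma op_sum_tensor (I : finType) (f h : I -> L2 R) u :
  op (fun z => \sum_i tensor (L2repr (f i)) (L2repr (h i)) z) u =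
  \sum_i <| u, h i |> *: f i.
Proof.
rewrite op_sum; last by move=> i _; apply: sqint_tensor; exact: L2reprP.
apply: eq_bigr => i _; rewrite op_tensor ?L2reprK//; exact: L2reprP.
Qed.

(** The vectors [basis n] are orthonormal up to null ones, and their images have
    summable squared norms, so the kernels of the truncations of [T] to the first basis vectors form a Cauchy
    sequence; its limit is the kernel of [T]. *)
Theorem hilbert_schmidt_kernel (T : L2 R -> L2 R) (H : R) : bounded_operator T ->
  (forall n, \sum_(i < n) snum T i ^+ 2 <= H) ->
  exists k, @L2_kernels R k /\ T = op k.
Proof.
move=> bT TH; have [lT _] := bT.
pose a i := nsq (T (basis i)).
have a0 i : 0 <= a i by exact: nsq_ge0.
have aH n : \sum_(i < n) a i <= H.
  apply: le_trans (TH n).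
  have := hilbert_schmidt_bound lT (snum_ge0 T) (snum_approximable bT) (@bessel_basis 0 n).
  by rewrite card_ord.
pose t i := tensor (L2repr (T (basis i))) (L2repr (basis i)).
have t2 i : square_integrable mu2 DD (t i) by apply: sqint_tensor; exact: L2reprP.
pose K n : RR -> R[i] := fun z => \sum_(i < n) t i z.
have K2 n : square_integrable mu2 DD (K n) by apply: sqint2_sum.
have opK n u : op (K n) u = T (expansion u n).
  by rewrite /K (@op_sum_tensor 'I_n) /expansion linear_sumZ.
have swapd (f g : RR -> R[i]) : sqnorm mu2 DD (fun z => f z - g z)%R =
    sqnorm mu2 DD (fun z => g z - f z)%R.
  by apply: eq_integral => z _; rewrite sqmodB.
have [||k k2 kP] := @sqint_complete _ _ R mu2 DD mDD K.
- exact: K2.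
- move=> e e0; have [N NP] := bounded_sums_cauchy a0 aH e0; exists N.
  have key m n : (N <= m)%N -> (sqnorm mu2 DD (fun z => K (m + n)%N z - K m z)%R <= e%:E)%E.
    move=> Nm; rewrite (_ : (fun z => _) = (fun z => \sum_(i < n) t (m + i)%N z)); last first.
      by apply/funext => z; rewrite /K big_split_ord /= addrAC subrr add0r.
    apply: (le_trans (sqnorm_sum_tensor (fun i : 'I_n => T (basis (m + i))) (@bessel_basis m n))).
    by rewrite lee_fin; exact: NP.
  move=> m n Nm Nn; have [mn|/ltnW nm] := leqP m n.
    by rewrite swapd -(subnKC mn) key.
  by rewrite -(subnKC nm) key.
exists k; split => //; apply/funext => u.
apply/eqP; rewrite -subr_eq0; apply/eqP/nsq_eq0.
apply/le_anti; rewrite nsq_ge0 andbT; apply/ler_addgt0Pr => e e0; rewrite add0r.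
have [A TA] : exists A : R, forall v, nsq (T v) <= A ^+ 2 * nsq v.
  have [_ oT] := bT; exists (fine (opnorm T)); apply: opnormP => //.
  by rewrite fineK// ge0_fin_numE ?opnorm_ge0.
pose B := A ^+ 2 + nsq u + 1.
have B0 : 0 < B by rewrite ltr_wpDl// addr_ge0 ?sqr_ge0 ?nsq_ge0.
pose d := e / (2 * B); have d0 : 0 < d by rewrite divr_gt0// mulr_gt0.
have [N1 P1] := expansion_cvg u d0; have [N2 P2] := kP d d0.
pose n := maxn N1 N2.
have h1 : nsq (T u - op (K n) u) <= A ^+ 2 * d.
  rewrite opK -linearB_arg// (le_trans (TA _))// ler_wpM2l ?sqr_ge0//.
  exact: P1 (leq_maxl _ _).
have h2 : nsq (op (K n) u - op k u) <= d * nsq u.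
  have -> : op (K n) u - op k u = op (fun z => K n z + (-1) * k z) u.
    by rewrite opD ?opZ ?scaleN1r//; exact: sqint2Z.
  rewrite -lee_fin; apply: (le_trans (nsq_op_le _ _)).
    by apply: sqint2D => //; exact: sqint2Z.
  rewrite EFinM lee_wpmul2r ?lee_fin ?nsq_ge0//.
  rewrite (_ : (fun z => _) = (fun z => K n z - k z)); first exact: P2 (leq_maxr _ _).
  by apply/funext => z; rewrite mulN1r.
rewrite -(subrKA (op (K n) u)); apply: (le_trans (nsqD_le _ _ _)).
apply: (@le_trans _ _ (2 * (A ^+ 2 * d + d * nsq u))).
  by rewrite ler_pM2l// lerD.
have dB : d * (2 * B) = e by rewrite /d divfK// gt_eqF// mulr_gt0.
rewrite -dB /B -subr_ge0; move: (nsq u) (A ^+ 2) => x y.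
rewrite (_ : _ - _ = 2 * d); last by ring.
by rewrite mulr_ge0// ltW.
Qed.

End HilbertSchmidtKernel.

(** * Averaged symbols *)

Section Symbols.
Variable R : realType.
Local Notation mu := (@lebesgue_measure R).
Local Notation D := (@Rpos R).
Local Notation mD := (@measurable_Rpos R).
Local Notation DD := (D `*` D).
Local Notation mDD := (@measurable_RposX R).
Local Notation mu2 := (mu \x mu)%E.
Local Notation RR := (measurableTypeR R * measurableTypeR R)%type.
Local Notation sqint := (square_integrable mu D).
Local Notation ip := (@L2ip R).
Local Notation nsq := (nsq ip).
Local Notation op := (@integral_operator R).
Implicit Types (k : RR -> R[i]) (phi psi : R -> R[i]) (u v : L2 R).

(** The two halves of the averaged symbol are [lower k] and
    [lower (transpose k)], up to the factor [(2 * x)^-1]. *)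
Definition lower k x : R[i] := cintegral mu `]0, x[%classic (fun t => k (x, t)).

Lemma subset_oo_Rpos (x : R) : `]0, x[%classic `<=` D.
Proof. by move=> t /=; rewrite in_itv /= => /andP[]. Qed.

Lemma lower_ind k x :
  lower k x = cintegral mu D (fun y => k (x, y) * ind `]0, x[%classic y).
Proof. by rewrite cintegral_ind setIidr//; exact: subset_oo_Rpos. Qed.

Lemma measurable_triangle : measurable [set z : RR | z.2 < z.1].
Proof.
have m1 : measurable_fun [set: RR] (fun z : RR => z.1 - z.2 : R).
  by apply: measurable_funB; [exact: measurable_fst|exact: measurable_snd].
have -> : [set z : RR | z.2 < z.1] = (fun z : RR => z.1 - z.2 : R) @^-1` `]0, +oo[%classic.
  by apply/seteqP; split => z /=; rewrite in_itv /= andbT subr_gt0.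
by rewrite -[X in measurable X]setTI; exact: m1.
Qed.

Lemma cmeasurable_triangle k : cmeasurable DD k ->
  cmeasurable DD (fun z => k z * (\1_[set z : RR | z.2 < z.1] z)%:C%C).
Proof.
move=> mk; apply: cmeasurableM => //; apply: cmeasurable_real.
by apply: measurable_indic; exact: measurable_triangle.
Qed.

Lemma cmeasurable_lower k : cmeasurable DD k -> cmeasurable D (lower k).
Proof.
move=> mk; have [mr mi] := cmeasurable_integral_section (cmeasurable_triangle mk).
have E x : D x -> lower k x = cintegral mu D
    (fun y => k (x, y) * (\1_[set z : RR | z.2 < z.1] (x, y))%:C%C).
  move=> Dx; rewrite lower_ind; apply: eq_cintegral => y Dy; congr (_ * _).
  rewrite /ind !indicE; congr (_%:R%:C%C); congr (nat_of_bool _).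
  by apply/idP/idP; rewrite !inE /= in_itv /= ?(Dy : 0 < y) // => /andP[].
split; [apply: eq_measurable_fun mr => x|apply: eq_measurable_fun mi => x];
  by rewrite inE => Dx; rewrite E.
Qed.

(** The two integrals differ by one over the interval from [a] to [x], to which
    the Cauchy--Schwarz inequality applies.  The rate in [x - a] makes the limit
    along finer and finer grids explicit. *)
Lemma lower_approx k (x a : R) : sqint (fun y => k (x, y)) -> 0 <= a -> a < x ->
  ((sqmod (lower k x - cintegral mu D (fun y => k (x, y) * ind `]0%R, a]%classic y)%R))%:E
    <= sqnorm mu D (fun y => k (x, y)) * (x - a)%:E)%E.
Proof.
move=> kx a0 ax.
have k1 (A : set R) : measurable A -> (mu A < +oo)%E ->
    cintegrable mu D (fun y => k (x, y) * ind A y).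
  by move=> mA fA; apply: sqintM => //; [exact: mD|exact: sqint_ind].
have fin (b c : R) (s t : bool) : (mu [set` Interval (BSide s b) (BSide t c)] < +oo)%E.
  by rewrite lebesgue_measure_itv; case: ifP => _; rewrite ?ltry.
have -> : lower k x - cintegral mu D (fun y => k (x, y) * ind `]0, a]%classic y) =
    cintegral mu D (fun y => k (x, y) * ind `]a, x[%classic y).
  rewrite lower_ind; apply/eqP; rewrite subr_eq; apply/eqP.
  rewrite -cintegralD//; [|exact: mD|exact: k1|exact: k1].
  apply: eq_cintegral => y Dy; rewrite -mulrDr; congr (_ * _).
  rewrite /ind !indicE -rmorphD/= -natrD; congr (_%:R%:C%C).
  rewrite !mem_setE !in_itv /= (Dy : 0 < y) /=.
  have [ay|ya] := ltP a y; first by rewrite addn0.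
  by rewrite (le_lt_trans ya ax).
have i2 : sqint (ind `]a, x[%classic) by apply: sqint_ind.
apply: (le_trans (cauchy_schwarz_fun kx i2)).
rewrite lee_wpmul2l ?sqnorm_ge0// sqnorm_ind//.
apply: (@le_trans _ _ (mu `]a, x[%classic)).
  by apply: le_measure => //; rewrite inE//; apply: measurableI => //; exact: mD.
by rewrite lebesgue_measure_itv /= lte_fin ax.
Qed.

Lemma lower_bound_sq k (x : R) : 0 < x -> sqint (fun y => k (x, y)) ->
  ((sqmod (lower k x))%:E <= sqnorm mu D (fun y => k (x, y)) * x%:E)%E.
Proof.
move=> x0 kx; have := lower_approx kx (lexx 0) x0.
rewrite subr0 (_ : cintegral _ _ _ = 0) ?subr0//.
by rewrite cintegral_ind set_itvoc0 ?ltxx// setI0 /cintegral !Rintegral_set0.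
Qed.

(** The value of [lower k x] is the limit of the values at [x] of [op k]
    applied to indicators of rational intervals, so the operator determines it
    almost everywhere. *)
Lemma lower_eq0 k : square_integrable mu2 DD k -> (forall u, op k u = 0) ->
  {ae mu, forall x, D x -> lower k x = 0}.
Proof.
move=> k2 k0; pose q j : R := if unpickle j is Some q then `|ratr (q : rat)| else 0.
have H : {ae mu, forall x j, D x -> op_fun k (ind `]0, q j]%classic) x = 0}.
  apply: ae_foralln => j; have := k0 (L2ind 0 (q j)).
  rewrite /L2ind (op_class k2 (sqint_itv _ _)) => E.
  have i2 := sqint_op_fun k2 (sqint_itv 0 (q j)).
  have := L2repr_class i2; rewrite E => h.
  apply: filterS2 h (@L2repr0 R) => x h1 h2 Dx.
  by rewrite -(h1 Dx); exact: h2.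
apply: filterS2 H (sqint_section k2) => x Hx kx Dx.
have {}kx := kx Dx; have kf := sqnorm_fin kx.
set K := fine (sqnorm mu D (fun y => k (x, y))).
have K0 : 0 <= K by rewrite fine_ge0// sqnorm_ge0.
apply: sqmod_eq0; apply/le_anti; rewrite sqmod_ge0 andbT.
apply/ler_addgt0Pr => e e0; rewrite add0r.
pose d := e / (K + 1).
have K1 : 0 < K + 1 by rewrite ltr_wpDl.
have d0 : 0 < d by rewrite divr_gt0.
have mb : Num.max 0 (x - d) < x by rewrite gt_max (Dx : 0 < x) ltrBlDr ltrDl.
have [r] := rat_in_itvoo mb.
rewrite in_itv /= gt_max => /andP[/andP[r0 dr] rx].
have := Hx (pickle r) Dx; rewrite /q pickleK ger0_norm ?(ltW r0)// /op_fun => E.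
have := lower_approx kx (ltW r0) rx; rewrite E subr0 -(fineK kf) -/K -EFinM lee_fin.
move=> /le_trans; apply; apply: (@le_trans _ _ (K * d)).
  by rewrite ler_wpM2l// lerBlDl -lerBlDr ltW.
by rewrite /d mulrA ler_pdivrMr// mulrC ler_pM2l// lerDl.
Qed.

Lemma op_transpose_eq0 k : square_integrable mu2 DD k -> (forall u, op k u = 0) ->
  forall u, op (transpose k) u = 0.
Proof.
move=> k2 k0 u; apply: nsq_eq0; rewrite /nsq dot_op_transpose// k0.
by rewrite dot0l.
Qed.

Lemma ae_lower_linear a k k' : square_integrable mu2 DD k -> square_integrable mu2 DD k' ->
  {ae mu, forall x, D x -> lower (fun z => a * k z + k' z) x = a * lower k x + lower k' x}.
Proof.
move=> k2 k2'; apply: filterS2 (sqint_section k2) (sqint_section k2') => x kx kx' Dx.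
have ix : sqint (ind `]0, x[%classic).
  by apply: sqint_ind => //; rewrite lebesgue_measure_itv; case: ifP => _; rewrite ?ltry.
rewrite !lower_ind.
have i1 := sqintM mD (kx Dx) ix; have i2 := sqintM mD (kx' Dx) ix.
rewrite -(cintegralZ mD a i1) -(cintegralD mD (cintegrableZ mD a i1) i2).
by apply: eq_cintegral => y _; rewrite mulrDl mulrA.
Qed.

Lemma inv2C (x : R) : (2 * x%:C%C)^-1 = ((2 * x)^-1)%:C%C :> R[i].
Proof. by rewrite fmorphV rmorphM rmorph_nat. Qed.

Lemma averaged_symbolE k x :
  averaged_symbol k x = (2 * x%:C%C)^-1 * (lower k x + lower (transpose k) x).
Proof. by []. Qed.

(** The symbol depends on the kernel only through its operator, almost
    everywhere; linearity in the operator follows by applying the uniqueness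
    statement to the kernel [a * k1 + k2 - k3]. *)
Lemma averaged_symbol_linear a k1 k2 k3 : square_integrable mu2 DD k1 ->
  square_integrable mu2 DD k2 -> square_integrable mu2 DD k3 ->
  (forall u, op k3 u = a *: op k1 u + op k2 u) ->
  {ae mu, forall x, D x ->
    averaged_symbol k3 x = a * averaged_symbol k1 x + averaged_symbol k2 x}.
Proof.
move=> h1 h2 h3 E.
pose k z := (-1) * k3 z + (a * k1 z + k2 z).
have h12 : square_integrable mu2 DD (fun z => a * k1 z + k2 z).
  by apply: sqint2D => //; exact: sqint2Z.
have hk : square_integrable mu2 DD k by apply: sqint2D => //; exact: sqint2Z.
have k0 u : op k u = 0.
  apply: (etrans (opD u (sqint2Z (-1) h3) h12)).
  have e1 := opZ (-1) u h3; have e2 := opD u (sqint2Z a h1) h2; have e3 := opZ a u h1.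
  apply: (etrans (congr2 +%R e1 (etrans e2 (congr1 (fun w => w + _) e3)))).
  by rewrite E scaleN1r addNr.
have l0 := lower_eq0 hk k0.
have t0 := lower_eq0 (sqint_swap hk) (op_transpose_eq0 hk k0).
have l1 := ae_lower_linear (-1) h3 h12; have l2 := ae_lower_linear a h1 h2.
have t1 := ae_lower_linear (-1) (sqint_swap h3) (sqint_swap h12).
have t2 := ae_lower_linear a (sqint_swap h1) (sqint_swap h2).
apply: filterS (filterI l0 (filterI t0 (filterI l1 (filterI l2 (filterI t1 t2))))).
move=> x [l0x [t0x [l1x [l2x [t1x t2x]]]]] Dx; rewrite !averaged_symbolE.
have L : lower k3 x = a * lower k1 x + lower k2 x.
  have := l1x Dx; rewrite (l2x Dx) => h.
  have : lower k x = 0 by exact: l0x.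
  rewrite /k h mulN1r addrC => /eqP; rewrite subr_eq0 => /eqP <- //.
have T : lower (transpose k3) x = a * lower (transpose k1) x + lower (transpose k2) x.
  have := t1x Dx; rewrite (t2x Dx) => h.
  have : lower (transpose k) x = 0 by exact: t0x.
  rewrite {1}/transpose /k h mulN1r addrC => /eqP; rewrite subr_eq0 => /eqP <- //.
rewrite L T; ring.
Qed.

(** Up to a factor 2, the integral is the squared norm of the kernel
    [max_kernel phi] on the quarter plane. *)
Definition symbol phi := cmeasurable D phi /\
  (\int[mu]_(x in D) (x * sqmod (phi x))%:E < +oo)%E.

Lemma cmeasurable_max_kernel phi : cmeasurable D phi -> cmeasurable DD (max_kernel phi).
Proof.
have real (r : R -> R) : measurable_fun D r ->
    measurable_fun DD (fun z : RR => r (Num.max z.1 z.2)).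
  move=> mr _ Y mY.
  have -> : DD `&` (fun z : RR => r (Num.max z.1 z.2)) @^-1` Y =
      DD `&` (fun z : RR => Num.max z.1 z.2 : R) @^-1` (D `&` r @^-1` Y).
    apply/seteqP; split => z /=; first by move=> [[D1 D2] rz]; split => //; split => //; rewrite /Rpos /= lt_max (D1 : 0 < z.1).
    by move=> [D12 [_ rz]].
  have mm : measurable_fun [set: RR] (fun z : RR => Num.max z.1 z.2 : R).
    by apply: measurable_maxr; [exact: measurable_fst|exact: measurable_snd].
  apply: measurableI; first exact: mDD.
  rewrite -[X in measurable X]setTI; apply: mm => //.
  exact: mr mD _ mY.
move=> [mr mi]; split; first exact: (real (fun x => Re (phi x))).
exact: (real (fun x => Im (phi x))).
Qed.

(** On each side of the diagonal the kernel depends on one variable only, and the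
    other variable ranges over an interval of length [x]. *)
Lemma sqnorm_max_kernel_le phi : cmeasurable D phi ->
  (sqnorm mu2 DD (max_kernel phi) <= 2%:E * \int[mu]_(x in D) (x * sqmod (phi x))%:E)%E.
Proof.
move=> mphi; rewrite /sqnorm.
pose G (z : RR) : \bar R := ((sqmod (phi z.1))%:E * (\1_[set z : RR | z.2 < z.1] z)%:E)%E.
pose G' (z : RR) : \bar R := ((sqmod (phi z.2))%:E * (\1_(~` [set z : RR | z.2 < z.1]) z)%:E)%E.
have mG : measurable_fun DD G.
  apply: emeasurable_funM; first exact: measurable_sqmod (cmeasurable_fst mphi).
  by apply/measurable_EFinP/measurable_indic; exact: measurable_triangle.
have mG' : measurable_fun DD G'.
  apply: emeasurable_funM; first exact: measurable_sqmod (cmeasurable_snd mphi).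
  by apply/measurable_EFinP/measurable_indic/measurableC; exact: measurable_triangle.
have G0 z : (0 <= G z)%E by rewrite mule_ge0// lee_fin ?sqmod_ge0// indicE ler0n.
have G0' z : (0 <= G' z)%E by rewrite mule_ge0// lee_fin ?sqmod_ge0// indicE ler0n.
rewrite (_ : (\int[mu2]_(z in DD) _ = \int[mu2]_(z in DD) (G z + G' z))%E); last first.
  apply: eq_integral => z _; rewrite /G /G' -!EFinM -EFinD /max_kernel !indicE; congr _%:E.
  have [zt|zt] := boolP (z.2 < z.1).
    rewrite mem_set// memNset; last by move=> /(_ zt).
    by rewrite mulr1 mulr0 addr0 max_l// ltW.
  rewrite memNset; last exact/negP.
  rewrite mem_set; last exact/negP.
  by rewrite mulr0 mulr1 add0r max_r// leNgt.
rewrite ge0_integralD//; last exact: mDD.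
rewrite quarter_tonelli1// quarter_tonelli2//.
have mtri : measurable_fun DD (fun z : RR => (\1_[set z : RR | z.2 < z.1] z)%:E : \bar R).
  by apply/measurable_EFinP/measurable_indic; exact: measurable_triangle.
have mtri' : measurable_fun DD (fun z : RR => (\1_(~` [set z : RR | z.2 < z.1]) z)%:E : \bar R).
  by apply/measurable_EFinP/measurable_indic/measurableC; exact: measurable_triangle.
have mw : measurable_fun D (fun x => (x * sqmod (phi x))%:E : \bar R).
  apply/measurable_EFinP; apply: measurable_funM => //.
  by apply/measurable_EFinP; exact: measurable_sqmod.
rewrite mule_natl mule2n; apply: leeD; apply: ge0_le_integral => //.
- exact: mD.
- by move=> x _; apply: integral_ge0 => y _.
- exact: measurable_integral_section.
- move=> x Dx; rewrite /G /=.
  rewrite ge0_integralZl ?lee_fin ?sqmod_ge0//; last first.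
    exact: (measurable_section mtri Dx).
    exact: mD.
  rewrite [X in (_ <= X)%E](_ : _ = (sqmod (phi x))%:E * x%:E)%E; last by rewrite -EFinM mulrC.
  rewrite lee_wpmul2l ?lee_fin ?sqmod_ge0//.
  apply: (@le_trans _ _ (\int[mu]_(y in D) (\1_(`]0, x[%classic : set R) y)%:E)%E).
    rewrite le_eqVlt; apply/orP; left; apply/eqP; apply: eq_integral => y; rewrite inE => Dy; rewrite !indicE; congr (_%:R%:E); congr nat_of_bool.
    by apply/idP/idP; rewrite !inE /= in_itv /= ?(Dy : 0 < y)// => /andP[].
  rewrite integral_indic//; last exact: mD.
  apply: (@le_trans _ _ (mu `]0, x[%classic)).
    by apply: le_measure => //; rewrite inE//; apply: measurableI => //; exact: mD.
  by rewrite lebesgue_measure_itv /= lte_fin (Dx : 0 < x) oppr0 adde0.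
- exact: mD.
- by move=> x _; apply: integral_ge0 => y _.
- exact: (measurable_integral_section (quarter_swap mG')).
- move=> x Dx; rewrite /G' /=.
  rewrite ge0_integralZl ?lee_fin ?sqmod_ge0//; last first.
    exact: (measurable_section (quarter_swap mtri') Dx).
    exact: mD.
  rewrite [X in (_ <= X)%E](_ : _ = (sqmod (phi x))%:E * x%:E)%E; last by rewrite -EFinM mulrC.
  rewrite lee_wpmul2l ?lee_fin ?sqmod_ge0//.
  apply: (@le_trans _ _ (\int[mu]_(y in D) (\1_(`]0, x]%classic : set R) y)%:E)%E).
    rewrite le_eqVlt; apply/orP; left; apply/eqP; apply: eq_integral => y; rewrite inE => Dy; rewrite !indicE; congr (_%:R%:E); congr nat_of_bool.
    by apply/idP/idP; rewrite !inE /= in_itv /= ?(Dy : 0 < y) leNgt => /negP.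
  rewrite integral_indic//; last exact: mD.
  apply: (@le_trans _ _ (mu `]0, x]%classic)).
    by apply: le_measure => //; rewrite inE//; apply: measurableI => //; exact: mD.
  by rewrite lebesgue_measure_itv /= lte_fin (Dx : 0 < x) oppr0 adde0.
Qed.

Lemma sqint_max_kernel phi : symbol phi -> square_integrable mu2 DD (max_kernel phi).
Proof.
move=> [mphi phioo]; split; first exact: cmeasurable_max_kernel.
apply: le_lt_trans (sqnorm_max_kernel_le mphi) _.
by rewrite lte_mul_pinfty// ge0_fin_numE// integral_ge0.
Qed.

(** By the Cauchy--Schwarz inequality [sqmod (lower k x)] is at most [x] times
    the squared norm of the row of [k] at [x], so that [x * sqmod phi] is
    dominated by integrable functions. *)
Lemma symbol_averaged k : square_integrable mu2 DD k -> symbol (averaged_symbol k).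
Proof.
move=> k2; have k2' := sqint_swap k2.
have mk := sqint_meas2 k2; have mk' := sqint_meas2 k2'.
have ma : cmeasurable D (averaged_symbol k).
  apply: cmeasurableM.
    rewrite (_ : (fun x => _) = (fun x => ((2 * x)^-1)%:C%C)).
      apply: cmeasurable_real.
      have mp : measurable_fun D (fun x : R => (2 * x) `^ (-1)).
        apply: measurable_funS measurableT (@subsetT _ D) _.
        by apply: (measurableT_comp (measurable_powR (-1))); exact: measurable_funM.
      apply: eq_measurable_fun mp => x; rewrite inE => Dx.
      by rewrite powR_inv1// mulr_ge0// ltW.
    by apply/funext => x; rewrite inv2C.
  by apply: cmeasurableD; [exact: (cmeasurable_lower mk)|exact: (cmeasurable_lower mk')].
split => //.
apply: (@le_lt_trans _ _ (\int[mu]_(x in D) (sqnorm mu D (fun y => k (x, y)) +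
   sqnorm mu D (fun y => transpose k (x, y))))%E).
  apply: ae_ge0_le_integral.
  - exact: mD.
  - by move=> x Dx; rewrite lee_fin mulr_ge0 ?sqmod_ge0// ltW.
  - apply/measurable_EFinP; apply: measurable_funM => //.
    by apply/measurable_EFinP; exact: measurable_sqmod.
  - by move=> x _; rewrite adde_ge0 ?sqnorm_ge0.
  - by apply: emeasurable_funD; exact: measurable_sqnorm_section.
  apply: filterS2 (sqint_section k2) (sqint_section k2') => x kx kx' Dx.
  have {}kx := kx Dx.
  have {}kx' : sqint (fun y => transpose k (x, y)) by exact: kx'.
  have := lower_bound_sq Dx kx; have := lower_bound_sq Dx kx'.
  rewrite -(fineK (sqnorm_fin kx)) -(fineK (sqnorm_fin kx')).
  rewrite -!EFinM -EFinD !lee_fin averaged_symbolE sqmodM => h1 h2.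
  set A := fine _ in h2 *; set B := fine _ in h1 *.
  have x0 : 0 < x by exact: Dx.
  have -> : sqmod (2 * x%:C%C)^-1 = (4 * x ^+ 2)^-1.
    by rewrite inv2C sqmod_real exprVn exprMn (_ : 2 ^+ 2 = 4)// -natrX.
  have h3 := sqmodD_le (lower k x) (lower (transpose k) x).
  rewrite mulrA (_ : x / (4 * x ^+ 2) = (4 * x)^-1); last first.
    by field; rewrite gt_eqF.
  rewrite mulrC ler_pdivrMr ?mulr_gt0//.
  have A0 : 0 <= A by rewrite fine_ge0// sqnorm_ge0.
  have B0 : 0 <= B by rewrite fine_ge0// sqnorm_ge0.
  apply: (le_trans h3); apply: (@le_trans _ _ (2 * (A * x + B * x))).
    by rewrite ler_pM2l// lerD.
  rewrite -subr_ge0 (_ : _ - _ = 2 * ((A + B) * x)); last by ring.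
  by rewrite !mulr_ge0 ?addr_ge0// ltW.
rewrite ge0_integralD; last 5 first.
- exact: mD.
- by move=> x _; exact: sqnorm_ge0.
- exact: measurable_sqnorm_section.
- by move=> x _; exact: sqnorm_ge0.
- exact: measurable_sqnorm_section.
rewrite -!sqnorm_sections// lte_add_pinfty//; [by case: k2|by case: k2'].
Qed.

(** For [t < x] the value at [(x, t)] is [phi x], whence the averaging fixes
    [phi]. *)
Lemma averaged_symbol_max_kernel phi x : D x -> averaged_symbol (max_kernel phi) x = phi x.
Proof.
move=> x0; rewrite averaged_symbolE.
have E (A : R -> R[i]) : (forall t, `]0, x[%classic t -> A t = phi x) ->
    cintegral mu `]0, x[%classic A = x%:C%C * phi x.
  have mx : fine (mu `]0, x[%classic) = x.
    by rewrite lebesgue_measure_itv /= lte_fin (x0 : 0 < x) /= subr0.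
  move=> Ax; rewrite (eq_cintegral mu Ax) /cintegral.
  rewrite !(Rintegral_cst mu (measurable_itv _)) mx.
  by apply/eqP; rewrite eq_complex ReM ImM /= !mul0r subr0 addr0 !(mulrC x) !eqxx.
rewrite /lower !E; last 2 first.
- by move=> t /=; rewrite in_itv /= => /andP[_ tx]; rewrite /transpose /max_kernel /= max_r// ltW.
- by move=> t /=; rewrite in_itv /= => /andP[_ tx]; rewrite /max_kernel /= max_l// ltW.
have X0 : x%:C%C != 0 :> R[i].
  by rewrite (_ : 0 = 0%:C%C)// (inj_eq (@complexI R)) gt_eqF.
by move: (x%:C%C) X0 (phi x) => X X0 w; field.
Qed.

Lemma eq_Qop phi psi : symbol phi -> symbol psi ->
  {ae mu, forall x, D x -> phi x = psi x} -> Qop phi = Qop psi.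
Proof.
move=> hphi hpsi E; apply: eq_op; try exact: sqint_max_kernel.
apply: filterS (E) => x Ex Dx; apply: filterS E => y Ey Dy.
by rewrite /max_kernel /=; case: ltP => _; [exact: Ey|exact: Ex].
Qed.

Lemma symbol_linear a phi psi : symbol phi -> symbol psi ->
  symbol (fun x => a * phi x + psi x).
Proof.
move=> [mphi hphi] [mpsi hpsi].
have mw (f : R -> R[i]) : cmeasurable D f ->
    measurable_fun D (fun x => (x * sqmod (f x))%:E : \bar R).
  move=> mf; apply/measurable_EFinP; apply: measurable_funM => //.
  by apply/measurable_EFinP; exact: measurable_sqmod.
have w0 (f : R -> R[i]) x : D x -> (0 <= (x * sqmod (f x))%:E)%E.
  by move=> Dx; rewrite lee_fin mulr_ge0 ?sqmod_ge0// ltW.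
have ma : cmeasurable D (fun x => a * phi x + psi x).
  by apply: cmeasurableD => //; apply: cmeasurableM => //; exact: cmeasurable_cst.
split => //.
apply: (@le_lt_trans _ _ (\int[mu]_(x in D) ((2 * sqmod a)%:E * (x * sqmod (phi x))%:E +
   2%:E * (x * sqmod (psi x))%:E))%E).
  apply: ge0_le_integral.
  - exact: mD.
  - exact: w0.
  - exact: mw.
  - by apply: emeasurable_funD; apply: measurable_funeM; exact: mw.
  move=> x Dx; rewrite -!EFinM -EFinD lee_fin.
  apply: (le_trans (ler_wpM2l (ltW Dx) (sqmodD_le _ _))).
  by rewrite sqmodM le_eqVlt; apply/orP; left; apply/eqP; ring.
have a0 : (0 <= (2 * sqmod a)%:E)%E by rewrite lee_fin mulr_ge0// sqmod_ge0.
have fin (f : R -> R[i]) : (\int[mu]_(x in D) (x * sqmod (f x))%:E < +oo)%E ->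
    (\int[mu]_(x in D) (x * sqmod (f x))%:E)%E \is a fin_num.
  by move=> h; rewrite ge0_fin_numE// integral_ge0// => x; exact: w0.
rewrite ge0_integralD; last 5 first.
- exact: mD.
- by move=> x Dx; rewrite mule_ge0// w0.
- by apply: measurable_funeM; exact: mw.
- by move=> x Dx; rewrite mule_ge0// w0.
- by apply: measurable_funeM; exact: mw.
rewrite !ge0_integralZl//; try exact: mD; try exact: mw; try exact: w0.
by rewrite lte_add_pinfty// lte_mul_pinfty//; exact: fin.
Qed.

Lemma Qop_linear a phi psi : symbol phi -> symbol psi ->
  Qop (fun x => a * phi x + psi x) = a *: Qop phi + Qop psi.
Proof.
move=> hphi hpsi; have h1 := sqint_max_kernel hphi; have h2 := sqint_max_kernel hpsi.
apply/funext => u.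
apply: (etrans (opD u (sqint2Z a h1) h2)).
exact: (congr1 (fun w => w + _) (opZ a u h1)).
Qed.

Lemma kernel_ofP T : (exists k, @L2_kernels R k /\ T = op k) ->
  L2_kernels (kernel_of T) /\ T = op (kernel_of T).
Proof. exact: xgetPex. Qed.

End Symbols.

(** * Local Hilbert--Schmidt norms over orthogonal blocks *)

Section LocalSingularVectors.
Context {R : realType}.
Implicit Types (x y p q : R).

(** Concavity: each [x i / s] lies in the unit interval, where [y <= y `^ q]. *)
Lemma powR_sum_le (I : finType) (x : I -> R) q : 0 < q -> q <= 1 ->
  (forall i, 0 <= x i) -> (\sum_i x i) `^ q <= \sum_i x i `^ q.
Proof.
move=> q0 q1 x0; set s := \sum_i x i.
have s0 : 0 <= s by apply: sumr_ge0 => i _.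
have [s00|sn0] := eqVneq s 0.
  by rewrite s00 powR0 ?gt_eqF//; apply: sumr_ge0 => i _; exact: powR_ge0.
have sp : 0 < s by rewrite lt_neqAle eq_sym sn0.
have xs i : x i <= s by rewrite /s (bigD1 i)//= lerDl sumr_ge0.
have h i : x i / s <= (x i / s) `^ q.
  have [->|xi] := eqVneq (x i) 0; first by rewrite mul0r powR_ge0.
  apply: ger1_powR => //; rewrite divr_gt0//=; last by rewrite lt_neqAle eq_sym xi x0.
  by rewrite ler_pdivrMr// mul1r.
have : 1 <= \sum_i (x i / s) `^ q.
  apply: le_trans (ler_sum _ (fun i _ => h i)).
  by rewrite -mulr_suml divff.
under eq_bigr do rewrite powRM ?invr_ge0//.
rewrite -mulr_suml -powR_inv1// -powRrM mulN1r powRN ler_pdivlMr ?powR_gt0//.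
by rewrite mul1r.
Qed.

Lemma sum_pair (A : nmodType) (J I : finType) (F : J * I -> A) :
  \sum_ji F ji = \sum_j \sum_i F (j, i).
Proof. by rewrite pair_bigA; apply: eq_bigr => -[]. Qed.

Lemma sum_option (V : nmodType) (I : finType) (F : option I -> V) :
  \sum_i F i = F None + \sum_i F (Some i).
Proof.
rewrite (bigD1 None)//=; congr (_ + _).
rewrite (reindex_omap Some id) /=; last by case.
by apply: eq_bigl => i; rewrite eqxx.
Qed.

Context {V : lmodType R[i]} (ip : inner_product V).
Local Notation "<| u , v |>" := (dot ip u v) (at level 0).
Local Notation nsq := (nsq ip).
Local Notation bessel := (bessel ip).

Lemma bessel_local_mix (J I : finType) (f : J * I -> V) (U : J -> I -> I -> R[i]) :
  (forall j, unitary (U j)) -> bessel f ->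
  bessel (fun jk => mix (U jk.1) (fun i => f (jk.1, i)) jk.2).
Proof.
move=> hU bf c; rewrite (sum_pair (fun jk => c jk *: _)) /=.
have -> : \sum_j \sum_k c (j, k) *: mix (U j) (fun i => f (j, i)) k =
    \sum_ji (\sum_k c (ji.1, k) * U ji.1 k ji.2) *: f ji.
  rewrite (sum_pair (fun ji => _ *: f ji)) /=.
  apply: eq_bigr => j _; under eq_bigr do rewrite /mix scaler_sumr.
  rewrite exchange_big /=; apply: eq_bigr => i _; rewrite scaler_suml.
  by apply: eq_bigr => k _; rewrite scalerA.
apply: (le_trans (bf _)); rewrite !(sum_pair (fun ji => sqmod _)) /=.
by apply: ler_sum => j _; rewrite (unitary_isometry (hU j)).
Qed.

(** Schur's test for a Gram matrix. *)
Lemma schur_bessel (I : finType) (f : I -> V) (B : R) :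
  (forall i, \sum_j normc <| f i, f j |> <= B) -> forall c,
  nsq (\sum_i c i *: f i) <= B * \sum_i sqmod (c i).
Proof.
move=> fB c; rewrite nsqE dot_suml Re_sum.
pose w i j := normc <| f i, f j |>.
have w0 i j : 0 <= w i j by exact: normc_ge0.
have wC i j : w i j = w j i by rewrite /w dotC normcJ.
apply: (@le_trans _ _ (\sum_i \sum_j w i j * ((sqmod (c i) + sqmod (c j)) / 2))).
  apply: ler_sum => i _; rewrite dot_sumr Re_sum; apply: ler_sum => j _.
  rewrite dotZl dotZr; apply: (le_trans (ler_norm _)).
  apply: (le_trans (normRe_le _)); rewrite !normcM normcJ -/(w i j).
  rewrite mulrA mulrC ler_wpM2l// /sqmod.
  by have := sqr_ge0 (normc (c i) - normc (c j)); nra.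
rewrite (_ : \sum_i _ = \sum_i sqmod (c i) * \sum_j w i j).
  by rewrite mulr_sumr; apply: ler_sum => i _; rewrite mulrC ler_wpM2r ?sqmod_ge0//; exact: fB.
transitivity (\sum_i \sum_j w i j * (sqmod (c i) / 2) + \sum_i \sum_j w i j * (sqmod (c j) / 2)).
  rewrite -big_split; apply: eq_bigr => i _; rewrite -big_split; apply: eq_bigr => j _ /=.
  by rewrite -mulrDr mulrDl.
rewrite [X in _ + X]exchange_big /= -big_split; apply: eq_bigr => i _ /=.
rewrite -!mulr_suml mulrC; under [X in _ + X * _]eq_bigr do rewrite wC.
by field.
Qed.


(** The transfer principle: local Hilbert--Schmidt norms of [A] over disjoint
    blocks are controlled by any bound on its diagonals [<| A f, g |>], since
    mixing each block unitarily turns the block norms into such diagonals. *)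
Lemma block_hilbert_schmidt (A : V -> V) (P : nat -> V -> V) (n : nat) (I : finType)
    (f : 'I_n * I -> V) p S : 0 < p -> p <= 2 -> linear A ->
  (forall j, linear (P j)) ->
  (forall j u v, <| P j u, v |> = <| u, P j v |>) ->
  (forall j u, P j (P j u) = P j u) ->
  (forall (i j : 'I_n) u v, i != j -> <| P i u, P j v |> = 0) ->
  (forall (K : finType) (h g : K -> V), bessel h -> bessel g ->
     \sum_i normc <| A (h i), g i |> `^ p <= S) ->
  bessel f ->
  \sum_(j < n) (\sum_i nsq (P j (A (f (j, i))))) `^ (p / 2) <= S.
Proof.
move=> p0 p2 lA lP aP iP oP AS bf.
pose y (j : 'I_n) i := P j (A (f (j, i))).
have /choice[U hU] : forall j, exists U, unitary U /\
    forall k l, k != l -> <| mix U (y j) k, mix U (y j) l |> = 0.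
  by move=> j; exact: gram_diagonalization.
pose h (jk : 'I_n * I) := mix (U jk.1) (fun i => f (jk.1, i)) jk.2.
have bh : bessel h by apply: bessel_local_mix => // j; case: (hU j).
pose Y (jk : 'I_n * I) := mix (U jk.1) (y jk.1) jk.2.
have YE jk : Y jk = P jk.1 (A (h jk)).
  by rewrite /h /mix linear_sumZ// linear_sumZ.
pose g jk := normalize ip (Y jk).
have bg : bessel g.
  apply: bessel_orth => [[j k] [j' k'] jk|jk]; last first.
    by rewrite nsq_normalize; case: (_ != _); rewrite ?lexx.
  rewrite /g /normalize dotZl dotZr.
  suff -> : <| Y (j, k), Y (j', k') |> = 0 by rewrite !mulr0.
  have [jj|jj] := eqVneq j j'; last by rewrite !YE oP.
  rewrite -jj in jk *; apply: (hU j).2 => /=.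
  by apply: contra jk => /eqP kk; rewrite kk.
have gE jk : normc <| A (h jk), g jk |> = Num.sqrt (nsq (Y jk)).
  have PY : P jk.1 (Y jk) = Y jk by rewrite YE iP.
  have -> : <| A (h jk), g jk |> = <| Y jk, g jk |>.
    rewrite /g /normalize !dotZr; congr (_ * _).
    by rewrite -{1}PY -aP -YE.
  rewrite /g /normalize dotZr dot_nsq normcM normcJ !normc_real.
  rewrite ger0_norm ?invr_ge0 ?sqrtr_ge0// ger0_norm ?nsq_ge0//.
  have [->|Y0] := eqVneq (nsq (Y jk)) 0; first by rewrite mulr0 sqrtr0.
  rewrite -[X in _ * X](sqr_sqrtr (nsq_ge0 ip _)) expr2 mulKf//.
  by rewrite sqrtr_eq0 -ltNge lt_neqAle eq_sym Y0 nsq_ge0.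
apply: le_trans (AS _ h g bh bg).
rewrite sum_pair; apply: ler_sum => j _.
rewrite -(nsq_mix ip (hU j).1 (y j)).
apply: (le_trans (powR_sum_le _ _ _)).
- by rewrite divr_gt0.
- by rewrite ler_pdivrMr// mul1r.
- by move=> k; exact: nsq_ge0.
apply: ler_sum => k _; rewrite gE /= -powR12_sqrt ?nsq_ge0// -powRrM.
by rewrite mulrC.
Qed.

End LocalSingularVectors.

Section Restriction.
Variable R : realType.
Local Notation mu := (@lebesgue_measure R).
Local Notation D := (@Rpos R).
Local Notation sqint := (square_integrable mu D).
Local Notation ip := (@L2ip R).
Local Notation nsq := (nsq ip).
Local Notation "<| u , v |>" := (dot ip u v) (at level 0).
Implicit Types (u v : L2 R) (E F : set R).

Definition restr E u : L2 R := L2class (fun x => L2repr u x * ind E x).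

Lemma sqint_restr E u : measurable E -> sqint (fun x => L2repr u x * ind E x).
Proof. by move=> mE; apply: sqint_mulind => //; exact: L2reprP. Qed.

Lemma restr_linear E : measurable E -> linear (restr E).
Proof.
move=> mE a u v.
have e := etrans (congr1 (fun w => w + restr E v) (L2classZ a (sqint_restr u mE)))
  (L2classD (sqintZ a (sqint_restr u mE)) (sqint_restr v mE)).
apply: (etrans _ (esym e)).
apply: eq_L2class.
- exact: sqint_restr.
- by apply: sqintD; [apply: sqintZ|]; exact: sqint_restr.
apply: filterS2 (L2reprD (a *: u) v) (L2reprZ a u) => x h1 h2 Dx.
rewrite (etrans (h1 Dx) (congr1 (fun w => w + _) (h2 Dx))).
by rewrite mulrDl mulrA.
Qed.

Lemma restr_dot E u v : measurable E ->
  <| restr E u, v |> = cintegral mu (D `&` E) (fun x => L2repr u x * (L2repr v x)^*%C).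
Proof.
move=> mE; rewrite -{1}[v]L2reprK [LHS](L2dot_class (sqint_restr u mE) (L2reprP v)).
by rewrite -cintegral_ind; apply: eq_cintegral => x _; rewrite mulrAC.
Qed.

Lemma restr_adj E u v : measurable E -> <| restr E u, v |> = <| u, restr E v |>.
Proof.
move=> mE; rewrite restr_dot// -{2}[u]L2reprK.
rewrite [RHS](L2dot_class (L2reprP u) (sqint_restr v mE)) -cintegral_ind.
apply: eq_cintegral => x _; rewrite rmorphM mulrA; congr (_ * _).
exact: esym (indJ E x).
Qed.

Lemma restr_restr E F u : measurable E -> measurable F ->
  restr E (restr F u) = restr (E `&` F) u.
Proof.
move=> mE mF; apply: eq_L2class.
- exact: sqint_restr.
- by apply: sqint_restr; exact: measurableI.
apply: filterS (L2repr_class (sqint_restr u mF)) => x h Dx.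
rewrite (h Dx) -mulrA; congr (_ * _); rewrite /ind !indicE in_setI -rmorphM/= -natrM.
by rewrite mulnC mulnb.
Qed.

Lemma restr_set0 u : restr set0 u = 0.
Proof.
apply: eq_L2class; [exact: sqint_restr|exact: sqint0|].
by apply: nearW => x _; rewrite /ind indicE in_set0 mulr0.
Qed.

Lemma restr_orth E F u v : measurable E -> measurable F -> E `&` F = set0 ->
  <| restr E u, restr F v |> = 0.
Proof.
move=> mE mF EF; rewrite restr_adj// restr_restr// EF restr_set0.
exact: dot0r.
Qed.

Lemma nsq_restr E u : measurable E ->
  (nsq (restr E u))%:E = sqnorm mu (D `&` E) (L2repr u).
Proof.
move=> mE; rewrite nsq_class; last exact: sqint_restr.
rewrite [RHS]integral_mkcondr; apply: eq_integral => x _.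
rewrite sqmodM sqmod_ind /patch indicE; case: (x \in E); rewrite ?mulr1 ?mulr0//.
Qed.

End Restriction.

(** * The dyadic system *)

Section DyadicSystem.
Variable R : realType.
Local Notation mu := (@lebesgue_measure R).
Local Notation D := (@Rpos R).
Local Notation mD := (@measurable_Rpos R).
Local Notation ip := (@L2ip R).
Local Notation nsq := (nsq ip).
Local Notation bessel := (bessel ip).
Local Notation "<| u , v |>" := (dot ip u v) (at level 0).
Implicit Types (u v : L2 R) (a b c d x : R).

Lemma dot_ind_disjoint a b c d : b <= c -> <| L2ind a b, L2ind c d |> = 0.
Proof.
move=> bc; rewrite L2dot_class; try exact: sqint_itv.
rewrite -(cintegral0 mu mD); apply: eq_cintegral => x _.
rewrite indJ /ind !indicE -rmorphM/= -natrM mulnb !mem_setE !in_itv /=.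
have [xb|bx] := leP x b; last by rewrite andbF.
by rewrite [c < x]ltNge (le_trans xb bc) /= andbF.
Qed.

Lemma dot_ind_nested b d : 0 <= b -> b <= d -> <| L2ind 0 b, L2ind 0 d |> = b%:C%C.
Proof.
move=> b0 bd; rewrite (L2ind_split b0 bd) dotDr (dot_ind_disjoint 0 d (lexx b)) addr0 dot_nsq.
by rewrite nsq_ind// subr0.
Qed.

Variable delta : R.
Hypothesis delta0 : 0 < delta.

Definition dyadic j : R := delta * 2 ^+ j.

Lemma dyadic_gt0 j : 0 < dyadic j.
Proof. by rewrite mulr_gt0// exprn_gt0. Qed.

Lemma dyadicS j : dyadic j.+1 = 2 * dyadic j.
Proof. by rewrite /dyadic exprS mulrCA. Qed.

Lemma dyadic_le i j : (i <= j)%N -> dyadic i <= dyadic j.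
Proof. by move=> ij; rewrite ler_pM2l// ler_eXn2l// ltr1n. Qed.

Definition nested j : L2 R := (Num.sqrt (dyadic j))^-1%:C%C *: L2ind 0 (dyadic j).

(** Two geometric series of ratio [3 / 4], which is above the square root of
    one half. *)
Lemma geometric_decay (z : R) i J : 0 <= z -> z <= 3 / 4 ->
  \sum_(j < J) z ^+ (i - j) * z ^+ (j - i) <= 8.
Proof.
move=> z0 z34; set y : R := 3 / 4.
have y0 : 0 <= y by rewrite divr_ge0.
apply: (@le_trans _ _ (\sum_(j < J) y ^+ (i - j) * y ^+ (j - i))).
  apply: ler_sum => j _; apply: ler_pM; rewrite ?exprn_ge0//.
    by rewrite lerXn2r.
  by rewrite lerXn2r.
have y4 : 4 * y = 3 by rewrite /y; lra.
have ys m : 4 * y ^+ m.+1 = 3 * y ^+ m by rewrite exprS mulrA y4.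
have small m : (m <= i.+1)%N ->
    \sum_(j < m) y ^+ (i - j) * y ^+ (j - i) <= 4 * y ^+ (i.+1 - m).
  elim: m => [|m IH] mi; first by rewrite big_ord0 mulr_ge0// exprn_ge0.
  rewrite big_ord_recr /= (_ : (m - i = 0)%N) ?expr0 ?mulr1; last by apply/eqP; rewrite subn_eq0.
  have := IH (ltnW mi); rewrite subSn// subSS ys.
  by move: (y ^+ (i - m)) (\sum_(_ < _) _) => t s; lra.
have [Ji|iJ] := leqP J i.+1.
  rewrite (le_trans (small _ Ji))//; apply: (@le_trans _ _ 4); last by lra.
  by rewrite ler_piMr// exprn_ile1//; rewrite /y; lra.
have big m : \sum_(j < i.+1 + m) y ^+ (i - j) * y ^+ (j - i) <= 8 - 4 * y ^+ m.
  elim: m => [|m IH].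
    by rewrite addn0 expr0 (le_trans (small _ (leqnn _)))// subnn expr0; lra.
  rewrite addnS big_ord_recr /= (_ : (i - (i.+1 + m) = 0)%N); last by apply/eqP; rewrite subn_eq0; lia.
  rewrite expr0 mul1r (_ : (i.+1 + m - i = m.+1)%N); last by lia.
  move: IH (ys m); have : 0 <= y ^+ m by rewrite exprn_ge0.
  by move: (y ^+ m) (y ^+ m.+1) (\sum_(_ < _) _) => t u s; lra.
have := big (J - i.+1)%N; rewrite subnKC ?(ltnW iJ)// => /le_trans; apply.
by rewrite gerBl mulr_ge0// exprn_ge0.
Qed.

(** Neighbouring indicators are not orthogonal, but their inner products decay
    geometrically in the distance of the indices. *)
Lemma nested_bound J (c : 'I_J -> R[i]) :
  nsq (\sum_j c j *: nested j) <= 8 * \sum_j sqmod (c j).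
Proof.
apply: schur_bessel => i; set z : R := Num.sqrt 2^-1.
have z0 : 0 <= z by exact: sqrtr_ge0.
have z2 : z ^+ 2 = 2^-1 by rewrite sqr_sqrtr// invr_ge0.
have z34 : z <= 3 / 4.
  by rewrite -(@ler_pXn2r _ 2)// ?nnegrE ?divr_ge0// z2; lra.
have key m n : (m <= n)%N -> normc <| nested m, nested n |> = z ^+ (n - m).
  move=> mn; rewrite dotZl dotZr dot_ind_nested ?dyadic_le ?(ltW (dyadic_gt0 _))//.
  rewrite !normcM normcJ !normc_real !ger0_norm ?invr_ge0 ?sqrtr_ge0 ?(ltW (dyadic_gt0 _))//.
  have sm : 0 < Num.sqrt (dyadic m) by rewrite sqrtr_gt0 dyadic_gt0.
  have sn : 0 < Num.sqrt (dyadic n) by rewrite sqrtr_gt0 dyadic_gt0.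
  have AB : Num.sqrt (dyadic m) = z ^+ (n - m) * Num.sqrt (dyadic n).
    apply/eqP; rewrite -(@eqrXn2 _ 2)// ?mulr_ge0 ?exprn_ge0 ?(ltW sm) ?(ltW sn)//.
    rewrite exprMn !sqr_sqrtr ?(ltW (dyadic_gt0 _))// -exprM mulnC exprM z2.
    rewrite /dyadic -[X in _ == _ * (_ * 2 ^+ X)](subnK mn) exprD exprVn mulrCA mulKf//.
  have Am : dyadic m = Num.sqrt (dyadic m) ^+ 2 by rewrite sqr_sqrtr// ltW// dyadic_gt0.
  rewrite [X in _ * (_ * X)]Am expr2 mulrCA mulKf ?gt_eqF// mulrC AB mulfK// gt_eqF//.
apply: le_trans (geometric_decay i J z0 z34); apply: ler_sum => j _.
have [ij|/ltnW ji] := leqP i j.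
  by rewrite key// (_ : (i - j = 0)%N) ?expr0 ?mul1r//; apply/eqP; rewrite subn_eq0.
by rewrite dotC normcJ key// (_ : (j - i = 0)%N) ?expr0 ?mulr1//; apply/eqP; rewrite subn_eq0.
Qed.

Variable N : nat.
Hypothesis N0 : (0 < N)%N.

Definition gridpt j i : R := dyadic j * (1 + i%:R / N%:R).

Lemma gridpt0 j : gridpt j 0 = dyadic j.
Proof. by rewrite /gridpt mul0r addr0 mulr1. Qed.

Lemma gridptN j : gridpt j N = dyadic j.+1.
Proof. by rewrite /gridpt divff ?pnatr_eq0 -?lt0n// dyadicS mulrC. Qed.

Lemma gridptSB j i : gridpt j i.+1 - gridpt j i = dyadic j / N%:R.
Proof.
by rewrite /gridpt -mulrBr opprD addrACA subrr add0r -mulrBl -natrB// subSn// subnn mul1r.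
Qed.

Lemma gridpt_le j i i' : (i <= i')%N -> gridpt j i <= gridpt j i'.
Proof.
move=> ii; rewrite ler_pM2l ?dyadic_gt0// lerD2l ler_pM2r ?invr_gt0 ?ltr0n//.
by rewrite ler_nat.
Qed.

Lemma gridpt_gt0 j i : 0 < gridpt j i.
Proof. by rewrite mulr_gt0 ?dyadic_gt0// ltr_wpDr// divr_ge0. Qed.

Definition cell j i : L2 R :=
  (Num.sqrt (dyadic j / N%:R))^-1%:C%C *: L2ind (gridpt j i) (gridpt j i.+1).

Lemma cell_orth j i j' i' : (i < N)%N -> (i' < N)%N -> (j, i) != (j', i') ->
  <| cell j i, cell j' i' |> = 0.
Proof.
move=> iN iN' ne; rewrite dotZl dotZr.
suff -> : <| L2ind (gridpt j i) (gridpt j i.+1), L2ind (gridpt j' i') (gridpt j' i'.+1) |> = 0.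
  by rewrite !mulr0.
have key m k m' k' : (k < N)%N -> (m < m')%N || (m == m') && (k < k')%N ->
    gridpt m k.+1 <= gridpt m' k'.
  move=> kN /orP[mm|/andP[/eqP <- kk]]; last exact: gridpt_le.
  apply: (@le_trans _ _ (gridpt m N)); first exact: gridpt_le.
  rewrite gridptN; apply: (@le_trans _ _ (gridpt m' 0)); last exact: gridpt_le.
  by rewrite gridpt0 dyadic_le.
have [jj|jj|jj] := ltngtP j j'.
- by rewrite dot_ind_disjoint// key// jj.
- by rewrite dotC dot_ind_disjoint ?conjc0// key// jj.
have [ii|ii|ii] := ltngtP i i'.
- by rewrite dot_ind_disjoint// key// jj eqxx ii orbT.
- by rewrite dotC dot_ind_disjoint ?conjc0// key// jj eqxx ii orbT.
by move: ne; rewrite jj ii eqxx.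
Qed.

Lemma nsq_cell j i : nsq (cell j i) = 1.
Proof.
have w0 : 0 < dyadic j / N%:R by rewrite divr_gt0 ?dyadic_gt0 ?ltr0n.
rewrite nsqZ nsq_ind ?(ltW (gridpt_gt0 _ _)) ?gridpt_le// gridptSB sqmod_real exprVn.
by rewrite sqr_sqrtr ?(ltW w0)// mulVf// gt_eqF.
Qed.

(** For each dyadic block, the normalized indicator of everything to its left
    together with those of the cells of the grid that subdivides the block.
    The indicator of an interval ending at a grid point of the block is a
    combination of these vectors. *)
Definition system J (ji : 'I_J * option 'I_N) : L2 R :=
  if ji.2 is Some i then cell ji.1 i else nested ji.1.

Lemma bessel_system J : bessel (fun ji => (4^-1)%:C%C *: @system J ji).
Proof.
move=> c; pose c0 j := (4^-1)%:C%C * c (j, None); pose c1 (ji : 'I_J * 'I_N) := (4^-1)%:C%C * c (ji.1, Some ji.2).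
have -> : \sum_ji c ji *: ((4^-1)%:C%C *: system ji) =
    \sum_j c0 j *: nested j + \sum_ji c1 ji *: cell ji.1 ji.2.
  rewrite sum_pair (sum_pair (fun ji => c1 ji *: _)) -big_split /=; apply: eq_bigr => j _.
  rewrite (sum_option (fun o => c (j, o) *: ((4^-1)%:C%C *: system (j, o)))).
  apply: congr2; first exact: (etrans (scalerA _ _ _) (congr1 (fun z => z *: _) (mulrC _ _))).
  apply: eq_bigr => i _.
  exact: (etrans (scalerA _ _ _) (congr1 (fun z => z *: _) (mulrC _ _))).
apply: (le_trans (nsqD_le _ _ _)).
have h1 := nested_bound c0.
have h2 : nsq (\sum_ji c1 ji *: cell ji.1 ji.2) <= \sum_ji sqmod (c1 ji).
  apply: bessel_orth => [[j i] [j' i'] ne|ji]; last by rewrite nsq_cell.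
  by rewrite cell_orth.
have q4 z : sqmod ((4^-1)%:C%C * z) = 16^-1 * sqmod z :> R.
  by rewrite sqmodM sqmod_real; congr (_ * _); field.
apply: (@le_trans _ _ (2 * (8 * \sum_j sqmod (c0 j) + \sum_ji sqmod (c1 ji)))).
  by rewrite ler_pM2l// lerD.
rewrite [leRHS]sum_pair (sum_pair (fun ji => sqmod (c1 ji))).
under [leRHS]eq_bigr do rewrite sum_option.
have -> : \sum_j sqmod (c0 j) = 16^-1 * \sum_j sqmod (c (j, None)).
  by rewrite mulr_sumr; apply: eq_bigr => j _; exact: q4.
have -> : \sum_(j < J) \sum_(i < N) sqmod (c1 (j, i)) =
    16^-1 * \sum_(j < J) \sum_(i < N) sqmod (c (j, Some i)).
  rewrite mulr_sumr; apply: eq_bigr => j _; rewrite mulr_sumr.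
  by apply: eq_bigr => i _; exact: q4.
rewrite big_split /=.
have s0 : 0 <= \sum_(j < J) \sum_(i < N) sqmod (c (j, Some i)).
  by apply: sumr_ge0 => j _; apply: sumr_ge0 => i _; exact: sqmod_ge0.
move: s0; move: (\sum_(j < J) sqmod _) (\sum_(j < J) \sum_(i < N) _) => s t; lra.
Qed.

End DyadicSystem.

(** * Averages of a kernel over dyadic blocks *)

Lemma linear_scale (F : pzRingType) (V W : lmodType F) (T : V -> W) : linear T ->
  forall a u, T (a *: u) = a *: T u.
Proof.
move=> lT a u; have T0 : T 0 = 0.
  by have := lT (-1) 0 0; rewrite scaler0 addr0 scaleN1r addNr.
by have := lT a u 0; rewrite T0 !addr0.
Qed.

Section BlockEstimate.
Variable R : realType.
Local Notation mu := (@lebesgue_measure R).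
Local Notation D := (@Rpos R).
Local Notation mD := (@measurable_Rpos R).
Local Notation DD := (D `*` D).
Local Notation mu2 := (mu \x mu)%E.
Local Notation RR := (measurableTypeR R * measurableTypeR R)%type.
Local Notation ip := (@L2ip R).
Local Notation nsq := (nsq ip).
Local Notation bessel := (bessel ip).
Local Notation "<| u , v |>" := (dot ip u v) (at level 0).
Local Notation op := (@integral_operator R).

Lemma powRD_le (x y q : R) : 0 < q -> q <= 1 -> 0 <= x -> 0 <= y ->
  (x + y) `^ q <= x `^ q + y `^ q.
Proof.
move=> q0 q1 x0 y0.
have := @powR_sum_le R bool (fun b => if b then x else y) q q0 q1.
by rewrite !big_bool /=; apply => -[].
Qed.

Lemma sqmod_sum_le m (z : nat -> R[i]) :
  sqmod (\sum_(i < m) z i) <= m%:R * \sum_(i < m) sqmod (z i).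
Proof.
have real (x : nat -> R) : (\sum_(i < m) x i) ^+ 2 <= m%:R * \sum_(i < m) x i ^+ 2.
  elim: m => [|m IH]; first by rewrite !big_ord0 expr0n mulr0.
  case: m IH => [|m] IH; first by rewrite !big_ord_recr !big_ord0 /= !add0r mul1r.
  rewrite big_ord_recr [in leRHS]big_ord_recr /=; move: IH.
  move: (\sum_(i < m.+1) x i) (\sum_(i < m.+1) x i ^+ 2) => S s IH.
  rewrite -natr1; have m0 : 0 < m.+1%:R :> R by rewrite ltr0n.
  move: m0 IH (x m.+1); move: (m.+1%:R : R) => M M0 IH t.
  rewrite -subr_ge0 -(pmulr_rge0 _ M0).
  rewrite (_ : M * _ = (S - M * t) ^+ 2 + (M + 1) * (M * s - S ^+ 2)); last by ring.
  by rewrite addr_ge0 ?sqr_ge0// mulr_ge0 ?subr_ge0// addr_ge0// ltW.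
have h := normc_sum_le (index_enum 'I_m) xpredT (fun i : 'I_m => z i).
rewrite {1}/sqmod; apply: le_trans (real (fun i => normc (z i))).
by rewrite lerXn2r ?nnegrE ?normc_ge0//; apply: sumr_ge0 => i _; exact: normc_ge0.
Qed.

Variables (delta : R) (delta0 : 0 < delta).
Local Notation a := (dyadic delta).
Local Notation block j := (`]a j, a j.+1]%classic : set R).

Lemma block_sub_Rpos j : block j `<=` D.
Proof.
by move=> x /=; rewrite in_itv /= => /andP[h _]; exact: lt_trans (dyadic_gt0 delta0 j) h.
Qed.

Lemma block_disjoint i j : i != j -> block i `&` block j = set0.
Proof.
move=> ij; apply/seteqP; split => // x /=; rewrite !in_itv /= => -[/andP[h1 h2] /andP[h3 h4]].
have [ji|ji|ji] := ltngtP i j.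
- by have := lt_le_trans h3 (le_trans h2 (dyadic_le delta0 ji)); rewrite ltxx.
- by have := lt_le_trans h1 (le_trans h4 (dyadic_le delta0 ji)); rewrite ltxx.
by rewrite ji eqxx in ij.
Qed.

Lemma between (xs : nat -> R) x n : xs 0%N < x -> x <= xs n ->
  exists2 i, (i < n)%N & xs i < x <= xs i.+1.
Proof.
elim: n => [|n IH] x0 xn; first by have := lt_le_trans x0 xn; rewrite ltxx.
have [h|h] := leP x (xs n); last by exists n => //; rewrite h xn.
by have [i ni hi] := IH x0 h; exists i => //; exact: leqW.
Qed.

Variables (k : RR -> R[i]) (k2 : square_integrable mu2 DD k).
Local Notation A := (op k).
Local Notation K := (fine (sqnorm mu2 DD k)).

Let lA : linear A. Proof. exact: op_linear. Qed.

Section Grid.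
Variables (N : nat) (N0 : (0 < N)%N).
Local Notation g := (gridpt delta N).

Lemma grid_expansion j i : L2ind 0 (g j i) =
  (Num.sqrt (a j))%:C%C *: nested delta j +
  \sum_(i' < i) (Num.sqrt (a j / N%:R))%:C%C *: cell delta N j i'.
Proof.
have cancel (r : R) (u : L2 R) : 0 < r ->
    (Num.sqrt r)%:C%C *: ((Num.sqrt r)^-1%:C%C *: u) = u.
  by move=> r0; rewrite scalerA -rmorphM/= divff ?scale1r// gt_eqF// sqrtr_gt0.
elim: i => [|i IH].
  by rewrite big_ord0 addr0 gridpt0 /nested cancel// dyadic_gt0.
rewrite (@L2ind_split _ 0 (g j i)) ?(ltW (gridpt_gt0 _ _ _ _))//; last first.
  exact: gridpt_le.
rewrite IH big_ord_recr /= addrA; congr (_ + _).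
by rewrite /cell cancel// divr_gt0 ?dyadic_gt0 ?ltr0n.
Qed.

(** The left end [g j i] of the cell containing [x] replaces [x] in
    [lower k x] at the cost of a term of order [1 / N]; the value at [x] of
    [A (L2ind 0 (g j i))] is then expanded in the local system. *)
Lemma ae_lower_le : {ae mu, forall x, forall j, block j x ->
  sqmod (lower k x) <= 4 * a j * (sqmod (L2repr (A (nested delta j)) x) +
     \sum_(i < N) sqmod (L2repr (A (cell delta N j i)) x)) +
   2 * (a j / N%:R) * fine (sqnorm mu D (fun y => k (x, y)))}.
Proof.
have E1 : {ae mu, forall x j i, D x ->
    L2repr (A (L2ind 0 (g j i))) x = op_fun k (ind `]0, g j i]%classic) x}.
  apply: ae_foralln => j; apply: ae_foralln => i; rewrite /L2ind (op_class k2 (sqint_itv _ _)).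
  exact: L2repr_class (sqint_op_fun k2 (sqint_itv _ _)).
have E2 : {ae mu, forall x j i, D x -> L2repr (A (L2ind 0 (g j i))) x =
    (Num.sqrt (a j))%:C%C * L2repr (A (nested delta j)) x +
    \sum_(i' < i) (Num.sqrt (a j / N%:R))%:C%C * L2repr (A (cell delta N j i')) x}.
  apply: ae_foralln => j; apply: ae_foralln => i; rewrite grid_expansion lA linear_sumZ//.
  set c := (Num.sqrt (a j))%:C%C; set c' := (Num.sqrt _)%:C%C.
  apply: filterS3 (L2reprD (c *: A (nested delta j)) (\sum_(i' < i) c' *: A (cell delta N j i')))
    (L2reprZ c (A (nested delta j)))
    (L2repr_sumZ (index_enum 'I_i) xpredT (fun=> c') (fun i' => A (cell delta N j i'))).
  by move=> x h1 h2 h3 Dx; exact: etrans (h1 Dx) (congr2 +%R (h2 Dx) (h3 Dx)).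
apply: filterS3 E1 E2 (sqint_section k2) => x e1 e2 kx j xj.
have Dx : D x by exact: block_sub_Rpos xj.
have {}kx := kx Dx.
have /andP[x0 xN] : g j 0 < x <= g j N.
  by rewrite gridpt0 (gridptN delta N0 j); move: xj; rewrite /= in_itv.
have [i iN /andP[gx xg]] := between x0 xN.
have [v Ev E] : exists2 v, v = (Num.sqrt (a j))%:C%C * L2repr (A (nested delta j)) x +
    \sum_(i' < i) (Num.sqrt (a j / N%:R))%:C%C * L2repr (A (cell delta N j i')) x
  & op_fun k (ind `]0, g j i]%classic) x = v.
  by exists (L2repr (A (L2ind 0 (g j i))) x); [exact: e2 j i Dx|exact: esym (e1 j i Dx)].
have : ((sqmod (lower k x - v))%:E
    <= sqnorm mu D (fun y => k (x, y)) * (x - g j i)%:E)%E.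
  by rewrite -E; exact: lower_approx kx (ltW (gridpt_gt0 delta0 N j i)) gx.
set Kx := fine _.
rewrite -(fineK (sqnorm_fin kx)) -EFinM lee_fin -/Kx => happ.
have Kx0 : 0 <= Kx by rewrite fine_ge0// sqnorm_ge0.
have a0 : 0 < a j by exact: dyadic_gt0.
have w0 : 0 < a j / N%:R by rewrite divr_gt0// ltr0n.
have -> : lower k x = (lower k x - v) + v by rewrite subrK.
apply: (le_trans (sqmodD_le _ _)); rewrite mulrDr addrC; apply: lerD.
  rewrite (_ : 4 * a j = 2 * (2 * a j)); last by ring.
  rewrite -mulrA ler_pM2l// Ev; apply: (le_trans (sqmodD_le _ _)).
  rewrite -mulrA ler_pM2l// mulrDr lerD//.
    by rewrite sqmodM sqmod_real sqr_sqrtr// ltW.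
  rewrite -mulr_sumr sqmodM sqmod_real sqr_sqrtr ?(ltW w0)//.
  have := sqmod_sum_le i (fun i' => L2repr (A (cell delta N j i')) x).
  move=> /(ler_wpM2l (ltW w0))/le_trans; apply.
  have sub : \sum_(i' < i) sqmod (L2repr (A (cell delta N j i')) x) <=
     \sum_(i' < N) sqmod (L2repr (A (cell delta N j i')) x).
    rewrite (big_ord_widen N (fun i' => sqmod (L2repr (A (cell delta N j i')) x)) (ltnW iN)).
    by rewrite [leRHS](bigID (fun i' : 'I_N => (i' < i)%N)) /= lerDl sumr_ge0// => *; exact: sqmod_ge0.
  apply: (@le_trans _ _ (a j / N%:R * (N%:R * \sum_(i' < N) sqmod (L2repr (A (cell delta N j i')) x)))).
    rewrite ler_pM2l//; apply: ler_pM => //; first by apply: sumr_ge0 => *; exact: sqmod_ge0.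
    by rewrite ler_nat ltnW.
  by rewrite mulrA divfK// pnatr_eq0 -lt0n.
rewrite -mulrA ler_pM2l// [leRHS]mulrC; apply: (le_trans happ); apply: ler_wpM2l => //.
by rewrite -(gridptSB delta N j i) lerD2r.
Qed.

Definition local_system j (o : option 'I_N) : L2 R :=
  if o is Some i then cell delta N j i else nested delta j.

Definition block_sum j : R := \sum_o nsq (restr (block j) (A (local_system j o))).

Lemma block_sum_ge0 j : 0 <= block_sum j.
Proof. by apply: sumr_ge0 => *; exact: nsq_ge0. Qed.

Lemma lower_block_le j : (sqnorm mu (block j) (lower k) <=
  (4 * a j * block_sum j + 2 * (a j / N%:R) * K)%:E)%E.
Proof.
have mB : measurable (block j : set (measurableTypeR R)) by exact: measurable_itv.
have DB : D `&` block j = block j by rewrite setIidr//; exact: block_sub_Rpos.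
have mk := sqint_meas2 k2.
have mS (h : R -> \bar R) : measurable_fun D h -> measurable_fun (block j : set (measurableTypeR R)) h.
  by move=> mh; apply: measurable_funS mD (@block_sub_Rpos j) mh.
pose Kx x := sqnorm mu D (fun y => k (x, y)).
have mKx : measurable_fun (block j : set (measurableTypeR R)) Kx.
  by apply: mS; exact: measurable_sqnorm_section.
pose G o x : \bar R := (sqmod (L2repr (A (local_system j o)) x))%:E.
have mG o : measurable_fun (block j : set (measurableTypeR R)) (G o).
  apply: mS; apply: measurable_sqmod; exact: sqint_meas (L2reprP _).
have G0 o x : (0 <= G o x)%E by rewrite lee_fin sqmod_ge0.
have a0 : 0 < a j by exact: dyadic_gt0.
have w0 : 0 < a j / N%:R by rewrite divr_gt0// ltr0n.
pose F x : \bar R := ((4 * a j)%:E * (\sum_o G o x) + (2 * (a j / N%:R))%:E * Kx x)%E.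
have mF1 : measurable_fun (block j : set (measurableTypeR R)) (fun x => \sum_o G o x)%E.
  by apply: emeasurable_sum => o; exact: mG.
have c1 : (0 <= (4 * a j)%:E)%E by rewrite lee_fin mulr_ge0// ltW.
have c2 : (0 <= (2 * (a j / N%:R))%:E)%E by rewrite lee_fin mulr_ge0// ltW.
have K0 x : (0 <= Kx x)%E by exact: sqnorm_ge0.
apply: (@le_trans _ _ (\int[mu]_(x in block j) F x)%E).
  apply: ae_ge0_le_integral.
  - exact: mB.
  - by move=> x _; rewrite lee_fin sqmod_ge0.
  - by apply: mS; apply: measurable_sqmod; exact: cmeasurable_lower.
  - by move=> x _; rewrite adde_ge0 ?mule_ge0 ?sume_ge0.
  - by apply: emeasurable_funD; exact: measurable_funeM.
  apply: filterS2 (sqint_section k2) ae_lower_le => x kx h Bx.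
  have {}kx := kx (@block_sub_Rpos j x Bx).
  rewrite /F /Kx -(fineK (sqnorm_fin kx)) sumEFin -!EFinM -EFinD lee_fin.
  by apply: (le_trans (h j Bx)); rewrite sum_option.
rewrite ge0_integralD//; last 4 first.
- by move=> x _; rewrite mule_ge0// sume_ge0.
- exact: measurable_funeM.
- by move=> x _; rewrite mule_ge0.
- exact: measurable_funeM.
rewrite !ge0_integralZl//; last by move=> x _; rewrite sume_ge0.
rewrite EFinD !EFinM; apply: leeD.
  rewrite lee_wpmul2l// ge0_integral_sum// /block_sum -sumEFin le_eqVlt; apply/orP; left; apply/eqP.
  by apply: eq_bigr => o _; rewrite nsq_restr// DB.
rewrite lee_wpmul2l// fineK; last exact: sqnorm_fin.
rewrite sqnorm_sections//; apply: ge0_subset_integral => //.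
- exact: mD.
- exact: measurable_sqnorm_section.
- exact: block_sub_Rpos.
Qed.

End Grid.

(** The error made by reading [lower k] off the grid vanishes as the grid is
    refined, while the bound on the block sums does not depend on the grid. *)
Lemma lower_blocks p S J : 0 < p -> p <= 2 ->
  (forall (I : finType) (h g : I -> L2 R), bessel h -> bessel g ->
     \sum_i normc <| A (h i), g i |> `^ p <= S) ->
  \sum_(j < J) (fine (sqnorm mu (block j) (lower k)) / a j) `^ (p / 2) <=
    64 `^ (p / 2) * S.
Proof.
move=> p0 p2 AS; set q := p / 2.
have q0 : 0 < q by rewrite divr_gt0.
have q1 : q <= 1 by rewrite ler_pdivrMr// mul1r.
have K0 : 0 <= K by rewrite fine_ge0// sqnorm_ge0.
have step N : (0 < N)%N ->
    \sum_(j < J) (fine (sqnorm mu (block j) (lower k)) / a j) `^ q <=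
    64 `^ q * S + J%:R * (2 * K / N%:R) `^ q.
  move=> N0; pose G (j : 'I_J) := block_sum N j / 16.
  have bs0 (j : 'I_J) := block_sum_ge0 N j.
  have NK : 0 <= 2 * K / N%:R by rewrite divr_ge0// mulr_ge0.
  have GS : \sum_j G j `^ q <= S.
    pose f (ji : 'I_J * option 'I_N) := (4^-1)%:C%C *: system delta ji.
    have mB j : measurable (block j : set (measurableTypeR R)) by exact: measurable_itv.
    have GE (j : 'I_J) : G j = \sum_i nsq (restr (block j) (A (f (j, i)))).
      rewrite /G /block_sum mulr_suml; apply: eq_bigr => o _.
      rewrite /f (linear_scale lA) (linear_scale (restr_linear (mB j))) nsqZ sqmod_real.
      rewrite mulrC (_ : 16^-1 = 4^-1 ^+ 2); last by field.
      by congr (_ * nsq (restr _ (A _))); case: o.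
    have h1 j : linear (restr (block j)) by exact: restr_linear (mB j).
    have h2 j u v := restr_adj u v (mB j).
    have h3 j u : restr (block j) (restr (block j) u) = restr (block j) u.
      by rewrite restr_restr// setIid.
    have h4 (i j : 'I_J) u v : i != j -> <| restr (block i) u, restr (block j) v |> = 0.
      by move=> ij; exact: restr_orth (mB i) (mB j) (block_disjoint ij).
    have h5 : bessel f := bessel_system delta0 N0 (J := J).
    have H := block_hilbert_schmidt p0 p2 lA h1 h2 h3 h4 AS h5.
    by apply: le_trans H; apply: ler_sum => j _; rewrite (GE j).
  apply: (@le_trans _ _ (\sum_(j < J) (64 `^ q * G j `^ q + (2 * K / N%:R) `^ q))).
    apply: ler_sum => j _; have a0 : 0 < a j by exact: dyadic_gt0.
    have G0 : 0 <= G j by rewrite divr_ge0.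
    rewrite -powRM//; apply: le_trans (powRD_le q0 q1 _ NK); last by rewrite mulr_ge0.
    apply: ge0_ler_powR; rewrite ?nnegrE ?(ltW q0)//.
    - by rewrite divr_ge0 ?(ltW a0)// fine_ge0// sqnorm_ge0.
    - by rewrite addr_ge0// mulr_ge0.
    rewrite ler_pdivrMr//.
    have h := lower_block_le N0 j.
    have : fine (sqnorm mu (block j) (lower k)) <= 4 * a j * block_sum N j + 2 * (a j / N%:R) * K.
      rewrite -lee_fin fineK// ge0_fin_numE ?sqnorm_ge0//.
      by apply: le_lt_trans h _; rewrite ltry.
    move=> /le_trans; apply; rewrite le_eqVlt; apply/orP; left; apply/eqP; rewrite /G.
    by field; rewrite pnatr_eq0 -lt0n.
  rewrite big_split /= -mulr_sumr sumr_const card_ord -[_ *+ J]mulr_natl lerD2r.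
  by rewrite ler_wpM2l// powR_ge0.
apply/ler_addgt0Pr => e e0; pose r := (e / J.+1%:R) `^ q^-1.
have r0 : 0 < r by rewrite powR_gt0// divr_gt0// ltr0n.
pose N := (Num.truncn (2 * K / r)).+1.
apply: (le_trans (step N isT)); rewrite lerD2l.
have le_r : 2 * K / N%:R <= r.
  rewrite ler_pdivrMr ?ltr0n// [r * _]mulrC -ler_pdivrMr// ltW//.
  have h : 0 <= 2 * K / r by rewrite divr_ge0 ?mulr_ge0 ?(ltW r0).
  have := truncn_itv h; rewrite -/N => /andP[_ hN]; exact: hN.
have : (2 * K / N%:R) `^ q <= e / J.+1%:R.
  have -> : e / J.+1%:R = r `^ q.
    by rewrite /r -powRrM mulVf ?gt_eqF// powRr1// divr_ge0// ltW.
  by apply: ge0_ler_powR; rewrite ?nnegrE ?(ltW q0) ?(ltW r0)// divr_ge0// mulr_ge0.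
move=> /(ler_wpM2l (ler0n _ J)) /le_trans; apply.
rewrite mulrCA ger_pMr// ler_pdivrMr ?ltr0n// mul1r ler_nat//.
Qed.

End BlockEstimate.

(** * Weights of the averaged symbol *)

Section Weights.
Variable R : realType.
Local Notation mu := (@lebesgue_measure R).
Local Notation D := (@Rpos R).
Local Notation mD := (@measurable_Rpos R).
Local Notation DD := (D `*` D).
Local Notation mu2 := (mu \x mu)%E.
Local Notation RR := (measurableTypeR R * measurableTypeR R)%type.
Local Notation ip := (@L2ip R).
Local Notation nsq := (nsq ip).
Local Notation bessel := (bessel ip).
Local Notation "<| u , v |>" := (dot ip u v) (at level 0).
Local Notation op := (@integral_operator R).
Implicit Types (k : RR -> R[i]) (phi : R -> R[i]) (u v : L2 R).

Lemma L2conj_linear a u v : L2conj (a *: u + v) = a^*%C *: L2conj u + L2conj v.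
Proof.
apply: L2_eqP.
have h1 := L2repr_class (sqintJ (L2reprP (a *: u + v))).
have h2 := L2repr_class (sqintJ (L2reprP u)).
have h3 := L2repr_class (sqintJ (L2reprP v)).
have h4 := L2reprD (a^*%C *: L2conj u) (L2conj v).
have h5 := L2reprZ a^*%C (L2conj u).
have h6 := L2reprD (a *: u) v; have h7 := L2reprZ a u.
apply: filterS (filterI h1 (filterI h2 (filterI h3 (filterI h4 (filterI h5 (filterI h6 h7)))))).
move=> x [e1 [e2 [e3 [e4 [e5 [e6 e7]]]]]] Dx.
have E1 := etrans (e1 Dx) (congr1 conjc (etrans (e6 Dx) (congr1 (fun z => z + _) (e7 Dx)))).
have E2 := etrans (e4 Dx) (congr2 +%R (etrans (e5 Dx) (congr1 (fun z => _ * z) (e2 Dx))) (e3 Dx)).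
apply: (etrans E1); apply: esym; apply: (etrans E2).
by rewrite rmorphD rmorphM.
Qed.

Lemma L2conj_sumZ (I : finType) (c : I -> R[i]) (f : I -> L2 R) :
  L2conj (\sum_i c i *: f i) = \sum_i (c i)^*%C *: L2conj (f i).
Proof.
have c0 : L2conj 0 = 0 :> L2 R by apply: nsq_eq0; rewrite nsq_conj nsq0.
apply: (big_ind2 (fun x y => L2conj x = y)) => // [x1 x2 y1 y2 <- <-|i _].
  by have := L2conj_linear 1 x1 y1; rewrite conjc1 !scale1r.
by have := L2conj_linear (c i) (f i) 0; rewrite c0 !addr0.
Qed.

Lemma bessel_conj (I : finType) (f : I -> L2 R) : bessel f -> bessel (fun i => L2conj (f i)).
Proof.
move=> bf c; rewrite -[X in nsq X]L2conjK L2conj_sumZ nsq_conj.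
rewrite (_ : \sum_i _ = \sum_i (c i)^*%C *: f i); last first.
  by apply: eq_bigr => i _; rewrite L2conjK.
by apply: (le_trans (bf _)); rewrite le_eqVlt; apply/orP; left; apply/eqP; apply: eq_bigr => i _; rewrite sqmodJ.
Qed.

Lemma sqnorm_itv_fin phi (a b : R) : 0 < a -> symbol phi ->
  sqnorm mu `]a, b]%classic phi \is a fin_num.
Proof.
move=> a0 [mphi phioo]; rewrite ge0_fin_numE ?sqnorm_ge0//.
have sub : (`]a, b]%classic : set R) `<=` D.
  by move=> x /=; rewrite in_itv /= => /andP[h _]; exact: lt_trans h.
have mB : measurable (`]a, b]%classic : set (measurableTypeR R)) by exact: measurable_itv.
have mx : measurable_fun D (fun x => (x * sqmod (phi x))%:E : \bar R).
  apply/measurable_EFinP; apply: measurable_funM => //.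
  by apply/measurable_EFinP; exact: measurable_sqmod.
have x0 x : D x -> (0 <= (x * sqmod (phi x))%:E)%E.
  by move=> Dx; rewrite lee_fin mulr_ge0 ?sqmod_ge0// ltW.
apply: (@le_lt_trans _ _ (a^-1%:E * \int[mu]_(x in D) (x * sqmod (phi x))%:E)%E); last first.
  by rewrite lte_mul_pinfty ?lee_fin ?invr_ge0 ?(ltW a0)// ge0_fin_numE// integral_ge0.
rewrite -ge0_integralZl//; [|exact: mD|by rewrite lee_fin invr_ge0 ltW].
apply: (@le_trans _ _ (\int[mu]_(x in `]a, b]) (a^-1%:E * (x * sqmod (phi x))%:E))%E).
  apply: ge0_le_integral => //.
  - by move=> x _; rewrite lee_fin sqmod_ge0.
  - by apply: measurable_funS mD sub _; exact: measurable_sqmod.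
  - by apply: measurable_funeM; apply: measurable_funS mD sub _.
  - move=> x xB; have /andP[ax _] : a < x <= b by move: xB; rewrite /= in_itv.
    rewrite -EFinM lee_fin mulrA ler_peMl ?sqmod_ge0//.
    by rewrite mulrC ler_pdivlMr// mul1r ltW.
apply: ge0_subset_integral => //.
- exact: mD.
- exact: measurable_funeM.
- by move=> x Dx; rewrite mule_ge0 ?x0// lee_fin invr_ge0 ltW.
Qed.

Variables (delta : R) (delta0 : 0 < delta).
Local Notation a := (dyadic delta).
Local Notation block j := (`]a j, a j.+1]%classic : set R).

(** Up to constants this is the squared norm of [x `^ 2^-1 * phi] on the
    block; it is quadratic in [phi], so powers [p / 2] of weights go with powers
    [p] of singular numbers. *)
Definition weight phi j : R := a j * fine (sqnorm mu (block j) phi).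

Lemma weight_ge0 phi j : 0 <= weight phi j.
Proof. by rewrite mulr_ge0 ?(ltW (dyadic_gt0 _ _))// fine_ge0// sqnorm_ge0. Qed.

(** On the block [x] is comparable with its left end, and the averaged symbol is
    the sum of two averages divided by [2 * x]. *)
Lemma weight_averaged k j : square_integrable mu2 DD k ->
  weight (averaged_symbol k) j <= fine (sqnorm mu (block j) (lower k)) / a j +
     fine (sqnorm mu (block j) (lower (transpose k))) / a j.
Proof.
move=> k2; have k2' := sqint_swap k2.
have a0 : 0 < a j by exact: dyadic_gt0.
have mB : measurable (block j : set (measurableTypeR R)) by exact: measurable_itv.
have sub := @block_sub_Rpos R delta delta0 j.
have fin k' : square_integrable mu2 DD k' -> sqnorm mu (block j) (lower k') \is a fin_num.
  move=> h; rewrite ge0_fin_numE ?sqnorm_ge0//.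
  by apply: (le_lt_trans (lower_block_le delta0 h (N := 1) isT j)); rewrite ltry.
have mS k' : square_integrable mu2 DD k' -> measurable_fun (block j : set (measurableTypeR R))
    (fun x => (sqmod (lower k' x))%:E).
  move=> h; apply: measurable_funS mD sub _; apply: measurable_sqmod.
  exact: cmeasurable_lower (sqint_meas2 h).
have key : (sqnorm mu (block j) (averaged_symbol k) <=
    ((a j ^+ 2)^-1)%:E * (sqnorm mu (block j) (lower k) + sqnorm mu (block j) (lower (transpose k))))%E.
  rewrite /sqnorm -ge0_integralD//; last 4 first.
  - by move=> x _; rewrite lee_fin sqmod_ge0.
  - exact: mS.
  - by move=> x _; rewrite lee_fin sqmod_ge0.
  - exact: mS.
  rewrite -ge0_integralZl//; last 3 first.
  - by apply: emeasurable_funD; exact: mS.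
  - by move=> x _; rewrite adde_ge0 ?lee_fin ?sqmod_ge0.
  - by rewrite lee_fin invr_ge0 sqr_ge0.
  apply: ge0_le_integral => //.
  - by move=> x _; rewrite lee_fin sqmod_ge0.
  - apply: measurable_funS mD sub _; apply: measurable_sqmod.
    by case: (symbol_averaged k2).
  - by apply: measurable_funeM; apply: emeasurable_funD; exact: mS.
  - move=> x xB; have /andP[ax _] : a j < x <= a j.+1 by move: xB; rewrite /= in_itv.
    rewrite -EFinD -EFinM lee_fin averaged_symbolE inv2C sqmodM sqmod_real.
    have x0 : 0 < x by exact: lt_trans ax.
    apply: (@le_trans _ _ ((2 * x)^-1 ^+ 2 * (2 * (sqmod (lower k x) + sqmod (lower (transpose k) x))))).
      by rewrite ler_wpM2l ?sqr_ge0//; have := sqmodD_le (lower k x) (lower (transpose k) x); rewrite mulrDr.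
    rewrite mulrA ler_wpM2r ?addr_ge0 ?sqmod_ge0//.
    rewrite exprVn -ler_pdivlMr// (_ : _ / 2 = (2 * a j ^+ 2)^-1); last first.
      by field; rewrite gt_eqF.
    rewrite lef_pV2 ?posrE ?mulr_gt0 ?exprn_gt0 ?mulr_gt0//.
    by nra.
rewrite /weight -mulrDl -[X in _ <= X * _](fineD (fin _ k2) (fin _ k2')).
have h : fine (sqnorm mu (block j) (averaged_symbol k)) <= (a j ^+ 2)^-1 *
   fine (sqnorm mu (block j) (lower k) + sqnorm mu (block j) (lower (transpose k))).
  have f1 := sqnorm_itv_fin (a j.+1) a0 (symbol_averaged k2).
  have f2 : (sqnorm mu (block j) (lower k) + sqnorm mu (block j) (lower (transpose k)))%E
      \is a fin_num.
    by rewrite fin_numD; apply/andP; split; [exact: fin _ k2|exact: fin _ k2'].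
  by rewrite -lee_fin EFinM (fineK f1) (fineK f2).
apply: (le_trans (ler_wpM2l (ltW a0) h)); rewrite le_eqVlt; apply/orP; left; apply/eqP.
by field; rewrite gt_eqF.
Qed.

(** The diagonal bound [S] for the operator of [k] passes to that of the
    transposed kernel, because complex conjugation preserves Bessel systems. *)
Lemma weights_averaged k p S J : square_integrable mu2 DD k -> 0 < p -> p <= 2 ->
  (forall (I : finType) (h g : I -> L2 R), bessel h -> bessel g ->
     \sum_i normc <| op k (h i), g i |> `^ p <= S) ->
  \sum_(j < J) weight (averaged_symbol k) j `^ (p / 2) <= 2 * (64 `^ (p / 2) * S).
Proof.
move=> k2 p0 p2 kS; have k2' := sqint_swap k2.
have q0 : 0 < p / 2 by rewrite divr_gt0.
have q1 : p / 2 <= 1 by rewrite ler_pdivrMr// mul1r.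
have kS' (I : finType) (h g : I -> L2 R) : bessel h -> bessel g ->
    \sum_i normc <| op (transpose k) (h i), g i |> `^ p <= S.
  move=> bh bg; apply: le_trans (kS I _ _ (bessel_conj bg) (bessel_conj bh)).
  rewrite le_eqVlt; apply/orP; left; apply/eqP; apply: eq_bigr => i _.
  apply: (congr1 (fun r : R => r `^ p)); apply: (congr1 (fun z => normc z)).
  exact: dot_op_transpose (h i) (g i) k2.
have L1 := lower_blocks delta0 k2 J p0 p2 kS.
have L2 := lower_blocks delta0 k2' J p0 p2 kS'.
rewrite mulr2n mulrDl mul1r; apply: le_trans (lerD L1 L2); rewrite -big_split.
apply: ler_sum => j _ /=.
have f0 f : 0 <= fine (sqnorm mu (block j) f) / a j.
  by rewrite divr_ge0 ?(ltW (dyadic_gt0 _ _))// fine_ge0// sqnorm_ge0.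
apply: le_trans (powRD_le q0 q1 (f0 _) (f0 _)).
apply: ge0_ler_powR; rewrite ?nnegrE ?(ltW q0) ?weight_ge0 ?addr_ge0 ?f0//.
exact: weight_averaged.
Qed.

End Weights.

(** * Truncation of a symbol *)

Section Truncation.
Variable R : realType.
Local Notation mu := (@lebesgue_measure R).
Local Notation D := (@Rpos R).
Local Notation mD := (@measurable_Rpos R).
Local Notation ip := (@L2ip R).
Local Notation nsq := (nsq ip).
Implicit Types (phi : R -> R[i]) (u v : L2 R).

Lemma symbol_mulind phi (E : set R) : measurable E -> symbol phi ->
  symbol (fun x => phi x * ind E x).
Proof.
move=> mE [mphi phioo].
have mi : cmeasurable D (ind E) by apply: cmeasurable_real; exact: measurable_indic.
have mpi : cmeasurable D (fun x => phi x * ind E x) by exact: cmeasurableM.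
have mx f : cmeasurable D f -> measurable_fun D (fun x => (x * sqmod (f x))%:E : \bar R).
  move=> mf; apply/measurable_EFinP; apply: measurable_funM => //.
  by apply/measurable_EFinP; exact: measurable_sqmod.
split => //; apply: le_lt_trans phioo; apply: ge0_le_integral => //.
- exact: mD.
- by move=> x Dx; rewrite lee_fin mulr_ge0 ?sqmod_ge0// ltW.
- exact: mx.
- exact: mx.
- move=> x Dx; rewrite lee_fin ler_wpM2l ?(ltW Dx)// sqmodM sqmod_ind indicE.
  by rewrite ler_piMr ?sqmod_ge0// lern1 leq_b1.
Qed.

Lemma symbolB phi psi : symbol phi -> symbol psi -> symbol (fun x => phi x - psi x).
Proof.
move=> h1 h2; have := symbol_linear (-1) h2 h1; congr symbol.
by apply/funext => x; rewrite mulN1r addrC.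
Qed.

Lemma QopB phi psi u : symbol phi -> symbol psi ->
  Qop (fun x => phi x - psi x) u = Qop phi u - Qop psi u.
Proof.
move=> h1 h2; have E := congr1 (fun f => f u) (Qop_linear (-1) h2 h1).
rewrite (_ : (fun x => phi x - psi x) = (fun x => -1 * psi x + phi x)); last first.
  by apply/funext => x; rewrite mulN1r addrC.
by apply: (etrans E); rewrite /= addrC; congr (_ + _); exact: scaleN1r.
Qed.

(** The squared Hilbert--Schmidt norm of [Qop phi] is an integral of
    [x * sqmod (phi x)], hence small near [0] and near infinity. *)
Lemma Qop_truncation phi e : symbol phi -> 0 < e -> exists M0, forall M, (M0 <= M)%N ->
  forall u, nsq (Qop phi u -
    Qop (fun x => phi x * ind `]dyadic (2 ^- M) 0, dyadic (2 ^- M) (M + M)]%classic x) u)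
    <= e * nsq u.
Proof.
move=> hphi e0; have [mphi phioo] := hphi.
pose F M : set (measurableTypeR R) := `]2 ^- M, 2 ^+ M]%classic.
have FE M : `]dyadic (2 ^- M) 0, dyadic (2 ^- M) (M + M)]%classic = F M.
  by rewrite /dyadic expr0 mulr1 exprD mulrA mulVf ?mul1r// expf_neq0.
have mF M : measurable (F M) by exact: measurable_itv.
have p2 n : 0 < (2 : R) ^+ n by rewrite exprn_gt0.
have FD M : F M `<=` D.
  by move=> x; rewrite /F /= in_itv /= => /andP[h _]; apply: lt_trans h; rewrite invr_gt0.
have FU : \bigcup_M F M = D.
  apply/seteqP; split => x; first by move=> [M _]; exact: FD.
  move=> Dx; pose n := (Num.truncn (x + x^-1)).+1.
  have xi0 : 0 < x^-1 by rewrite invr_gt0.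
  have h : x + x^-1 < 2 ^+ n.
    have s0 : 0 <= x + x^-1 by rewrite addr_ge0// ltW.
    have /andP[_ hn] := truncn_itv s0.
    by apply: (lt_trans hn); rewrite -natrX ltr_nat ltn_expl.
  exists n => //; rewrite /F /= in_itv /=; apply/andP; split.
    rewrite -[x]invrK ltf_pV2 ?posrE//; apply: lt_trans h; by rewrite ltrDr.
  by apply/ltW; apply: lt_trans h; rewrite ltrDl.
pose f x : \bar R := (x * sqmod (phi x))%:E.
have mf : measurable_fun D f.
  apply/measurable_EFinP; apply: measurable_funM => //.
  by apply/measurable_EFinP; exact: measurable_sqmod.
have f0 x : D x -> (0 <= f x)%E by move=> Dx; rewrite lee_fin mulr_ge0 ?sqmod_ge0// ltW.
have cv : (\int[mu]_(x in F i) f x)%E @[i --> \oo] --> (\int[mu]_(x in D) f x)%E.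
  rewrite -FU; apply: ge0_nondecreasing_set_cvg_integral => //.
  - move=> m n mn; rewrite subsetEset => x; rewrite /F /= !in_itv /= => /andP[h1 h2].
    apply/andP; split; last by apply: (le_trans h2); rewrite ler_eXn2l// ltr1n.
    by apply: le_lt_trans h1; rewrite lef_pV2 ?posrE// ler_eXn2l// ltr1n.
  - by move=> M; exact: measurable_funS mD (FD M) mf.
  - by move=> M x Fx; apply: f0; exact: FD Fx.
have Ifin : (\int[mu]_(x in D) f x)%E \is a fin_num.
  by rewrite ge0_fin_numE// integral_ge0.
have e2 : 0 < e / 2 by rewrite divr_gt0.
move: cv; rewrite -(fineK Ifin) => /fine_cvgP[_ /cvgrPdist_le /(_ _ e2)[M0 _ hM]].
exists M0 => M M0M u; rewrite FE.
have {}hM := hM M M0M; have hpsi := symbol_mulind (mF M) hphi.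
rewrite -(QopB u hphi hpsi).
have hd := symbolB hphi hpsi.
rewrite -lee_fin EFinM; apply: le_trans (nsq_op_le u (sqint_max_kernel hd)) _.
rewrite lee_wpmul2r ?lee_fin ?nsq_ge0//.
apply: (le_trans (sqnorm_max_kernel_le hd.1)).
rewrite -lee_pdivlMl// -EFinM mulrC.
have DF : D `\` (D `\` F M) = F M by rewrite setDD setIidr//; exact: FD.
have mDF : measurable (D `\` F M) by apply: measurableD => //; exact: mD.
have split_int : (\int[mu]_(x in D) f x = \int[mu]_(x in F M) f x + \int[mu]_(x in D `\` F M) f x)%E.
  rewrite -[X in integral _ X _ = _](@setDUK _ (F M) D); last exact: FD.
  rewrite ge0_integral_setU//.
  - by rewrite setDUK//; exact: FD.
  - by rewrite setDUK; [exact: f0|exact: FD].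
  - by rewrite disj_set2E setDIK.
have finF : (\int[mu]_(x in F M) f x)%E \is a fin_num.
  rewrite ge0_fin_numE; first by apply: le_lt_trans phioo; apply: ge0_subset_integral => //; (exact: mD || exact: FD).
  by apply: integral_ge0 => x Fx; apply: f0; exact: FD Fx.
have finDF : (\int[mu]_(x in D `\` F M) f x)%E \is a fin_num.
  rewrite ge0_fin_numE; first by apply: le_lt_trans phioo; apply: ge0_subset_integral => //; (exact: mD || exact: subDsetl).
  by apply: integral_ge0 => x [Dx _]; exact: f0.
apply: (@le_trans _ _ (\int[mu]_(x in D `\` F M) f x)%E).
  rewrite -(setIidr (@subDsetl _ D (F M))).
  rewrite integral_mkcondr le_eqVlt; apply/orP; left; apply/eqP; apply: eq_integral => x Dx.
  rewrite patchE /f -{1}[phi x]mulr1 -mulrBr sqmodM.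
  have [xF|xF] := boolP (x \in F M).
    rewrite (_ : x \in D `\` F M = false); last by apply/negP; rewrite inE => -[_]; rewrite inE in xF.
    by rewrite /ind indicE xF subrr sqmod0 mulr0 mulr0.
  rewrite (_ : x \in D `\` F M); last by rewrite inE; split; [rewrite inE in Dx|rewrite notin_setE in xF].
  by rewrite /ind indicE (negbTE xF) subr0 sqmod1 mulr1.
rewrite -(fineK finDF) lee_fin; move: hM; rewrite /= split_int fineD//.
move: (fine _) (fine _) => s t h; apply: le_trans h; rewrite addrAC subrr add0r.
exact: ler_norm.
Qed.

End Truncation.

(** * Cutting an interval by length and energy *)

Section EnergyCut.
Variable R : realType.
Local Notation mu := (@lebesgue_measure R).
Local Notation D := (@Rpos R).
Local Notation mD := (@measurable_Rpos R).
Implicit Types (phi : R -> R[i]) (a b : R).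

Lemma sqnorm_itv_split phi a c b : 0 < a -> a <= c -> c <= b -> symbol phi ->
  fine (sqnorm mu `]a, b]%classic phi) =
  fine (sqnorm mu `]a, c]%classic phi) + fine (sqnorm mu `]c, b]%classic phi).
Proof.
move=> a0 ac cb hphi; have c0 : 0 < c by exact: lt_le_trans ac.
rewrite -fineD; [|exact: sqnorm_itv_fin|exact: sqnorm_itv_fin].
congr fine; rewrite /sqnorm -ge0_integral_setU//=.
- by rewrite -itv_bndbnd_setU// bnd_simp.
- rewrite -itv_bndbnd_setU ?bnd_simp//.
  apply: measurable_funS mD _ (measurable_sqmod hphi.1).
  by move=> x /=; rewrite in_itv /= => /andP[h _]; exact: lt_trans h.
- by move=> x _; rewrite lee_fin sqmod_ge0.
- rewrite disj_set2E; apply/eqP/seteqP; split => // x [] /=; rewrite !in_itv /=.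
  by move=> /andP[_ xc] /andP[cx _]; have := le_lt_trans xc cx; rewrite ltxx.
Qed.

Lemma continuous_energy phi a b : 0 < a -> a <= b -> symbol phi ->
  {within `[a, b], continuous (fun x => fine (sqnorm mu `]a, x]%classic phi))}.
Proof.
move=> a0 ab hphi.
have sub : `[a, b]%classic `<=` D.
  by move=> x /=; rewrite in_itv /= => /andP[h _]; exact: lt_le_trans h.
have m' d : measurable_fun (`]a, d]%classic : set (measurableTypeR R)) (fun x => (sqmod (phi x))%:E).
  apply: measurable_funS mD _ (measurable_sqmod hphi.1).
  by move=> x /=; rewrite in_itv /= => /andP[h _]; exact: lt_trans h.
have m c d : 0 < c -> measurable_fun (`[c, d]%classic : set (measurableTypeR R)) (fun x => (sqmod (phi x))%:E).
  move=> c0; apply: measurable_funS mD _ (measurable_sqmod hphi.1).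
  by move=> x /=; rewrite in_itv /= => /andP[h _]; exact: lt_le_trans h.
have E x : fine (sqnorm mu `]a, x]%classic phi) =
    parameterized_integral mu a x (fun x => sqmod (phi x)).
  rewrite /parameterized_integral /Rintegral; congr fine.
  by apply: integral_itv_obnd_cbnd; exact: m'.
rewrite (_ : (fun x => _) = (fun x => parameterized_integral mu a x (fun x => sqmod (phi x)))).
  apply: parameterized_integral_continuous => //; apply/integrableP; split; first exact: m.
  have -> : (\int[mu]_(x in `[a, b]) `|(EFin \o (fun x => sqmod (phi x))) x| = sqnorm mu `]a, b]%classic phi)%E.
    rewrite /sqnorm integral_itv_obnd_cbnd; last exact: m'.
    by apply: eq_integral => x _; rewrite /= ger0_norm ?sqmod_ge0.
  by rewrite -ge0_fin_numE ?sqnorm_ge0//; exact: sqnorm_itv_fin.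
by apply/funext => x; exact: E.
Qed.

(** Cutting the interval at equidistributed values of a combination of length and
    energy makes both factors of each product about [m] times smaller. *)
Lemma energy_cut phi a b m tau : 0 < a -> a < b -> (0 < m)%N -> 0 < tau -> symbol phi ->
  (b - a) * fine (sqnorm mu `]a, b]%classic phi) <= m%:R ^+ 2 * tau ->
  exists y : nat -> R, [/\ y 0%N = a, y m = b, forall i, y i <= y i.+1 &
    forall i, (i < m)%N ->
      (y i.+1 - y i) * fine (sqnorm mu `]y i, y i.+1]%classic phi) <= tau].
Proof.
move=> a0 ab m0 tau0 hphi; set I := fine (sqnorm mu `]a, b]%classic phi) => hI.
have ba0 : 0 < b - a by rewrite subr_gt0.
have M0 : 0 < m%:R :> R by rewrite ltr0n.
pose e x := fine (sqnorm mu `]a, x]%classic phi).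
pose I' := m%:R ^+ 2 * tau / (b - a).
have I'0 : 0 < I' by rewrite divr_gt0// mulr_gt0// exprn_gt0.
have II' : I <= I' by rewrite ler_pdivlMr// mulrC.
have [G GE] : exists G : R -> R, forall x, G x = (x - a) * I' + (b - a) * e x.
  by exists (fun x => (x - a) * I' + (b - a) * e x).
have ea : e a = 0 by rewrite /e set_itvoc0 /sqnorm ?integral_set0.
have emono x x' : a <= x -> x <= x' -> e x' = e x + fine (sqnorm mu `]x, x']%classic phi).
  by move=> ax xx'; exact: sqnorm_itv_split.
have sq0 c d : 0 <= fine (sqnorm mu `]c, d]%classic phi) by rewrite fine_ge0// sqnorm_ge0.
have Gmono x x' : a <= x -> x < x' -> G x < G x'.
  move=> ax xx'; rewrite !GE (emono x x')// ?(ltW xx')//.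
  apply: ltr_leD; first by rewrite ltr_pM2r// ltrD2r.
  by rewrite ler_pM2l// lerDl.
have Ga : G a = 0 by rewrite GE ea subrr mul0r mulr0 addr0.
have Gb : 0 < G b by rewrite -Ga; exact: Gmono.
have Gb2 : G b <= 2 * ((b - a) * I').
  by rewrite GE (_ : 2 * _ = (b - a) * I' + (b - a) * I') ?lerD2l ?ler_pM2l//; ring.
have Gc : {within `[a, b], continuous G}.
  rewrite (_ : G = fun x => (x - a) * I' + (b - a) * e x); last exact/funext.
  have e1 := continuous_energy a0 (ltW ab) hphi.
  have e2 : {within `[a, b], continuous (fun x : R => (x - a) * I')}.
    apply: continuous_subspaceT => x; apply: cvgM; last exact: cvg_cst.
    by apply: cvgB; [exact: cvg_id|exact: cvg_cst].
  move=> x; apply: cvgD; first exact: e2.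
  by apply: cvgM; [exact: cvg_cst|exact: e1].
have /choice[y hy] : forall i, exists c, c \in `[a, b] /\ G c = G b * ((minn i m)%:R / m%:R).
  move=> i; have r0 : 0 <= (minn i m)%:R / m%:R :> R by rewrite divr_ge0.
  have r1 : (minn i m)%:R / m%:R <= 1 :> R by rewrite ler_pdivrMr// mul1r ler_nat geq_minr.
  have [|c c1 c2] := @IVT R G a b (G b * ((minn i m)%:R / m%:R)) (ltW ab) Gc.
    rewrite Ga min_l ?max_r ?(ltW Gb)// mulr_ge0 ?(ltW Gb)//=.
    by rewrite ler_piMr// ltW.
  by exists c.
have ya i : a <= y i by have [+ _] := hy i; rewrite in_itv /= => /andP[].
have inj x x' : a <= x -> a <= x' -> G x <= G x' -> x <= x'.
  move=> ax ax' h; rewrite leNgt; apply/negP => /(Gmono _ _ ax').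
  by rewrite ltNge h.
have inj2 x x' : a <= x -> a <= x' -> G x = G x' -> x = x'.
  move=> ax ax' h; apply/le_anti/andP; split; apply: inj => //; by rewrite h.
have GS i : G (y i) <= G (y i.+1).
  have h : (minn i m <= minn i.+1 m)%N.
    by rewrite leq_min geq_minr andbT; exact: leq_trans (geq_minl _ _) (leqnSn i).
  rewrite (hy i).2 (hy i.+1).2; apply: ler_wpM2l; first exact: ltW.
  apply: ler_wpM2r; first by rewrite invr_ge0 ltW.
  by rewrite ler_nat.
have yS i : y i <= y i.+1 by apply: inj.
exists y; split => //.
- by apply: inj2 => //; rewrite (hy 0%N).2 min0n mul0r mulr0 Ga.
- by apply: inj2 => //; [exact: ltW|rewrite (hy m).2 minnn divff ?mulr1// gt_eqF].
move=> i im; set r := fine _; set s := _ - _.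
have r0 : 0 <= r by exact: sq0.
have s0 : 0 <= s by rewrite subr_ge0.
have key : s * I' + (b - a) * r = G b / m%:R.
  have h1 := (hy i).2; have h2 := (hy i.+1).2.
  have -> : G b / m%:R = G (y i.+1) - G (y i).
    by rewrite h1 h2 (minn_idPl im) (minn_idPl (ltnW im)) -natr1; ring.
  by rewrite !GE (emono (y i) (y i.+1))// -/r /s; ring.
have k2 : s * I' + (b - a) * r <= 2 * ((b - a) * I' / m%:R).
  by rewrite key mulrA ler_pM2r// invr_gt0.
have hp : (s * I') * ((b - a) * r) <= ((b - a) * I' / m%:R) ^+ 2.
  have p1 : 0 <= s * I' by rewrite mulr_ge0// ltW.
  have p2 : 0 <= (b - a) * r by rewrite mulr_ge0// ltW.
  move: p1 p2 k2; move: (s * I') ((b - a) * r) ((b - a) * I' / m%:R) => P Q V p1 p2 k2.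
  have h : (P + Q) ^+ 2 <= (2 * V) ^+ 2 by rewrite lerXn2r// nnegrE ?addr_ge0// (le_trans _ k2)// addr_ge0.
  by have := sqr_ge0 (P - Q); nra.
rewrite (_ : (b - a) * I' / m%:R = m%:R * tau) in hp; last first.
  by rewrite /I'; field; rewrite !gt_eqF.
have W0 : 0 < m%:R ^+ 2 * tau by rewrite mulr_gt0// exprn_gt0.
rewrite -(ler_pM2l W0).
rewrite (_ : m%:R ^+ 2 * tau * (s * r) = s * I' * ((b - a) * r)); last first.
  by rewrite /I'; field; rewrite gt_eqF.
by apply: (le_trans hp); rewrite exprMn expr2 mulrA.
Qed.

End EnergyCut.

(** * One piece of a symbol *)

Section Pieces.
Variable R : realType.
Local Notation mu := (@lebesgue_measure R).
Local Notation D := (@Rpos R).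
Local Notation mD := (@measurable_Rpos R).
Local Notation DD := (D `*` D).
Local Notation mDD := (@measurable_RposX R).
Local Notation mu2 := (mu \x mu)%E.
Local Notation RR := (measurableTypeR R * measurableTypeR R)%type.
Local Notation sqint := (square_integrable mu D).
Local Notation ip := (@L2ip R).
Local Notation nsq := (nsq ip).
Local Notation "<| u , v |>" := (dot ip u v) (at level 0).
Local Notation op := (@integral_operator R).
Implicit Types (u v : L2 R) (a b : R).

Lemma restr_class (E : set R) f : measurable E -> sqint f ->
  restr E (L2class f) = L2class (fun x => f x * ind E x).
Proof.
move=> mE f2; apply: eq_L2class; [exact: sqint_restr|exact: sqint_mulind|].
by apply: filterS (L2repr_class f2) => x h Dx; rewrite (h Dx).
Qed.

(** The sum of the restrictions is again a restriction of [u], so the claim is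
    the Cauchy--Schwarz inequality for the pair of both. *)
Lemma restr_bessel (I : finType) (E : I -> set R) u : (forall i, measurable (E i)) ->
  (forall i j, i != j -> E i `&` E j = set0) ->
  \sum_i nsq (restr (E i) u) <= nsq u.
Proof.
move=> mE dE; set N := \sum_i _.
have N0 : 0 <= N by apply: sumr_ge0 => *; exact: nsq_ge0.
pose S := \sum_i 1 *: restr (E i) u.
have SN : nsq S = N.
  rewrite nsq_sum_orth; last by move=> i j ij; exact: restr_orth (dE i j ij).
  by apply: eq_bigr => i _; rewrite sqmod1 mul1r.
have Su : <| S, u |> = N%:C%C.
  rewrite dot_suml rmorph_sum; apply: eq_bigr => i _; rewrite dotZl mul1r.
  apply: etrans (dot_nsq ip (restr (E i) u)).
  apply: (etrans (restr_adj u u (mE i))); apply: esym.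
  apply: (etrans (restr_adj u (restr (E i) u) (mE i))).
  by rewrite restr_restr// setIid.
have := cauchy_schwarz ip S u; rewrite Su sqmod_real SN expr2.
have [->|N1] := eqVneq N 0; first by rewrite nsq_ge0.
by rewrite ler_pM2l// lt_neqAle eq_sym N1.
Qed.

Lemma indE_itv a b x : ind `]a, b]%classic x = ((a < x) && (x <= b))%:R%:C%C :> R[i].
Proof. by rewrite /ind indicE mem_setE in_itv. Qed.

Lemma ind_telescope (y : nat -> R) m x : (forall i, y i <= y i.+1) ->
  ind `]y 0%N, y m]%classic x = \sum_(i < m) ind `]y i, y i.+1]%classic x.
Proof.
move=> yS; have y0 m' : y 0%N <= y m' by elim: m' => // n IH; exact: le_trans (yS n).
elim: m => [|m IH]; first by rewrite big_ord0 indE_itv andbC leNgt andNb.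
rewrite big_ord_recr /= -IH !indE_itv -rmorphD -natrD; congr (_%:R%:C%C).
have [xm|mx] := leP x (y m); first by rewrite (le_trans xm (yS m)) andbT addn0.
by rewrite (le_lt_trans (y0 m) mx).
Qed.

Variable phi : R -> R[i].
Hypothesis hphi : symbol phi.

Definition piece a b x : R[i] := phi x * ind `]a, b]%classic x.

Lemma sqnorm_piece a b : 0 < a -> sqnorm mu D (piece a b) = sqnorm mu `]a, b]%classic phi.
Proof.
move=> a0; rewrite /sqnorm -[in RHS](@setIidr _ D `]a, b]%classic); last first.
  by move=> x /=; rewrite in_itv /= => /andP[h _]; exact: lt_trans h.
rewrite [RHS]integral_mkcondr; apply: eq_integral => x _.
rewrite patchE /piece sqmodM sqmod_ind indicE; case: (x \in _); by rewrite ?mulr1 ?mulr0.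
Qed.

Lemma sqint_piece a b : 0 < a -> sqint (piece a b).
Proof.
move=> a0; split; first by apply: cmeasurable_mulind => //; case: hphi.
rewrite -/(sqnorm mu D (piece a b)) sqnorm_piece//.
by rewrite -ge0_fin_numE ?sqnorm_ge0//; exact: sqnorm_itv_fin.
Qed.

Definition upper a b u : L2 R := <| u, L2ind 0 a |> *: L2class (piece a b).
Definition lower_part a b u : L2 R :=
  <| u, L2class (fun x => (piece a b x)^*%C) |> *: L2ind 0 a.

Definition corner a b : RR -> R[i] :=
  fun z => max_kernel phi z * ind `]a, b]%classic z.1 * ind `]a, b]%classic z.2.

Lemma cmeasurable_corner a b : cmeasurable DD (corner a b).
Proof.
have mi : cmeasurable D (ind `]a, b]%classic) by exact: sqint_meas (sqint_itv a b).
apply: cmeasurableM; last exact: cmeasurable_snd.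
by apply: cmeasurableM; [apply: cmeasurable_max_kernel; case: hphi|exact: cmeasurable_fst].
Qed.

(** Pointwise, the value of [phi] at the larger variable is bounded by the sum of
    the values at both variables, which are tensor products. *)
Lemma sqnorm_corner_le a b : 0 < a -> a <= b -> (sqnorm mu2 DD (corner a b) <=
  (2 * ((b - a) * fine (sqnorm mu `]a, b]%classic phi)))%:E)%E.
Proof.
move=> a0 ab; have p2 := sqint_piece b a0; have i2 := sqint_itv a b.
have pJ := sqintJ p2.
have h1 := sqint_tensor p2 i2; have h2 := sqint_tensor i2 pJ.
have e1 : sqnorm mu D (ind `]a, b]%classic) = (b - a)%:E.
  rewrite sqnorm_ind// setIidl ?lebesgue_itvoc// => x /=.
  by rewrite in_itv /= => /andP[h _]; exact: lt_trans h.
have e2 : sqnorm mu D (piece a b) = (fine (sqnorm mu `]a, b]%classic phi))%:E.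
  by rewrite sqnorm_piece// fineK//; exact: sqnorm_itv_fin.
have e3 : sqnorm mu D (fun x => (piece a b x)^*%C) = (fine (sqnorm mu `]a, b]%classic phi))%:E.
  by rewrite -e2; apply: eq_integral => x _; rewrite sqmodJ.
have t1 := sqnorm_tensor p2 i2; have t2 := sqnorm_tensor i2 pJ.
move: t1 t2; rewrite e1 e2 e3 -!EFinM => t1 t2.
apply: (@le_trans _ _ (sqnorm mu2 DD (tensor (piece a b) (ind `]a, b]%classic)) +
   sqnorm mu2 DD (tensor (ind `]a, b]%classic) (fun x => (piece a b x)^*%C)))%E); last first.
  by rewrite t1 t2 -EFinD lee_fin le_eqVlt; apply/orP; left; apply/eqP; ring.
have m1 := measurable_sqmod (sqint_meas2 h1); have m2 := measurable_sqmod (sqint_meas2 h2).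
rewrite /sqnorm -ge0_integralD//; last 3 first.
- exact: mDD.
- by move=> z _; rewrite lee_fin sqmod_ge0.
- by move=> z _; rewrite lee_fin sqmod_ge0.
apply: ge0_le_integral => //.
- exact: mDD.
- by move=> z _; rewrite lee_fin sqmod_ge0.
- by apply: measurable_sqmod; exact: cmeasurable_corner.
- exact: emeasurable_funD.
move=> [x y] _; rewrite -EFinD lee_fin /corner /tensor /piece /max_kernel.
rewrite !(sqmodM, sqmodJ, sqmod_ind) !indicE /=.
have s1 := sqmod_ge0 (phi x); have s2 := sqmod_ge0 (phi y).
move: (_%:R) (_%:R) (ler0n R (x \in (`]a, b]%classic : set R))) (ler0n R (y \in (`]a, b]%classic : set R))) => j i i0 j0.
have key P Q : 0 <= P -> 0 <= Q ->
    P * i * j <= P * i * j + i * (Q * j) /\ Q * i * j <= P * i * j + i * (Q * j).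
  move=> P0 Q0; rewrite [i * (Q * j)]mulrA [i * Q]mulrC.
  by split; [rewrite lerDl !mulr_ge0|rewrite lerDr !mulr_ge0].
by have [? ?] := key _ _ s1 s2; have [xy|yx] := leP x y.
Qed.

Lemma sqint_corner a b : 0 < a -> a <= b -> square_integrable mu2 DD (corner a b).
Proof.
move=> a0 ab; split; first exact: cmeasurable_corner.
rewrite -/(sqnorm mu2 DD (corner a b)).
by apply: le_lt_trans (sqnorm_corner_le a0 ab) _; rewrite ltry.
Qed.

Lemma op_corner_restrr a b u : 0 < a -> a <= b ->
  op (corner a b) (restr `]a, b]%classic u) = op (corner a b) u.
Proof.
move=> a0 ab; have mE : measurable (`]a, b]%classic : set R) by exact: measurable_itv.
apply: (etrans (op_class (sqint_corner a0 ab) (sqint_restr u mE))).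
congr L2class; apply/funext => x; congr cintegral; apply/funext => y.
rewrite /corner /= -mulrA -[RHS]mulrA; congr (_ * _).
rewrite mulrCA [RHS]mulrC; congr (_ * _); rewrite indE_itv.
by rewrite -rmorphM -natrM mulnb andbb.
Qed.

Lemma op_corner_restrl a b u : 0 < a -> a <= b ->
  restr `]a, b]%classic (op (corner a b) u) = op (corner a b) u.
Proof.
move=> a0 ab; have mE : measurable (`]a, b]%classic : set R) by exact: measurable_itv.
have u2 := L2reprP u.
apply: (etrans (restr_class mE (sqint_op_fun (sqint_corner a0 ab) u2))).
congr L2class; apply/funext => x; rewrite /op_fun.
have [xE|xE] := boolP (x \in (`]a, b]%classic : set R)); first by rewrite /ind indicE xE mulr1.
have ix0 : ind `]a, b]%classic x = 0 :> R[i] by rewrite /ind indicE (negbTE xE).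
rewrite ix0 mulr0 -(cintegral0 mu mD); apply: eq_cintegral => y _.
by rewrite /corner /= ix0 mulr0 !mul0r.
Qed.

(** If the larger variable lies in the interval of the piece, the smaller one
    lies in it too or is at most [a]; the latter case gives the two rank one
    kernels, the former the corner, a kernel supported on the square of the
    interval. *)
Lemma max_kernel_piece a b (x y : R) : 0 < a -> a <= b -> 0 < x -> 0 < y ->
  max_kernel (piece a b) (x, y) = tensor (piece a b) (ind `]0, a]%classic) (x, y) +
    tensor (ind `]0, a]%classic) (fun x => (piece a b x)^*%C) (x, y) + corner a b (x, y).
Proof.
move=> a0 ab x0 y0; rewrite /tensor /corner /max_kernel /piece indJ conjcK /= !indE_itv x0 y0 /=.
pose c (t : bool) : R[i] := t%:R%:C%C.
have simp := (rmorph1, rmorph0, mulr1, mulr0, mul1r, mul0r, addr0, add0r).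
have c1 : c true = 1 by []. have c0 : c false = 0 by [].
have aux (s t : R) (q w : R[i]) : s <= t ->
    q * c (a < t <= b) = w * c (a < s <= b) * c (t <= a) +
      c (s <= a) * (q * c (a < t <= b)) + q * c (a < s <= b) * c (a < t <= b) /\
    q * c (a < t <= b) = q * c (a < t <= b) * c (s <= a) +
      c (t <= a) * (w * c (a < s <= b)) + q * c (a < t <= b) * c (a < s <= b).
  move=> st; have [sa|sa] := leP s a.
    have [ta|ta] := leP t a; first by rewrite /= c1 c0 ?simp.
    by rewrite /= c1 c0 ?simp.
  have ta : a < t by exact: lt_le_trans st.
  rewrite ta [t <= a]leNgt ta /= c0; have [tb|tb] := leP t b; last by rewrite c0 ?simp.
  by rewrite (le_trans st tb) c1 ?simp.
have [xy|/ltW yx] := leP x y; first exact: (aux x y (phi y) (phi x) xy).1.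
exact: (aux y x (phi x) (phi y) yx).2.
Qed.

End Pieces.

(** * Finite families of pieces *)

Lemma sum_split_ord (V : nmodType) m n (F : 'I_(m + n) -> V) :
  \sum_i F i = \sum_i F (lshift n i) + \sum_i F (rshift m i).
Proof. exact: big_split_ord. Qed.

Section Rank.
Variable R : realType.
Implicit Types (T S : L2 R -> L2 R).

Lemma rank_le_sum (I : finType) (P : pred I) (e : I -> L2 R) (c : L2 R -> I -> R[i]) :
  rank_le #|P| (fun u => \sum_(i | P i) c u i *: e i).
Proof.
exists (fun k => e (enum_val k)) => u; exists (fun k => c u (enum_val k)).
by rewrite -[RHS](big_enum_val (fun i => c u i *: e i)).
Qed.

Lemma rank_leD m n S T : rank_le m S -> rank_le n T -> rank_le (m + n) (fun u => S u + T u).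
Proof.
move=> [e he] [f hf].
exists (fun k : 'I_(m + n) => match fintype.split k with inl i => e i | inr i => f i end) => u.
have [c ->] := he u; have [d ->] := hf u.
exists (fun k : 'I_(m + n) => match fintype.split k with inl i => c i | inr i => d i end).
apply: esym; apply: (etrans (@sum_split_ord (L2 R) m n _)); apply: congr2; apply: eq_bigr => i _.
  by rewrite (unsplitK (inl i)).
by rewrite (unsplitK (inr i)).
Qed.

End Rank.

Section Cut.
Variable R : realType.
Local Notation mu := (@lebesgue_measure R).
Local Notation D := (@Rpos R).
Local Notation mD := (@measurable_Rpos R).
Local Notation DD := (D `*` D).
Local Notation mu2 := (mu \x mu)%E.
Local Notation RR := (measurableTypeR R * measurableTypeR R)%type.
Local Notation sqint := (square_integrable mu D).
Local Notation ip := (@L2ip R).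
Local Notation nsq := (nsq ip).
Local Notation bessel := (bessel ip).
Local Notation "<| u , v |>" := (dot ip u v) (at level 0).
Local Notation op := (@integral_operator R).
Implicit Types (u v : L2 R).

Variable phi : R -> R[i].
Hypothesis hphi : symbol phi.

Section Family.
Variables (I : finType) (l r : I -> R) (tau : R).
Hypothesis tau0 : 0 <= tau.
Hypothesis l0 : forall i, 0 < l i.
Hypothesis lr : forall i, l i <= r i.
Hypothesis dlr : forall i j, i != j -> (`]l i, r i] `&` `]l j, r j])%classic = set0.
Hypothesis cut : forall i, (r i - l i) * fine (sqnorm mu `]l i, r i]%classic phi) <= tau.
Let pc i := piece phi (l i) (r i).
Let ia i : R -> R[i] := ind `]0, l i]%classic.
Let pJ i : R -> R[i] := fun x => (pc i x)^*%C.

Let pc2 i : sqint (pc i). Proof. exact: sqint_piece. Qed.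
Let ia2 i : sqint (ia i). Proof. exact: sqint_itv. Qed.
Let pJ2 i : sqint (pJ i). Proof. exact: sqintJ. Qed.

Definition family_sum (P : pred I) u :=
  \sum_(i | P i) (upper phi (l i) (r i) u + lower_part phi (l i) (r i) u).

Lemma Qop_family psi u : symbol psi ->
  (forall x, 0 < x -> psi x = \sum_i piece phi (l i) (r i) x) ->
  Qop psi u = family_sum xpredT u + \sum_i op (corner phi (l i) (r i)) u.
Proof.
move=> hpsi psiE.
pose k i (z : RR) := (tensor (pc i) (ia i) z + tensor (ia i) (pJ i) z) + corner phi (l i) (r i) z.
have k1 i := sqint_tensor (pc2 i) (ia2 i).
have k2 i := sqint_tensor (ia2 i) (pJ2 i).
have k3 i := sqint_corner hphi (l0 i) (lr i).
have k12 i := sqint2D (k1 i) (k2 i).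
have hk i : square_integrable mu2 DD (k i) := sqint2D (k12 i) (k3 i).
have E : op (max_kernel psi) = op (fun z => \sum_i k i z).
  apply: eq_op; [exact: sqint_max_kernel|by apply: sqint2_sum => i _; exact: hk|].
  apply: nearW => x Dx; apply: nearW => y Dy.
  rewrite {1}/max_kernel psiE /=; last by rewrite lt_max (Dx : 0 < x).
  by apply: eq_bigr => i _; exact: max_kernel_piece.
apply: (etrans (congr1 (fun T => T u) E)).
apply: (etrans (@op_sum R I (index_enum I) xpredT k u (fun i _ => hk i))).
rewrite /family_sum -big_split; apply: eq_bigr => i _.
apply: (etrans (opD u (k12 i) (k3 i))); apply: (congr1 (fun w => w + _)).
apply: (etrans (opD u (k1 i) (k2 i))).
apply: congr2; [exact: op_tensor u (pc2 i) (ia2 i)|exact: op_tensor u (ia2 i) (pJ2 i)].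
Qed.

Lemma bounded_family_sum P : bounded_operator (family_sum P).
Proof.
pose k i := fun z => tensor (pc i) (ia i) z + tensor (ia i) (pJ i) z.
have k1 i := sqint_tensor (pc2 i) (ia2 i).
have k2 i := sqint_tensor (ia2 i) (pJ2 i).
have hk i : square_integrable mu2 DD (k i) := sqint2D (k1 i) (k2 i).
have hs : square_integrable mu2 DD (fun z => \sum_(i | P i) k i z).
  by apply: sqint2_sum => i _; exact: hk.
suff -> : family_sum P = op (fun z => \sum_(i | P i) k i z) by exact: op_bounded.
apply/funext => u; apply: esym; apply: (etrans (@op_sum R I (index_enum I) P k u (fun i _ => hk i))).
apply: eq_bigr => i _; apply: (etrans (opD u (k1 i) (k2 i))).
apply: congr2; [exact: op_tensor u (pc2 i) (ia2 i)|exact: op_tensor u (ia2 i) (pJ2 i)].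
Qed.

Lemma rank_family_sum P : rank_le (#|P| + #|P|) (family_sum P).
Proof.
rewrite (_ : family_sum P = fun u =>
  \sum_(i | P i) upper phi (l i) (r i) u + \sum_(i | P i) lower_part phi (l i) (r i) u).
  apply: rank_leD.
    exact: rank_le_sum (fun u i => <| u, L2ind 0 (l i) |>).
  exact: rank_le_sum (fun u i => <| u, L2class (pJ i) |>).
by apply/funext => u; rewrite /family_sum big_split.
Qed.

(** The corners act between mutually orthogonal subspaces, so the norm of their
    sum is the maximum of their norms. *)
Lemma nsq_corners u : nsq (\sum_i op (corner phi (l i) (r i)) u) <= 2 * tau * nsq u.
Proof.
pose w i := op (corner phi (l i) (r i)) u.
have mE i : measurable (`]l i, r i]%classic : set R) by exact: measurable_itv.
have wE i : w i = restr `]l i, r i]%classic (w i).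
  exact: esym (op_corner_restrl hphi u (l0 i) (lr i)).
have -> : \sum_i op (corner phi (l i) (r i)) u = \sum_i 1 *: w i.
  by apply: eq_bigr => i _; apply: esym; exact: scale1r.
rewrite nsq_sum_orth; last first.
  by move=> i j ij; rewrite (wE i) (wE j); exact: restr_orth (dlr ij).
apply: (@le_trans _ _ (\sum_i 2 * tau * nsq (restr `]l i, r i]%classic u))).
  apply: ler_sum => i _; rewrite sqmod1 mul1r.
  have -> : w i = op (corner phi (l i) (r i)) (restr `]l i, r i]%classic u).
    exact: esym (op_corner_restrr hphi u (l0 i) (lr i)).
  have c2 := sqint_corner hphi (l0 i) (lr i).
  rewrite -lee_fin; apply: (le_trans (nsq_op_le _ c2)); rewrite EFinM.
  rewrite lee_wpmul2r ?lee_fin ?nsq_ge0//.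
  by apply: (le_trans (sqnorm_corner_le hphi (l0 i) (lr i))); rewrite lee_fin ler_pM2l.
rewrite -mulr_sumr.
by rewrite ler_wpM2l ?mulr_ge0//; exact: restr_bessel.
Qed.

End Family.

Lemma dot_disjoint f g : sqint f -> sqint g -> (forall x, f x = 0 \/ g x = 0) ->
  <| L2class f, L2class g |> = 0.
Proof.
move=> f2 g2 fg; apply: (etrans (L2dot_class f2 g2)); rewrite -(cintegral0 mu mD).
apply: eq_cintegral => x _; have [->|->] := fg x; first by rewrite mul0r.
by rewrite conjc0 mulr0.
Qed.

Lemma dot_realZ (c : R) u v : <| u, c%:C%C *: v |> = c%:C%C * <| u, v |>.
Proof. by rewrite dotZr conjc_real. Qed.

Lemma sqmod_dotZ (c : R) u v : sqmod <| u, c%:C%C *: v |> = c ^+ 2 * sqmod <| u, v |>.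
Proof. by rewrite dotZr sqmodM sqmodJ sqmod_real. Qed.

Variables (delta : R) (delta0 : 0 < delta).
Local Notation a := (dyadic delta).

(** A quarter of the nested system is Bessel, and so is its analysis map. *)
Lemma nested_dual J u : \sum_(j < J) sqmod <| u, nested delta j |> <= 16 * nsq u.
Proof.
have bf : bessel (fun j : 'I_J => (4^-1)%:C%C *: nested delta j).
  move=> c; have E : \sum_j c j *: ((4^-1)%:C%C *: nested delta j) =
      \sum_j (c j * (4^-1)%:C%C) *: nested delta j.
    by apply: eq_bigr => j _; exact: scalerA.
  apply: (le_trans (_ : _ <= 8 * \sum_j sqmod (c j * (4^-1)%:C%C))).
    rewrite -subr_ge0 (congr1 nsq E) subr_ge0.
    exact: (nested_bound delta0 (fun j => c j * (4^-1)%:C%C)).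
  rewrite mulr_sumr; apply: ler_sum => j _; rewrite sqmodM sqmod_real.
  by have := sqmod_ge0 (c j); move: (sqmod (c j)) => s; lra.
have h := bessel_dual u bf.
have E : \sum_(j < J) sqmod <| u, nested delta j |> =
    16 * \sum_(j < J) sqmod <| u, (4^-1)%:C%C *: nested delta j |>.
  rewrite mulr_sumr; apply: eq_bigr => j _.
  apply: etrans (esym (congr1 ( *%R 16) (sqmod_dotZ 4^-1 u (nested delta j)))).
  by move: (sqmod _) => s; field.
by rewrite E; apply: ler_wpM2l.
Qed.

Section Small.
Variables (J : nat) (P : pred 'I_J) (t : R).
Hypothesis t0 : 0 < t.
Hypothesis small : forall j, P j -> weight delta phi j <= t ^+ 2.
Let G (j : 'I_J) := L2class (piece phi (a j) (a j.+1)).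
Let H (j : 'I_J) := L2class (fun x => (piece phi (a j) (a j.+1) x)^*%C).
Let E (j : 'I_J) := fine (sqnorm mu `]a j, a j.+1]%classic phi).

Let a0 j : 0 < a j. Proof. exact: dyadic_gt0. Qed.
Let p2 (j : 'I_J) : sqint (piece phi (a j) (a j.+1)). Proof. exact: sqint_piece. Qed.
Let pJ2 (j : 'I_J) : sqint (fun x => (piece phi (a j) (a j.+1) x)^*%C).
Proof. exact: sqintJ. Qed.
Let E0 j : 0 <= E j. Proof. by rewrite fine_ge0// sqnorm_ge0. Qed.

Let piece_disjoint (i j : 'I_J) x : i != j ->
  piece phi (a i) (a i.+1) x = 0 \/ piece phi (a j) (a j.+1) x = 0.
Proof.
move=> ij; have [xi|xi] := pselect ((`]a i, a i.+1]%classic : set R) x); last first.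
  by left; rewrite /piece /ind indicE memNset// mulr0.
right; rewrite /piece /ind indicE memNset ?mulr0// => xj.
have : (`]a i, a i.+1] `&` `]a j, a j.+1])%classic x by split.
by rewrite (block_disjoint delta0).
Qed.

Let G_orth i j : i != j -> <| G i, G j |> = 0.
Proof. by move=> ij; apply: dot_disjoint (p2 i) (p2 j) _ => x; exact: piece_disjoint. Qed.

Let H_orth i j : i != j -> <| H i, H j |> = 0.
Proof.
move=> ij; apply: dot_disjoint (pJ2 i) (pJ2 j) _ => x.
by have [->|->] := piece_disjoint x ij; [left|right]; rewrite conjc0.
Qed.

Let nsqG j : nsq (G j) = E j.
Proof.
suff : (nsq (G j))%:E = (E j)%:E by case.
rewrite nsq_class// sqnorm_piece// fineK//; exact: sqnorm_itv_fin.
Qed.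

Let nsqH j : nsq (H j) = E j.
Proof.
suff : (nsq (H j))%:E = (E j)%:E by case.
rewrite (nsq_class (pJ2 j)) (_ : sqnorm _ _ _ = sqnorm mu D (piece phi (a j) (a j.+1))).
  by rewrite sqnorm_piece// fineK//; exact: sqnorm_itv_fin.
by apply: eq_integral => x _; rewrite sqmodJ.
Qed.

Let aE j : P j -> a j * E j <= t ^+ 2. Proof. exact: small. Qed.

Let nsq_upper u :
  nsq (\sum_(j | P j) upper phi (a j) (a j.+1) u) <= 16 * t ^+ 2 * nsq u.
Proof.
pose c j : R[i] := if P j then <| u, L2ind 0 (a j) |> else 0.
have -> : \sum_(j | P j) upper phi (a j) (a j.+1) u = \sum_j c j *: G j.
  rewrite big_mkcond; apply: eq_bigr => j _; rewrite /c; case: (P j) => //.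
  by apply: esym; exact: scale0r.
rewrite (nsq_sum_orth c G_orth).
apply: (@le_trans _ _ (\sum_(j < J) t ^+ 2 * sqmod <| u, nested delta j |>)).
  apply: ler_sum => j _; rewrite nsqG /c; have [Pj|_] := ifP; last first.
    by rewrite sqmod0 mul0r mulr_ge0 ?sqr_ge0 ?sqmod_ge0.
  have -> : sqmod <| u, L2ind 0 (a j) |> = a j * sqmod <| u, nested delta j |>.
    apply: esym; apply: (etrans (congr1 ( *%R (a j)) (sqmod_dotZ _ u (L2ind 0 (a j))))).
    by rewrite exprVn sqr_sqrtr ?(ltW (a0 j))// mulVKf// gt_eqF.
  rewrite mulrAC; apply: ler_wpM2r; [exact: sqmod_ge0|exact: aE].
rewrite -mulr_sumr (_ : 16 * t ^+ 2 * nsq u = t ^+ 2 * (16 * nsq u)); last by ring.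
by apply: ler_wpM2l; [exact: sqr_ge0|exact: nested_dual].
Qed.

Let nsq_lower u :
  nsq (\sum_(j | P j) lower_part phi (a j) (a j.+1) u) <= 8 * t ^+ 2 * nsq u.
Proof.
pose f j : L2 R := (if P j then Num.sqrt (a j) / t else 0)%:C%C *: H j.
have bf : bessel f.
  apply: bessel_orth => [i j ij|j]; first by rewrite dotZl dotZr H_orth// !mulr0.
  rewrite nsqZ sqmod_real nsqH; case: ifP => [Pj|_]; last by rewrite expr0n mul0r.
  rewrite expr_div_n sqr_sqrtr ?(ltW (a0 j))// mulrAC ler_pdivrMr ?mul1r ?exprn_gt0//.
  exact: aE.
pose c j : R[i] := t%:C%C * <| u, f j |>.
have -> : \sum_(j | P j) lower_part phi (a j) (a j.+1) u = \sum_j c j *: nested delta j.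
  rewrite [LHS]big_mkcond; apply: eq_bigr => j _; rewrite /c (dot_realZ _ u (H j)).
  case: (P j); last by rewrite mul0r mulr0; apply: esym; exact: scale0r.
  apply: esym; apply: (etrans (scalerA _ _ _)); apply: (congr1 (fun z => z *: _)).
  have s0 : Num.sqrt (a j) != 0 by rewrite gt_eqF// sqrtr_gt0.
  have e : t%:C%C * (Num.sqrt (a j) / t)%:C%C * (Num.sqrt (a j))^-1%:C%C = 1 :> R[i].
    rewrite -!rmorphM /= (_ : _ * _ * _ = 1)//; field; rewrite s0 gt_eqF//.
  by rewrite mulrA mulrAC e mul1r.
apply: (le_trans (nested_bound delta0 c)); rewrite -mulrA ler_pM2l//.
rewrite (_ : \sum_j _ = t ^+ 2 * \sum_j sqmod <| u, f j |>).
  by apply: ler_wpM2l; [exact: sqr_ge0|exact: bessel_dual].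
by rewrite mulr_sumr; apply: eq_bigr => j _; rewrite sqmodM sqmod_real.
Qed.

(** Both families of rank one operators pair the almost orthogonal indicators
    with the orthogonal pieces of [phi], weighted by at most [t]. *)
Lemma nsq_small_blocks u : nsq (\sum_(j | P j)
  (upper phi (a j) (a j.+1) u + lower_part phi (a j) (a j.+1) u)) <= 48 * t ^+ 2 * nsq u.
Proof.
rewrite big_split /=; apply: (le_trans (nsqD_le _ _ _)).
apply: (@le_trans _ _ (2 * (16 * t ^+ 2 * nsq u + 8 * t ^+ 2 * nsq u))).
  by rewrite ler_pM2l//; apply: lerD; [exact: nsq_upper|exact: nsq_lower].
by rewrite le_eqVlt; apply/orP; left; apply/eqP; ring.
Qed.

End Small.
End Cut.

(** * Singular numbers of the operator of a symbol *)

Lemma sum_tagged (V : nmodType) J (m : nat -> nat) (P : pred 'I_J) (F : 'I_J -> nat -> V) :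
  \sum_(p : {j : 'I_J & 'I_(m j)} | P (tag p)) F (tag p) (tagged p) =
  \sum_(j | P j) \sum_(i < m j) F j i.
Proof.
rewrite (sig_big_dep (fun j : 'I_J => P j) (fun j (i : 'I_(m j)) => true) (fun j (i : 'I_(m j)) => F j i)).
by apply: eq_bigl => p; rewrite andbT.
Qed.

Lemma subr_split (V : zmodType) (x q k s : V) : q = k + s -> x - k = (x - q) + s.
Proof. by move=> ->; rewrite opprD addrA subrK. Qed.

Section SingularNumbers.
Variable R : realType.
Local Notation mu := (@lebesgue_measure R).
Local Notation ip := (@L2ip R).
Local Notation nsq := (nsq ip).
Implicit Types (u v : L2 R) (phi : R -> R[i]).

(** The estimate of the pieces improves with the square of their number, so
    about [Num.sqrt w / t] of them suffice. *)
Lemma piece_count (w t : R) : 0 < t -> exists m : nat,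
  [/\ (0 < m)%N, w <= m%:R ^+ 2 * t ^+ 2, w <= t ^+ 2 -> m = 1%N &
      t ^+ 2 < w -> m%:R <= 2 * (Num.sqrt w / t)].
Proof.
move=> t0; have [wt|tw] := leP w (t ^+ 2).
  by exists 1%N; split => //; rewrite expr1n mul1r.
have w0 : 0 < w by apply: lt_trans tw; rewrite exprn_gt0.
have x1 : 1 < Num.sqrt w / t.
  by rewrite ltr_pdivlMr// mul1r -(@ltr_pXn2r _ 2)// ?nnegrE ?sqrtr_ge0 ?(ltW t0)// sqr_sqrtr// ltW.
have x0 : 0 <= Num.sqrt w / t by apply: ltW; exact: lt_trans x1.
have /andP[h1 h2] := truncn_itv x0.
exists (Num.truncn (Num.sqrt w / t)).+1; split => //; last first.
  by move=> _; rewrite -natr1 mulr2n mulrDl mul1r lerD// ltW.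
move: h2; rewrite ltr_pdivrMr// => h2; rewrite -exprMn -[w in w <= _](sqr_sqrtr (ltW w0)).
by rewrite lerXn2r ?nnegrE ?sqrtr_ge0 ?(ltW h2)// mulr_ge0// ltW.
Qed.

Lemma eq_rank_two phi u (b b' c c' : R) : b = b' -> c = c' ->
  upper phi b c u + lower_part phi b c u = upper phi b' c' u + lower_part phi b' c' u.
Proof. by move=> -> ->. Qed.

(** Each block with weight above [t ^+ 2] is cut into pieces whose corners have
    norm at most a multiple of [t], and the rank-two parts of these pieces are
    removed: this costs rank [2] per piece.  The rank-two parts of the other
    blocks are kept, since together they are bounded by a multiple of [t]. *)
Lemma Qop_singular phi delta J (t : R) N : symbol phi -> 0 < delta -> 0 < t ->
  (forall u, nsq (Qop phi u -
     Qop (fun x => phi x * ind `]dyadic delta 0, dyadic delta J]%classic x) u) <= t ^+ 2 * nsq u) ->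
  \sum_(j < J | t ^+ 2 < weight delta phi j) 4 * (Num.sqrt (weight delta phi j) / t) <= N%:R ->
  snum (Qop phi) N <= 15 * t.
Proof.
move=> hphi delta0 t0 htail hN.
pose w j := weight delta phi j; pose a := dyadic delta.
have a0 j : 0 < a j by exact: dyadic_gt0.
have t20 : 0 < t ^+ 2 by rewrite exprn_gt0.
have /choice[m hm] := fun j => piece_count (w j) t0.
have /choice[y hy] : forall j, exists y : nat -> R, [/\ y 0%N = a j, y (m j) = a j.+1,
    forall i, y i <= y i.+1 & forall i, (i < m j)%N ->
      (y i.+1 - y i) * fine (sqnorm mu `]y i, y i.+1]%classic phi) <= t ^+ 2].
  move=> j; have [m0 wm _ _] := hm j; have E : a j.+1 = 2 * a j by exact: dyadicS.
  apply: energy_cut => //; first by rewrite E mulr_natl mulr2n ltrDl.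
  by rewrite [X in X * _](_ : _ = a j) // E mulr_natl mulr2n addrK.
have yle j i i' : (i <= i')%N -> y j i <= y j i'.
  have [_ _ yS _] := hy j.
  by move=> /subnKC <-; elim: (i' - i)%N => [|n IH]; rewrite ?addn0// addnS (le_trans IH).
have y0 j i : 0 < y j i.
  have [E _ _ _] := hy j; apply: lt_le_trans (yle j 0%N i (leq0n i)); by rewrite E.
pose I := {j : 'I_J & 'I_(m j)}.
pose l (p : I) : R := y (tag p) (tagged p); pose r (p : I) : R := y (tag p) (tagged p).+1.
have l0 p : 0 < l p by exact: y0.
have lr p : l p <= r p by exact: yle.
have dlr (p q : I) : p != q -> (`]l p, r p] `&` `]l q, r q])%classic = set0.
  case: p q => [j i] [j' i'] pq; rewrite /l /r /=; apply/seteqP; split => // x [] /=.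
  rewrite !in_itv /= => /andP[h1 h2] /andP[h3 h4].
  have blk (k : 'I_J) (n : 'I_(m k)) : y k n < x -> x <= y k n.+1 -> (`]a k, a k.+1]%classic : set R) x.
    move=> k1 k2; rewrite /= in_itv /=; have [E0 Em _ _] := hy k.
    by rewrite -E0 -Em (le_lt_trans (yle k 0%N n _) k1)//= (le_trans k2)// yle.
  have [jj|jj] := eqVneq j j'; last first.
    have : (`]a j, a j.+1] `&` `]a j', a j'.+1])%classic x by split; [exact: blk h1 h2|exact: blk h3 h4].
    by rewrite (block_disjoint delta0).
  subst j'; have ii : (i : nat) != i'.
    by apply: contra pq => /eqP e; have -> : i = i' by exact: val_inj.
  have [ij|ij|ij] := ltngtP (i : nat) (i' : nat).
  - by have := lt_le_trans h3 (le_trans h2 (yle j _ _ ij)); rewrite ltxx.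
  - by have := lt_le_trans h1 (le_trans h4 (yle j _ _ ij)); rewrite ltxx.
  - by rewrite ij eqxx in ii.
have cut p : (r p - l p) * fine (sqnorm mu `]l p, r p]%classic phi) <= t ^+ 2.
  by case: p => j i; rewrite /r /l /=; have [_ _ _] := hy j; apply.
pose psi x := phi x * ind `]a 0%N, a J]%classic x.
have hpsi : symbol psi by apply: symbol_mulind.
have psiE x : 0 < x -> psi x = \sum_p piece phi (l p) (r p) x.
  move=> x0; rewrite /psi (ind_telescope _ _ (fun i => dyadic_le delta0 (leqnSn i))) mulr_sumr.
  rewrite (eq_bigr (fun j : 'I_J => \sum_(i < m j) piece phi (y j i) (y j i.+1) x)); last first.
    move=> j _; have [E0 Em yS _] := hy j.
    by rewrite -/(a j) -/(a j.+1) -E0 -Em (ind_telescope _ _ yS) mulr_sumr.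
  exact: esym (sum_tagged m xpredT (fun j i => piece phi (y j i) (y j i.+1) x)).
pose big (p : I) := t ^+ 2 < w (tag p).
pose K := family_sum phi l r big.
have bK : bounded_operator K by exact: bounded_family_sum.
have rK := rank_family_sum phi l r big.
have card : (#|big| + #|big| <= N)%N.
  rewrite -(ler_nat R); apply: le_trans hN; rewrite natrD.
  have E : #|big|%:R = \sum_(j < J | t ^+ 2 < w j) (m j)%:R :> R.
    rewrite -sum1_card natr_sum.
    apply: (etrans (sum_tagged m (fun j : 'I_J => t ^+ 2 < w j) (fun _ _ => 1%:R))).
    by apply: eq_bigr => j _; rewrite sumr_const card_ord.
  rewrite E -big_split /=; apply: ler_sum => j wj; have [_ _ _ /(_ wj) h] := hm j.
  by move: h; rewrite -/(w j); move: (_ / t) => s; lra.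
have main u : nsq (Qop phi u - K u) <= (15 * t) ^+ 2 * nsq u.
  (* Three errors remain: the truncation, the uncut blocks and the corners.
     15 comes from 2 * (1 + 2 * (48 + 2)) <= 15 ^ 2. *)
  pose S := family_sum phi l r (predC big) u.
  pose C := \sum_p integral_operator (corner phi (l p) (r p)) u.
  have E : Qop psi u = K u + (S + C).
    rewrite (Qop_family hphi l0 lr u hpsi psiE) addrA; congr (_ + _).
    by rewrite /K /S /family_sum (bigID big).
  have S48 : nsq S <= 48 * t ^+ 2 * nsq u.
    have -> : S = \sum_(j < J | ~~ (t ^+ 2 < w j))
        (upper phi (a j) (a j.+1) u + lower_part phi (a j) (a j.+1) u).
      rewrite /S /family_sum.
      apply: (etrans (sum_tagged m (fun j : 'I_J => ~~ (t ^+ 2 < w j))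
        (fun j i => upper phi (y j i) (y j i.+1) u + lower_part phi (y j i) (y j i.+1) u))).
      apply: eq_bigr => j; rewrite -leNgt => wj.
      have [_ _ /(_ wj) m1 _] := hm j; have [E0 Em _ _] := hy j.
      have E1 : y j 1%N = a j.+1 by rewrite -Em m1.
      rewrite m1; apply: (etrans (big_ord1 _ _)).
      exact: eq_rank_two E0 E1.
    by apply: nsq_small_blocks => // j; rewrite -leNgt.
  have C2 : nsq C <= 2 * t ^+ 2 * nsq u.
    by apply: nsq_corners => //; exact: ltW.
  rewrite (subr_split (Qop phi u) E).
  apply: (le_trans (nsqD_le _ _ _)).
  have h1 := nsqD_le ip S C; have h2 := htail u; have u0 := nsq_ge0 ip u.
  apply: (@le_trans _ _ (2 * (t ^+ 2 * nsq u + 2 * (48 * t ^+ 2 * nsq u + 2 * t ^+ 2 * nsq u)))).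
    rewrite ler_pM2l//; apply: lerD => //; apply: (le_trans h1).
    by rewrite ler_pM2l//; apply: lerD.
  rewrite -subr_ge0 (_ : _ - _ = 23 * (t ^+ 2 * nsq u)); last by ring.
  by rewrite mulr_ge0// mulr_ge0// ltW.
have bQ : bounded_operator (Qop phi) by apply: op_bounded; exact: sqint_max_kernel.
rewrite -lee_fin snumE//; apply: le_trans (singular_number_nonincreasing _ card) _.
by apply: singular_number_le bK rK main; rewrite mulr_ge0// ltW.
Qed.

End SingularNumbers.

(** * Summation over dyadic levels *)

Section LayerCake.
Variable R : realType.
Implicit Types (x w t p q : R).

(** A geometric sum is dominated by its last term, here the last one below
    [w]. *)
Lemma geometric_below q x w n : 1 < q -> 0 < x -> 0 <= w ->
  \sum_(i < n) (if x * q ^+ i < w then x * q ^+ i else 0) <= q / (q - 1) * w.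
Proof.
move=> q1 x0 w0; have q0 : 0 < q by exact: lt_trans q1.
have d0 : 0 < q - 1 by rewrite subr_gt0.
have total m : \sum_(i < m) (if x * q ^+ i < w then x * q ^+ i else 0) <= x * q ^+ m / (q - 1).
  elim: m => [|m IH]; first by rewrite big_ord0 divr_ge0 ?mulr_ge0 ?exprn_ge0 ?ltW.
  rewrite big_ord_recr /=; apply: (@le_trans _ _ (x * q ^+ m / (q - 1) + x * q ^+ m)).
    by apply: lerD => //; case: ifP => // _; rewrite mulr_ge0 ?exprn_ge0 ?ltW.
  rewrite le_eqVlt; apply/orP; left; apply/eqP; rewrite exprS; field; by rewrite gt_eqF.
elim: n => [|n IH]; first by rewrite big_ord0 mulr_ge0// divr_ge0// ltW.
have [lt|ge] := ltP (x * q ^+ n) w.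
  apply: (le_trans (total n.+1)).
  have -> : x * q ^+ n.+1 / (q - 1) = q / (q - 1) * (x * q ^+ n).
    by rewrite exprS; field; rewrite gt_eqF.
  by apply: ler_wpM2l; [rewrite divr_ge0 ?ltW|exact: ltW].
by rewrite big_ord_recr /= ltNge ge addr0.
Qed.

(** The factor 2 absorbs rounding, which is possible only because [x] cannot lie
    strictly between 0 and 1. *)
Lemma count_lt x K : x = 0 \/ 1 <= x ->
  \sum_(k < K) (if (k : nat)%:R < x then 1 else 0) <= 2 * x.
Proof.
move=> [->|x1]; first by rewrite mulr0 big1// => k _; rewrite ltNge ler0n.
have x0 : 0 <= x by exact: le_trans x1.
have /andP[h1 h2] := truncn_itv x0; set n := Num.truncn x in h1 h2 *.
have step m : \sum_(k < m) (if (k : nat)%:R < x then 1 else 0) <= (minn m n.+1)%:R :> R.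
  elim: m => [|m IH]; first by rewrite big_ord0.
  rewrite big_ord_recr /=; case: ifP => mx.
    apply: (le_trans (lerD IH (lexx _))).
    have : (m < n.+1)%N by rewrite -(ltr_nat R); exact: lt_trans h2.
    by move=> mn; rewrite (minn_idPl (ltnW mn)) (minn_idPl mn) natr1.
  rewrite addr0; apply: (le_trans IH); rewrite ler_nat.
  by rewrite leq_min geq_minr andbT (leq_trans (geq_minl _ _)).
apply: (le_trans (step K)); apply: (@le_trans _ _ n.+1%:R); first by rewrite ler_nat geq_minr.
by rewrite -natr1 mulr2n mulrDl mul1r lerD.
Qed.

Lemma powR_expn x r i : 0 <= x -> (x `^ r) ^+ i = (x ^+ i) `^ r.
Proof.
move=> x0; elim: i => [|i IH]; first by rewrite !expr0 powR1.
by rewrite !exprS IH powRM// exprn_ge0.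
Qed.

Definition layer_constant p : R :=
  30 `^ p * (8 * (2 `^ (p - 1) / (2 `^ (p - 1) - 1))).

(** A layer cake decomposition.  Below the top level, [s k] lies between two
    consecutive levels or under the lowest one, so its power is bounded by a sum
    over the levels below it; the number of [k] above a level is bounded by
    the sum in the hypothesis.  Exchanging the sums leaves, for each [w j], a
    geometric progression of ratio [2 `^ (p - 1)]: this is where [1 < p] enters. *)
Lemma layer_cake_level p (s : nat -> R) K B t0 n J (w : 'I_J -> R) : 1 < p ->
  (forall k, 0 <= s k) -> 0 < t0 -> (forall j, 0 <= w j) ->
  \sum_j w j `^ p <= B ->
  (forall i N, (i < n)%N -> \sum_(j | dyadic t0 i < w j) 4 * (w j / dyadic t0 i) <= N%:R ->
     s N <= 15 * dyadic t0 i) ->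
  (forall k, (k < K)%N -> s k <= 15 * dyadic t0 n) ->
  \sum_(k < K) s k `^ p <= K%:R * (15 * t0) `^ p + layer_constant p * B.
Proof.
move=> p1 s0 t00 w0 wB sN sn; pose t := dyadic t0.
have tp i : 0 < t i by exact: dyadic_gt0.
have p0 : 0 < p by exact: lt_trans p1.
have pm1 : 0 < p - 1 by rewrite subr_gt0.
pose q : R := 2 `^ (p - 1).
have q1 : 1 < q.
  have := gt0_ltr_powR pm1 (ler0n R 1) (ler0n R 2); rewrite powR1; apply.
  by rewrite ltr1n.
pose F k i : R := if 15 * t i < s k then t i `^ p else 0.
have F0 k i : 0 <= F k i by rewrite /F; case: ifP => // _; exact: powR_ge0.
have pointwise k : (k < K)%N -> s k `^ p <= (15 * t0) `^ p + 30 `^ p * \sum_(i < n) F k i.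
  move=> kK; have sum0 : 0 <= 30 `^ p * \sum_(i < n) F k i.
    by rewrite mulr_ge0 ?powR_ge0// sumr_ge0.
  have [sk|sk] := leP (s k) (15 * t0).
    apply: ler_wpDr => //; apply: ge0_ler_powR; rewrite ?nnegrE ?(ltW p0)//.
    by rewrite mulr_ge0// ltW.
  have t00E : 15 * t 0%N = 15 * t0 by rewrite /t /dyadic expr0 mulr1.
  have [i ni /andP[i1 i2]] := @between R (fun i => 15 * t i) (s k) n (eq_ind_r (fun z => z < s k) sk t00E) (sn k kK).
  apply: ler_wpDl; first exact: powR_ge0.
  apply: (@le_trans _ _ (30 `^ p * t i `^ p)).
    rewrite -powRM ?(ltW (tp i))//; apply: ge0_ler_powR; rewrite ?nnegrE ?(ltW p0)//.
      by rewrite mulr_ge0// ltW.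
    by apply: (le_trans i2); rewrite /t dyadicS mulrA (_ : 15 * 2 = 30)//; ring.
  apply: ler_wpM2l; first exact: powR_ge0.
  rewrite (bigD1 (Ordinal ni)) //= {1}/F i1 lerDl; apply: sumr_ge0 => i' _; exact: F0.
pose Nt i : R := \sum_(j | t i < w j) 4 * (w j / t i).
have Nt1 i : Nt i = 0 \/ 1 <= Nt i.
  have [j tj|none] := pickP (fun j => t i < w j); last by left; rewrite /Nt big_pred0.
  right; rewrite /Nt (bigD1 j) //=; apply: ler_wpDr.
    by apply: sumr_ge0 => j' _; rewrite mulr_ge0// divr_ge0// ltW.
  have : 1 <= w j / t i by rewrite ler_pdivlMr// mul1r ltW.
  by move: (w j / t i) => z; lra.
have count i : (i < n)%N -> \sum_(k < K) F k i <= t i `^ p * (2 * Nt i).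
  move=> ni; apply: (@le_trans _ _ (t i `^ p * \sum_(k < K) (if (k : nat)%:R < Nt i then 1 else 0))).
    rewrite mulr_sumr; apply: ler_sum => k _; rewrite /F; case: ifP => [sk|_]; last first.
      by rewrite mulr_ge0 ?powR_ge0//; case: ifP.
    rewrite ifT ?mulr1//; rewrite ltNge; apply/negP => /(sN _ _ ni) h.
    by have := lt_le_trans sk h; rewrite ltxx.
  by apply: ler_wpM2l; [exact: powR_ge0|exact: count_lt].
have tE i : t0 `^ (p - 1) * q ^+ i = t i `^ (p - 1).
  rewrite /t /dyadic powRM ?exprn_ge0 ?(ltW t00)//; congr (_ * _).
  exact: powR_expn.
have level i j : t i `^ p * (4 * (w j / t i)) = 4 * (w j * (t0 `^ (p - 1) * q ^+ i)).
  rewrite tE.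
  rewrite -(mulr_powRB1 (ltW (tp i)) p0); field; by rewrite gt_eqF.
have geo j : \sum_(i < n) (if t i < w j then w j * (t0 `^ (p - 1) * q ^+ i) else 0) <=
    q / (q - 1) * w j `^ p.
  have x0 : 0 < t0 `^ (p - 1) by exact: powR_gt0.
  have := geometric_below n q1 x0 (powR_ge0 (w j) (p - 1)) => /(ler_wpM2l (w0 j)).
  rewrite mulrCA mulr_powRB1//; apply: le_trans.
  rewrite mulr_sumr; apply: ler_sum => i _.
  rewrite (tE i); case: ifP => [tw|_]; last by case: ifP => _; rewrite ?mulr0// mulr_ge0 ?powR_ge0.
  rewrite ifT//; apply: gt0_ltr_powR => //; rewrite nnegrE ?w0//.
  exact: ltW (tp i).
apply: (@le_trans _ _ (\sum_(k < K) ((15 * t0) `^ p + 30 `^ p * \sum_(i < n) F k i))).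
  by apply: ler_sum => k _; exact: pointwise.
rewrite big_split /= sumr_const card_ord -[_ *+ K]mulr_natl lerD2l -mulr_sumr /layer_constant -mulrA.
apply: ler_wpM2l; first exact: powR_ge0.
rewrite exchange_big /=.
apply: (@le_trans _ _ (\sum_(i < n) t i `^ p * (2 * Nt i))).
  by apply: ler_sum => i _; exact: count.
apply: (@le_trans _ _ (8 * \sum_j \sum_(i < n)
    (if t i < w j then w j * (t0 `^ (p - 1) * q ^+ i) else 0))).
  rewrite exchange_big /= mulr_sumr; apply: ler_sum => i _.
  rewrite /Nt mulrCA !mulr_sumr big_mkcond; apply: ler_sum => j _.
  case: ifP => _; last by rewrite mulr0.
  by rewrite level le_eqVlt; apply/orP; left; apply/eqP; ring.
rewrite -mulrA ler_pM2l//; apply: (@le_trans _ _ (q / (q - 1) * \sum_j w j `^ p)).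
  by rewrite mulr_sumr; apply: ler_sum => j _; exact: geo.
apply: ler_wpM2l => //; rewrite divr_ge0 ?powR_ge0// subr_ge0; exact: ltW.
Qed.

End LayerCake.

Section Levels.
Variable R : realType.
Local Notation nsq := (nsq (@L2ip R)).
Implicit Types (phi : R -> R[i]).

Lemma snum_le0 (T : L2 R -> L2 R) k : bounded_operator T -> snum T k <= snum T 0.
Proof.
by move=> bT; rewrite -lee_fin !snumE//; exact: singular_number_nonincreasing (leq0n k).
Qed.

(** For finitely many singular numbers finitely many levels matter, so one
    truncation serves all of them; the contribution of the lowest level tends to
    0 with the level. *)
Lemma Qop_sum_singular phi p (B : R) K : 1 < p -> symbol phi ->
  (forall delta J, 0 < delta -> \sum_(j < J) weight delta phi j `^ (p / 2) <= B) ->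
  \sum_(k < K) snum (Qop phi) k `^ p <= layer_constant p * B.
Proof.
move=> p1 hphi hB; have p0 : 0 < p by exact: lt_trans p1.
have bQ : bounded_operator (Qop phi) by apply: op_bounded; exact: sqint_max_kernel.
apply/ler_addgt0Pr => e e0.
have K1 : 0 < K.+1%:R :> R by rewrite ltr0n.
(* chosen so that [K%:R * (15 * t0) `^ p <= e] *)
pose t0 : R := (e / K.+1%:R) `^ p^-1 / 15.
have eK : 0 < e / K.+1%:R by rewrite divr_gt0.
have t00 : 0 < t0 by rewrite divr_gt0// powR_gt0.
have tE : 15 * t0 = (e / K.+1%:R) `^ p^-1 by rewrite /t0 mulrC divfK.
pose S := snum (Qop phi) 0; pose n := (Num.truncn (S / (15 * t0))).+1.
have d0 : 0 < 15 * t0 by rewrite mulr_gt0.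
have sn k : snum (Qop phi) k <= 15 * dyadic t0 n.
  apply: (le_trans (snum_le0 k bQ)); rewrite /dyadic mulrA [X in _ <= X]mulrC -ler_pdivrMr//.
  have h0 : 0 <= S / (15 * t0) by rewrite divr_ge0 ?snum_ge0// ltW.
  have /andP[_ /ltW h] := truncn_itv h0; apply: (le_trans h).
  by rewrite -natrX ler_nat ltnW// ltn_expl.
have /choice[M hM] : forall i, exists M0, forall M, (M0 <= M)%N -> forall u, nsq (Qop phi u -
    Qop (fun x => phi x * ind `]dyadic (2 ^- M) 0, dyadic (2 ^- M) (M + M)]%classic x) u)
    <= dyadic t0 i ^+ 2 * nsq u.
  by move=> i; apply: Qop_truncation => //; rewrite exprn_gt0// dyadic_gt0.
pose m := (\sum_(i < n) M i)%N.
have Mm i : (i < n)%N -> (M i <= m)%N.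
  by move=> ni; rewrite /m (bigD1 (Ordinal ni))//= leq_addr.
have delta0 : 0 < 2 ^- m :> R by rewrite invr_gt0 exprn_gt0.
pose w (j : 'I_(m + m)) := Num.sqrt (weight (2 ^- m) phi j).
have w2 j : w j ^+ 2 = weight (2 ^- m) phi j by rewrite sqr_sqrtr// weight_ge0.
have main := @layer_cake_level R p (snum (Qop phi)) K B t0 n (m + m) w p1
  (snum_ge0 (Qop phi)) t00 (fun j => sqrtr_ge0 _).
apply: le_trans (main _ _ _) _.
- apply: le_trans (hB _ (m + m)%N delta0); apply: ler_sum => j _.
  by rewrite /w -powR12_sqrt ?weight_ge0// -powRrM mulrC.
- move=> i N ni hN; apply: (Qop_singular hphi delta0 (dyadic_gt0 t00 i) (hM i m (Mm i ni))).
  apply: le_trans hN; rewrite le_eqVlt; apply/orP; left; apply/eqP; apply: eq_bigl => j.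
  by rewrite -w2 ltr_pXn2r// nnegrE ?sqrtr_ge0// ltW// dyadic_gt0.
- by move=> k _; exact: sn.
rewrite addrC lerD2l tE -powRrM mulVf ?gt_eqF// powRr1 ?(ltW eK)//.
by rewrite mulrCA ger_pMr// ler_pdivrMr// mul1r ler_nat.
Qed.

End Levels.

(** * Operators of class p *)

Section SchattenBounds.
Variable R : realType.
Local Notation ip := (@L2ip R).
Local Notation op := (@integral_operator R).
Variable p : R.
Hypotheses (p1 : 1 < p) (p2 : p <= 2).
Implicit Types T : L2 R -> L2 R.

Let p0 : 0 < p. Proof. exact: lt_trans p1. Qed.
Definition power_sum T : \bar R := (\sum_(0 <= n <oo) singular_number T n `^ p)%E.

Let term_ge0 T n : (0 <= singular_number T n `^ p)%E.
Proof. exact: poweR_ge0. Qed.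

Lemma power_sum_ge0 T : (0 <= power_sum T)%E.
Proof. by apply: nneseries_ge0 => n _ _; exact: term_ge0. Qed.

Lemma power_sum_partial T n : bounded_operator T ->
  (\sum_(0 <= i < n) singular_number T i `^ p)%E = (\sum_(i < n) snum T i `^ p)%:E.
Proof.
move=> bT; rewrite big_mkord -sumEFin; apply: eq_bigr => i _.
by rewrite -snumE// poweR_EFin.
Qed.

Lemma schatten_power_sum T : schatten p T -> bounded_operator T /\
  power_sum T \is a fin_num.
Proof.
move=> [bT Toe]; split => //; rewrite ge0_fin_numE ?power_sum_ge0//.
by apply: lty_poweRy Toe; rewrite invr_eq0 gt_eqF.
Qed.

Lemma sum_snum_le T n : schatten p T ->
  \sum_(i < n) snum T i `^ p <= fine (power_sum T).
Proof.
move=> /schatten_power_sum[bT fT]; rewrite -lee_fin fineK// -power_sum_partial//.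
by apply: nneseries_lim_ge => i _ _; exact: term_ge0.
Qed.

Lemma power_sum_le T (b : R) : bounded_operator T ->
  (forall n, \sum_(i < n) snum T i `^ p <= b) -> (power_sum T <= b%:E)%E.
Proof.
move=> bT Tb; apply: lime_le; first by apply: is_cvg_nneseries => i _ _; exact: term_ge0.
by apply: nearW => n; rewrite power_sum_partial// lee_fin.
Qed.

(** Since [p <= 2], the squares of the singular numbers are at most their
    powers [p] times [snum T 0 `^ (2 - p)]; hence [T] is Hilbert--Schmidt. *)
Lemma schatten_kernel T : schatten p T ->
  L2_kernels (kernel_of T) /\ T = op (kernel_of T).
Proof.
move=> ST; have [bT fT] := schatten_power_sum ST; apply: kernel_ofP.
apply: (@hilbert_schmidt_kernel R T (fine (power_sum T) * snum T 0 `^ (2 - p))) => // n.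
apply: (@le_trans _ _ ((\sum_(i < n) snum T i `^ p) * snum T 0 `^ (2 - p))); last first.
  by apply: ler_wpM2r; [exact: powR_ge0|exact: sum_snum_le].
rewrite mulr_suml; apply: ler_sum => i _.
have -> : snum T i ^+ 2 = snum T i `^ p * snum T i `^ (2 - p).
  rewrite -powR_mulrn ?snum_ge0// -powRD addrCA subrr addr0 ?pnatr_eq0//.
apply: ler_wpM2l; first exact: powR_ge0.
apply: ge0_ler_powR; rewrite ?nnegrE ?snum_ge0 ?subr_ge0//.
exact: snum_le0.
Qed.

Lemma symbol_of_schatten T : schatten p T -> symbol (averaged_symbol (kernel_of T)).
Proof. by move=> /schatten_kernel[k2 _]; exact: symbol_averaged. Qed.

Definition projection_constant : R := layer_constant p * (2 * 64 `^ (p / 2)).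

Lemma projection_constant_ge0 : 0 <= projection_constant.
Proof.
have q1 : 1 <= 2 `^ (p - 1) :> R.
  by rewrite -[leLHS](powRr0 2); apply: ler_powR; rewrite ?ler1n// subr_ge0 ltW.
by rewrite /projection_constant /layer_constant !mulr_ge0 ?powR_ge0 ?invr_ge0 ?subr_ge0.
Qed.

Lemma averaging_power_sum T : schatten p T ->
  bounded_operator (averaging_projection T) /\
  (power_sum (averaging_projection T) <= projection_constant%:E * power_sum T)%E.
Proof.
move=> ST; have [bT fT] := schatten_power_sum ST; have [k2 TE] := schatten_kernel ST.
have hphi := symbol_of_schatten ST.
have bQ : bounded_operator (averaging_projection T).
  by apply: op_bounded; exact: sqint_max_kernel.
split => //; rewrite -[in leRHS](fineK fT) -EFinM; apply: power_sum_le => // n.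
have -> : projection_constant * fine (power_sum T) =
    layer_constant p * (2 * (64 `^ (p / 2) * fine (power_sum T))).
  by rewrite /projection_constant; move: (layer_constant p) => L; ring.
apply: (Qop_sum_singular n p1 hphi) => delta J delta0.
apply: weights_averaged => // I h g bh bg; rewrite -TE.
apply: le_trans (sum_snum_le #|I| ST).
apply: diagonal_bound => //; first by case: bT.
- exact: snum_ge0.
- exact: snum_approximable.
Qed.

End SchattenBounds.

(** * The averaging projection *)

Theorem theorem11p1 (R : realType) (p : R) (hp1 : 1 < p) (hp2 : p <= 2) :
  [/\ forall T : L2 R -> L2 R,
        schatten p T -> schatten p (averaging_projection T),
      forall (a : R[i]) (S T : L2 R -> L2 R),
        schatten p S -> schatten p T ->
        averaging_projection (a *: S + T) =
          a *: averaging_projection S + averaging_projection T,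
      forall T : L2 R -> L2 R, schatten p T ->
        averaging_projection (averaging_projection T) = averaging_projection T
    & exists C : R, forall T : L2 R -> L2 R, schatten p T ->
        (schatten_norm p (averaging_projection T) <= C%:E * schatten_norm p T)%E].
Proof.
have p0 : 0 < p by exact: lt_trans hp1.
have c0 : (0 <= (projection_constant p)%:E)%E by rewrite lee_fin projection_constant_ge0.
have bound (T : L2 R -> L2 R) : schatten p T -> (schatten_norm p (averaging_projection T) <=
    (projection_constant p `^ p^-1)%:E * schatten_norm p T)%E.
  move=> ST; have [_ h] := averaging_power_sum hp1 hp2 ST.
  rewrite -poweR_EFin /schatten_norm -poweRM ?power_sum_ge0//; apply: gt0_ler_poweR => //.
  - by rewrite invr_ge0 ltW.
  - by rewrite in_itv /= leey power_sum_ge0.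
  - by rewrite in_itv /= leey andbT mule_ge0// power_sum_ge0.
split.
- move=> T ST; have [bQ _] := averaging_power_sum hp1 hp2 ST; split => //.
  apply: (le_lt_trans (bound T ST)); have [_ Toe] := ST.
  by rewrite lte_mul_pinfty// ?lee_fin ?powR_ge0// ge0_fin_numE// poweR_ge0.
- move=> a S T SS ST.
  have [k1 SE] := schatten_kernel hp1 hp2 SS; have [k2 TE] := schatten_kernel hp1 hp2 ST.
  have k12 : L2_kernels (fun z => a * kernel_of S z + kernel_of T z).
    exact: sqint2D (sqint2Z a k1) k2.
  have E : a *: S + T = integral_operator (fun z => a * kernel_of S z + kernel_of T z).
    apply/funext => u; apply: esym; apply: (etrans (opD u (sqint2Z a k1) k2)).
    apply: congr2; last by rewrite -TE.
    by apply: (etrans (opZ a u k1)); rewrite -SE.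
  have [k3 E3] : L2_kernels (kernel_of (a *: S + T)) /\ a *: S + T = integral_operator (kernel_of (a *: S + T)).
    by apply: kernel_ofP; exists (fun z => a * kernel_of S z + kernel_of T z).
  have h1 := symbol_averaged k1; have h2 := symbol_averaged k2.
  apply: etrans (Qop_linear a h1 h2).
  apply: (eq_Qop (symbol_averaged k3) (symbol_linear a h1 h2)).
  apply: (averaged_symbol_linear k1 k2 k3) => u.
  apply: (etrans (esym (congr1 (fun F => F u) E3))).
  by rewrite -SE -TE.
- move=> T ST; have hphi := symbol_of_schatten hp1 hp2 ST.
  have kmax := sqint_max_kernel hphi.
  set phi := averaged_symbol (kernel_of T) in hphi kmax.
  have QE : averaging_projection T = Qop phi by [].
  have [k' E'] : L2_kernels (kernel_of (Qop phi)) /\ Qop phi = integral_operator (kernel_of (Qop phi)).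
    by apply: kernel_ofP; exists (max_kernel phi).
  rewrite QE; apply: (eq_Qop (symbol_averaged k') hphi).
  (* [Qop phi] may be represented by another kernel than [max_kernel phi]; both
     have the same operator, hence the same symbol almost everywhere. *)
  have h u : integral_operator (kernel_of (Qop phi)) u =
      0 *: integral_operator (max_kernel phi) u + integral_operator (max_kernel phi) u.
    by rewrite scale0r add0r -E'.
  apply: filterS (averaged_symbol_linear kmax kmax k' h) => x hx Dx.
  by apply: (etrans (hx Dx)); rewrite mul0r add0r; exact: averaged_symbol_max_kernel.
- by exists (projection_constant p `^ p^-1).
Qed.
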